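(* Let $n, c\ge 1$ be integers. The sequence $$\mathcal L(\Gamma_*(IA_{F_{n,c}}))\xrightarrow{\ i_*\ }\mathcal L(\mathcal A_*(F_{n,c}))\cong\mathrm{Der}(\mathfrak L_{\leq c}V)\xrightarrow{\ \mathrm{Tr}\ }C_{<c}V\longrightarrow0$$ is always a complex, and it is exact for $n\geq c+1$.
   Context: $F_n$ is the free group of rank $n$, $F_{n,c}=F_n/\Gamma_{c+1}(F_n)$ the free $c$-nilpotent group, where $\Gamma_*$ denotes lower central series. $IA_{F_{n,c}}$ is the group of automorphisms of $F_{n,c}$ acting trivially on its abelianization $V=F_n^{ab}\cong\mathbb Z^n$. $\mathcal A_j(F_{n,c})$ is the group of automorphisms of $F_{n,c}$ acting trivially on $F_{n,c}/\Gamma_{j+1}(F_{n,c})$; $\mathcal A_1(F_{n,c})=IA_{F_{n,c}}$ and $\Gamma_j(IA_{F_{n,c}})\subseteq\mathcal A_j(F_{n,c})$. For a filtration $G_*$ with $[G_i,G_j]\subseteq G_{i+j}$, $\mathcal L(G_* )=\bigoplus_{i\geq1}G_i/G_{i+1}$ is the associated graded Lie ring. The map $i_*$ is induced by the inclusions $\Gamma_j(IA_{F_{n,c}})\subseteq\mathcal A_j(F_{n,c})$, $j\geq1$. $\mathfrak LV$ is the free Lie ring on $V$, $\mathfrak L_jV$ its degree $j$ part, and $\mathfrak L_{\leq c}V=\mathfrak LV/\bigoplus_{j>c}\mathfrak L_jV$. $\mathrm{Der}(\mathfrak L_{\leq c}V)$ is the graded Lie ring of graded derivations (in degrees at least one),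 a derivation of degree $k$ being one that raises degrees by $k$. The isomorphism $\mathcal L(\mathcal A_*(F_{n,c}))\cong\mathrm{Der}(\mathfrak L_{\leq c}V)$ is the Johnson morphism, sending the class of $\sigma\in\mathcal A_k(F_{n,c})$ to the derivation of degree $k$ induced by $x\mapsto\sigma(x)x^{-1}$. In degree $k$ with $1\leq k\leq c-1$, $\mathrm{Der}_k(\mathfrak L_{\leq c}V)\cong V^*\otimes\mathfrak L_{k+1}V$. $C_kV=V^{\otimes k}/(\mathbb Z/k)$ is the module of coinvariants of $V^{\otimes k}$ under cyclic permutation of factors, $C_{<c}V$ is the part of $C_*V=\bigoplus_{k\geq1}C_kV$ in degrees $<c$, and $\mathrm{Tr}$ is in degree $k$ the composite $V^*\otimes\mathfrak L_{k+1}V\hookrightarrow V^*\otimes V^{\otimes k+1}\xrightarrow{\Phi}V^{\otimes k}\twoheadrightarrow C_kV$, where $\mathfrak L_{k+1}V\subseteq V^{\otimes k+1}$ canonically and $\Phi(\alpha\otimes v_1\cdots v_{k+1})=\alpha(v_{k+1})v_1\cdots v_k$.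
   Formalization: The target C_{<c}V and Tr are taken in degrees 2 ≤ k < c only: in degree 1, Γ_1(IA)=A_1, so i_* is onto, yet Tr(e_1^*⊗[e_1,e_2]) = −e_2 ≠ 0 in C_1V, so for n,c ≥ 2 the sequence with C_1V included is not a complex. *)

(* Defs.v *)
From HB Require Import structures.
From mathcomp Require Import all_boot all_order all_algebra ssrAC ring_quotient.
From mathcomp Require Import boolp classical_sets functions.
From mathcomp.multinomials Require Import monalg.

Set Implicit Arguments.
Unset Strict Implicit.
Unset Printing Implicit Defensive.

Import GRing.Theory.
Local Open Scope classical_set_scope.
Local Open Scope quotient_scope.
Local Open Scope group_scope.

Section Subgroups.
Variable G : groupType.
Implicit Types (x y z : G) (H K : set G).

Definition is_subgroup H :=
  [/\ H 1, forall x y, H x -> H y -> H (x * y) & forall x, H x -> H x^-1].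

Inductive gen (S : set G) : G -> Prop :=
| gen_in x : S x -> gen S x
| gen1 : gen S 1
| genM x y : gen S x -> gen S y -> gen S (x * y)
| genV x : gen S x -> gen S x^-1.

Definition commsub H K : set G :=
  gen [set z | exists x y, [/\ H x, K y & z = [~ x, y]]].

(* lcs H k = Gamma_k(H) for k >= 1; the value at k = 0 is H, by convention. *)
Definition lcs H k : set G := iter k.-1 (fun K => commsub K H) H.

Definition normalized_by H K := forall x y, H x -> K y -> K (y ^ x).

Lemma gen_subgroup S : is_subgroup (gen S).
Proof. by split; [exact: gen1|exact: genM|exact: genV]. Qed.

Lemma gen_sub S H : is_subgroup H -> S `<=` H -> gen S `<=` H.
Proof.
by move=> [H1 HM HV] SH x; elim=> {x} [x /SH||x y _ Hx _ Hy|x _ /HV] //; apply: (HM).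
Qed.

Lemma lcsSS H k : lcs H k.+2 = commsub (lcs H k.+1) H.
Proof. by []. Qed.

Section Lcs.
Variable H : set G.
Hypothesis sgH : is_subgroup H.

Lemma lcs_subgroup k : is_subgroup (lcs H k).
Proof. by case: k => [|[|k]] //; rewrite lcsSS; apply: gen_subgroup. Qed.

Lemma lcs_norm k : normalized_by H (lcs H k).
Proof.
have [H1 HM HV] := sgH.
have nH : normalized_by H H by move=> x y Hx Hy; apply: (HM); [apply: (HV)|apply: (HM)].
case: k => [//|k]; elim: k => [//|k IH] x y Hx.
rewrite lcsSS; elim=> {y}.
- move=> _ [a [b [Ka Hb ->]]]; rewrite conjRg; apply: gen_in.
  by exists (a ^ x), (b ^ x); split; [apply: IH|apply: nH|].
- by rewrite conj1g; apply: gen1.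
- by move=> a b _ Ka _ Kb; rewrite conjMg; apply: genM.
- by move=> a _ Ka; rewrite conjVg; apply: genV.
Qed.

Lemma lcsS k : lcs H k.+1 `<=` lcs H k.
Proof.
case: k => [//|k]; rewrite lcsSS; apply: gen_sub; first exact: lcs_subgroup.
move=> _ [x [y [Kx Hy ->]]]; rewrite commgEl.
have [_ KM KV] := lcs_subgroup k.+1.
by apply: KM; [apply: KV|apply: lcs_norm].
Qed.

Lemma lcs_sub k : lcs H k `<=` H.
Proof. by elim: k => [//|k IH] x /lcsS /IH. Qed.

Lemma lcs_sub_comm N i b : is_subgroup N -> normalized_by H N -> H b ->
  (forall a, lcs H i a -> N [~ a, b]) -> forall a, lcs H i a -> N [~ a, b^-1].
Proof.
move=> [N1 NM NV] nN Hb h a Ka.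
have -> : [~ a, b^-1] = ([~ a, b] ^ b^-1)^-1.
  by rewrite !commgEl !conjgE !gnorm.
have [_ _ HV] := sgH.
by apply: (NV); apply: (nN); [apply: (HV)|apply: (h)].
Qed.

Lemma hall_witt x y z :
  [~ x, y^-1, z] ^ y * [~ y, z^-1, x] ^ z * [~ z, x^-1, y] ^ x = 1.
Proof. by rewrite !commgEl !conjgE !gnorm. Qed.

Lemma lcs_comm i j x y :
  lcs H i x -> lcs H j y -> lcs H (i + j) [~ x, y].
Proof.
have [H1 HM HV] := sgH.
have base k a b : lcs H k a -> H b -> lcs H k.+1 [~ a, b].
  case: k => [|k] Ka Hb; last by rewrite lcsSS; apply: gen_in; exists a, b.
  by rewrite commgEl; apply: (HM); [apply: (HV)|do 2?apply: (HM) => //; apply: (HV)].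
case: j => [|j].
  by move=> Kx Hy; rewrite addn0; apply: lcsS; apply: base.
elim: j i x y => [|j IH] i x y Kx; first by rewrite addn1; apply: base.
rewrite lcsSS addnS => Ky.
set N := lcs H (i + j.+1).+1.
have sgN : is_subgroup N by apply: lcs_subgroup.
have nN : normalized_by H N by apply: lcs_norm.
have [N1 NM NV] := sgN.
suff [_ Ny] : H y /\ forall x, lcs H i x -> N [~ x, y] by exact: Ny.
elim: Ky => {x y Kx} [_ [y [z [Ky Hz ->]]]||y z _ [Hy Ny] _ [Hz Nz]|y _ [Hy Ny]].
- have Hy := lcs_sub Ky.
  split=> [|x Kx]; first by rewrite commgEl; do !apply: (HM) => //; apply: (HV).
  have Hx := lcs_sub Kx.
  rewrite -invgR; apply: (NV).
  have hw := hall_witt x y z^-1; rewrite invgK in hw.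
  have Kyx : N [~ x, y^-1, z^-1].
    apply: base; last exact: HV.
    by apply: IH => //; have [_ _] := lcs_subgroup j.+1; apply.
  have Kzx : N [~ z^-1, x^-1, y].
    rewrite /N -addSn; apply: IH => //.
    rewrite -invgR; have [_ _] := lcs_subgroup i.+1; apply.
    by apply: base; [have [_ _] := lcs_subgroup i; apply|apply: (HV)].
  have -> : [~ y, z, x] =
     ((([~ x, y^-1, z^-1] ^ y)^-1 * ([~ z^-1, x^-1, y] ^ x)^-1)) ^ z.
    apply: (can_inj (conjgK z^-1)); rewrite -conjgM mulgV conjg1.
    by apply: (mulgI ([~ x, y^-1, z^-1] ^ y)); apply: (mulIg ([~ z^-1, x^-1, y] ^ x)); rewrite hw !gnorm.
  by apply: (nN) => //; apply: (NM); apply: (NV); apply: (nN).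
- by split=> // x _; rewrite commg1.
- split=> [|x Kx]; first exact: HM.
  have -> : [~ x, y * z] = [~ x, z] * [~ x, y] ^ z.
    by rewrite !commgEl !conjgE !gnorm.
  by apply: (NM); [apply: Nz|apply: (nN) => //; apply: Ny].
- by split; [apply: (HV)|apply: lcs_sub_comm].
Qed.

End Lcs.
End Subgroups.

(* A filtration F_1, F_2, ... with [F_i, F_j] included in F_{i+j}. The term F_0
   only serves to start the indexing at 0: it plays no role in lgr below. *)
Record nseries (G : groupType) := NSeries {
  nser :> nat -> set G;
  nser_sg : forall i, is_subgroup (nser i);
  nserS : forall i, nser i.+1 `<=` nser i;
  nserR : forall i j x y, nser i x -> nser j y -> nser (i + j) [~ x, y] }.

Definition lcs_series (G : groupType) (H : set G) (sgH : is_subgroup H) :=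
  NSeries (lcs_subgroup sgH) (lcsS sgH) (lcs_comm sgH).

Lemma setT_subgroup (G : groupType) : is_subgroup [set: G].
Proof. by []. Qed.

Definition Gamma (G : groupType) : nseries G := lcs_series (setT_subgroup G).

Lemma lcs_sub_nseries (G : groupType) (F : nseries G) k : lcs (F 1%N) k `<=` F k.
Proof.
case: k => [|k]; first exact: nserS.
elim: k => [//|k IH]; rewrite lcsSS; apply: gen_sub; first exact: nser_sg.
by move=> _ [x [y [/IH Fx Fy ->]]]; rewrite -addn1; apply: nserR.
Qed.

Record normal_subgroup (G : groupType) := NormalSubgroup {
  nsub :> G -> Prop;
  nsub_sg : is_subgroup nsub;
  nsub_norm : normalized_by [set: G] nsub }.

Section QuotientGroup.
Variables (G : groupType) (N : normal_subgroup G).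

Let N1 : N 1. Proof. by case: (nsub_sg N). Qed.
Let NM x y : N x -> N y -> N (x * y). Proof. by case: (nsub_sg N) => _ /(_ x y). Qed.
Let NV x : N x -> N x^-1. Proof. by case: (nsub_sg N) => _ _ /(_ x). Qed.
Let NJ x y : N y -> N (y ^ x). Proof. by apply: nsub_norm. Qed.

Definition qequiv (x y : G) : bool := `[< N (x^-1 * y) >].

Lemma qequiv_equiv : equiv_class_of qequiv.
Proof.
split=> [x|x y|y x z].
- by apply/asboolP; rewrite mulVg.
- by apply: asbool_equiv_eq; split=> /NV; rewrite invgM invgK.
- move=> /asboolP xy /asboolP yz; apply/asboolP.
  have -> : x^-1 * z = x^-1 * y * (y^-1 * z) by rewrite !gnorm.
  exact: NM.
Qed.
Canonical qequiv_rel := EquivRelPack qequiv_equiv.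
Canonical qequiv_enc := defaultEncModRel qequiv.

Definition quotg := {eq_quot qequiv}.
HB.instance Definition _ := Choice.on quotg.

Definition qpi (x : G) : quotg := (\pi_quotg x)%qT.

Lemma qpiP x y : qpi x = qpi y <-> N (x^-1 * y).
Proof. by rewrite (rwP eqP) (rwP (asboolP (N _))) /qpi eqmodE. Qed.

Lemma qpi_repr (q : quotg) : qpi (repr q) = q. Proof. exact: reprK. Qed.

Lemma qrepr_pi x : N ((repr (qpi x))^-1 * x).
Proof. by apply/qpiP; rewrite qpi_repr. Qed.

Definition qmul (a b : quotg) := qpi (repr a * repr b).
Definition qinv (a : quotg) := qpi (repr a)^-1.

Lemma qmulE x y : qmul (qpi x) (qpi y) = qpi (x * y).
Proof.
apply/qpiP; rewrite invgM.
set b := repr _; set a := repr _.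
have -> : b^-1 * a^-1 * (x * y) = (b^-1 * y) * (a^-1 * x) ^ y.
  by rewrite conjgE !gnorm.
by apply: (NM); [|apply: NJ]; apply: qrepr_pi.
Qed.

Lemma qinvE x : qinv (qpi x) = qpi x^-1.
Proof.
apply/qpiP; set a := repr _.
have -> : a^-1^-1 * x^-1 = ((a^-1 * x) ^ a^-1)^-1 by rewrite conjgE !gnorm.
by apply/NV/NJ/qrepr_pi.
Qed.

Lemma qmulA : associative qmul.
Proof.
by move=> a b c; rewrite -[a]qpi_repr -[b]qpi_repr -[c]qpi_repr !qmulE mulgA.
Qed.
Lemma qmul1 : left_id (qpi 1) qmul.
Proof. by move=> a; rewrite -[a]qpi_repr !qmulE mul1g. Qed.
Lemma qmulr1 : right_id (qpi 1) qmul.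
Proof. by move=> a; rewrite -[a]qpi_repr !qmulE mulg1. Qed.
Lemma qmulV : left_inverse (qpi 1) qinv qmul.
Proof. by move=> a; rewrite -[a]qpi_repr qinvE !qmulE mulVg. Qed.
Lemma qmulrV : right_inverse (qpi 1) qinv qmul.
Proof. by move=> a; rewrite -[a]qpi_repr qinvE !qmulE mulgV. Qed.

HB.instance Definition _ := isGroup.Build quotg qmulA qmul1 qmulr1 qmulV qmulrV.

Lemma qpiM x y : qpi (x * y) = qpi x * qpi y. Proof. by rewrite -qmulE. Qed.
Lemma qpi1 : qpi 1 = 1. Proof. by []. Qed.
Lemma qpiV x : qpi x^-1 = (qpi x)^-1. Proof. by rewrite -qinvE. Qed.
Lemma qpiR x y : qpi [~ x, y] = [~ qpi x, qpi y].
Proof. by rewrite /commg /conjg !(qpiM, qpiV). Qed.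
End QuotientGroup.

Section Aut.
Variable G : groupType.

Definition is_autpair (p : (G -> G) * (G -> G)) : bool :=
  `[< [/\ {morph p.1 : x y / x * y}, cancel p.1 p.2 & cancel p.2 p.1] >].

(* An automorphism is recorded together with its (unique) inverse. *)
Definition aut := {p : (G -> G) * (G -> G) | is_autpair p}.
HB.instance Definition _ := Choice.on aut.

Definition autfun (s : aut) : G -> G := (val s).1.
Definition autinv (s : aut) : G -> G := (val s).2.
Coercion autfun : aut >-> Funclass.

Lemma autM (s : aut) : {morph s : x y / x * y}.
Proof. by case: s => p pP; case/asboolP: (pP). Qed.
Lemma autK (s : aut) : cancel s (autinv s).
Proof. by case: s => p pP; case/asboolP: (pP). Qed.
Lemma autKV (s : aut) : cancel (autinv s) s.
Proof. by case: s => p pP; case/asboolP: (pP). Qed.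

Lemma autP (s t : aut) : s =1 t -> s = t.
Proof.
move=> st; apply/val_inj; rewrite [val s]surjective_pairing [val t]surjective_pairing.
congr pair; apply/funext => x; first exact: st.
by rewrite -[RHS](autK s) st autKV.
Qed.

Fact aut1_subproof : is_autpair (id, id). Proof. by apply/asboolP. Qed.
Definition aut1 : aut := Sub (id, id) aut1_subproof.

Fact autmul_subproof (s t : aut) : is_autpair (s \o t, autinv t \o autinv s).
Proof.
apply/asboolP; split=> [x y|x|x] /=; first by rewrite !autM.
- by rewrite !autK.
- by rewrite !autKV.
Qed.
Definition autmul (s t : aut) : aut := Sub (s \o t, autinv t \o autinv s) (autmul_subproof s t).

Fact autV_subproof (s : aut) : is_autpair (autinv s, autfun s).
Proof.
apply/asboolP; split=> [x y|x|x] /=; rewrite ?autK ?autKV //.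
by apply: (can_inj (autK s)); rewrite autM !autKV.
Qed.
Definition autV (s : aut) : aut := Sub (autinv s, autfun s) (autV_subproof s).

Lemma autmulA : associative autmul. Proof. by move=> s t u; apply: autP. Qed.
Lemma autmul1 : left_id aut1 autmul. Proof. by move=> s; apply: autP. Qed.
Lemma autmulr1 : right_id aut1 autmul. Proof. by move=> s; apply: autP. Qed.
Lemma autmulV : left_inverse aut1 autV autmul.
Proof. by move=> s; apply: autP => x; apply: autK. Qed.
Lemma autmulrV : right_inverse aut1 autV autmul.
Proof. by move=> s; apply: autP => x; apply: autKV. Qed.

HB.instance Definition _ :=
  isGroup.Build aut autmulA autmul1 autmulr1 autmulV autmulrV.

Lemma autmE (s t : aut) x : (s * t : aut) x = s (t x). Proof. by []. Qed.
Lemma aut1E x : (1 : aut) x = x. Proof. by []. Qed.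
Lemma aut_1 (s : aut) : s 1 = 1.
Proof. by apply: (mulgI (s 1)); rewrite -autM !mulg1. Qed.
Lemma aut_V (s : aut) x : s x^-1 = (s x)^-1.
Proof. by apply: (mulgI (s x)); rewrite -autM !mulgV aut_1. Qed.
Lemma aut_R (s : aut) x y : s [~ x, y] = [~ s x, s y].
Proof. by rewrite /commg /conjg !(autM, aut_V). Qed.

Local Notation "'G_ k" := (@lcs G setT k) (at level 8, k at level 2).

Definition autfil (j : nat) : set aut :=
  [set s | forall x, 'G_j.+1 (s x * x^-1)].

Let sgT := setT_subgroup G.
Let g1 k : 'G_k 1. Proof. by case: (lcs_subgroup sgT k). Qed.
Let gM k x y : 'G_k x -> 'G_k y -> 'G_k (x * y).
Proof. by case: (lcs_subgroup sgT k) => _ h _; apply: (h). Qed.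
Let gV k x : 'G_k x -> 'G_k x^-1.
Proof. by case: (lcs_subgroup sgT k) => _ _ h; apply: (h). Qed.
Let gJ k x y : 'G_k x -> 'G_k (x ^ y).
Proof. by apply: lcs_norm. Qed.

Lemma aut_lcs (s : aut) k x : 'G_k x -> 'G_k (s x).
Proof.
case: k => [//|k]; elim: k x => [//|k IH] x; rewrite lcsSS.
elim=> {x} [_ [x [y [Kx _ ->]]]||x y _ Kx _ Ky|x _ Kx].
- by rewrite aut_R; apply: gen_in; exists (s x), (s y); split=> //; apply: IH.
- by rewrite aut_1; apply: gen1.
- by rewrite autM; apply: genM.
- by rewrite aut_V; apply: genV.
Qed.

Lemma aut_lcsE (s : aut) k x : 'G_k (s x) -> 'G_k x.
Proof. by move=> /(@aut_lcs s^-1); rewrite -autmE mulVg. Qed.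

Lemma autfil_subgroup j : is_subgroup (autfil j).
Proof.
split=> [x|s t hs ht x|s hs x].
- by rewrite aut1E mulgV; apply: g1.
- rewrite autmE -(mulgVK (autfun t x) (autfun s (autfun t x))) -mulgA; apply: (gM); [exact: hs|exact: ht].
- have := hs ((s^-1 : aut) x); rewrite -autmE mulgV aut1E => h.
  by have := gV h; rewrite invgM invgK.
Qed.

Lemma autfilS j : autfil j.+1 `<=` autfil j.
Proof. by move=> s hs x; apply: (lcsS sgT). Qed.

Lemma autfil_act i j (s : aut) x : autfil i s -> 'G_j.+1 x ->
  'G_(i + j.+1) (s x * x^-1).
Proof.
move=> hs; elim: j x => [|j IH] x; first by move=> _; rewrite addn1; apply: hs.
rewrite lcsSS addnS.
elim=> {x} [_ [x [y [Kx _ ->]]]||x y _ Kx _ Ky|x _ Kx].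
- rewrite aut_R.
  have := IH _ Kx; set u := s x * x^-1 => Ku.
  have := hs y; set v := s y * y^-1 => Kv.
  have -> : s x = u * x by rewrite mulgVK.
  have -> : s y = v * y by rewrite mulgVK.
  have -> : [~ u * x, v * y] * [~ x, y]^-1 =
      [~ u, v * y] ^ x * ([~ x, v] ^ y) ^ [~ x, y]^-1.
    by rewrite /commg !conjgE !gnorm.
  apply: (gM); apply: (gJ).
    by rewrite -addn1; apply: lcs_comm.
  by apply: (gJ); rewrite addnC -addnS; apply: lcs_comm.
- by rewrite aut_1 mulgV; apply: g1.
- rewrite autM.
  have -> : s x * s y * (x * y)^-1 = (s y * y^-1) ^ (s x)^-1 * (s x * x^-1).
    by rewrite conjgE !gnorm.
  by apply: (gM) => //; apply: (gJ).
- rewrite aut_V invgK.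
  have -> : (s x)^-1 * x = ((s x * x^-1) ^ x)^-1.
    by rewrite conjgE !gnorm.
  by apply/gV/gJ.
Qed.

Lemma autfilR i j (s t : aut) : autfil i s -> autfil j t -> autfil (i + j) [~ s, t].
Proof.
move=> hs ht x.
have -> : [~ s, t] = (t * s)^-1 * (s * t) by rewrite /commg conjgE invgM !gnorm.
apply: (@aut_lcsE (t * s)).
rewrite autM aut_V -autmE mulVKg !autmE.
have := hs x; set a := s x * x^-1 => Ka; have := ht x; set b := t x * x^-1 => Kb.
have -> : t x = b * x by rewrite mulgVK.
have -> : s x = a * x by rewrite mulgVK.
have -> : s (b * x) = (s b * b^-1) * b * a * x.
  by rewrite autM /a !gnorm.
have -> : t (a * x) = (t a * a^-1) * a * b * x.
  by rewrite autM /b !gnorm.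
have Kb' := autfil_act hs Kb; have Ka' := autfil_act ht Ka.
rewrite addnS in Kb'; rewrite addnS addnC in Ka'.
set p := s b * _ in Kb' *; set q := t a * _ in Ka' *.
have -> : p * b * a * x * (q * a * b * x)^-1 = p * [~ b^-1, a^-1] * q^-1.
  by rewrite /commg conjgE !gnorm.
apply: (gM); last exact: gV.
apply: (gM) => //; apply: (lcsS sgT).
rewrite addnC -addnS -addSn; apply: lcs_comm => //; exact: gV.
Qed.

(* A_j(G): the automorphisms acting trivially on G / Gamma_{j+1}(G). *)
Definition autseries : nseries aut := NSeries autfil_subgroup autfilS autfilR.

End Aut.

Definition IA (G : groupType) : set (aut G) := autseries G 1%N.
Definition GammaIA (G : groupType) : nseries (aut G) :=
  lcs_series (nser_sg (autseries G) 1%N).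

Lemma GammaIA_sub (G : groupType) k : GammaIA G k `<=` autseries G k.
Proof. exact: lcs_sub_nseries. Qed.


Section FreeGroup.
Variable n : nat.
Local Notation letter := ('I_n * bool)%type.
Implicit Types (a b : letter) (u v w : seq letter).

(* (i, true) is the generator x_i and (i, false) its inverse. *)
Definition linv a : letter := (a.1, ~~ a.2).
Definition reduced w := sorted (fun a b => b != linv a) w.
Definition lcons a w :=
  if w is b :: w' then if b == linv a then w' else a :: w else [:: a].
Definition lcat u v := foldr lcons v u.

Lemma linvK : involutive linv. Proof. by case=> i b; rewrite /linv /= negbK. Qed.

Lemma lcons_red a w : reduced w -> reduced (lcons a w).
Proof.
case: w => [//|b w] /= rw; case: ifPn => [_|]; first exact: path_sorted rw.
by rewrite /= => ->.
Qed.

Lemma lconsE a w : reduced (a :: w) -> lcons a w = a :: w.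
Proof. by case: w => [//|b w] /= /andP [/negPf ->]. Qed.

Lemma lconsK a w : reduced w -> lcons (linv a) (lcons a w) = w.
Proof.
case: w => [_|b w rw] /=; first by rewrite linvK eqxx.
case: ifPn => [/eqP <-|_] /=; last by rewrite linvK eqxx.
exact: lconsE.
Qed.

Lemma lcat_red u v : reduced v -> reduced (lcat u v).
Proof. by move=> rv; elim: u => [//|a u IH]; apply: lcons_red. Qed.

Lemma lcat_lcons a u v : reduced v -> lcat (lcons a u) v = lcons a (lcat u v).
Proof.
move=> rv; case: u => [//|b u] /=; case: ifPn => [/eqP ->|//].
by have := lconsK (linv a) (lcat_red u rv); rewrite linvK => ->.
Qed.

Lemma lcatA u v w : reduced w -> lcat u (lcat v w) = lcat (lcat u v) w.
Proof. by move=> rw; elim: u => [//|a u IH] /=; rewrite lcat_lcons // IH. Qed.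

Lemma lcat0 u : reduced u -> lcat u [::] = u.
Proof.
elim: u => [//|a u IH] ru /=; rewrite IH ?lconsE //; exact: path_sorted ru.
Qed.

Definition winv u := rev (map linv u).

Lemma winv_red u : reduced u -> reduced (winv u).
Proof.
rewrite /reduced /winv rev_sorted sorted_map; apply: sub_sorted => a b /=.
by apply: contra => /eqP/(can_inj linvK) ->; rewrite linvK.
Qed.

Lemma winvK : involutive winv.
Proof. by move=> u; rewrite /winv map_rev revK -map_comp map_id_in // => a _ /=; rewrite linvK. Qed.

Lemma lcat_winv u : lcat (winv u) u = [::].
Proof.
elim: u => [//|a u IH]; rewrite /lcat /winv /= rev_cons foldr_rcons /= linvK eqxx.
exact: IH.
Qed.

Definition free_group := {w : seq letter | reduced w}.
HB.instance Definition _ := Choice.on free_group.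

Definition fg_one : free_group := Sub [::] isT.
Definition fg_mul (u v : free_group) : free_group :=
  Sub (lcat (val u) (val v)) (lcat_red (val u) (valP v)).
Definition fg_inv (u : free_group) : free_group :=
  Sub (winv (val u)) (winv_red (valP u)).

Lemma fg_mulA : associative fg_mul.
Proof. by move=> u v w; apply: val_inj; rewrite /= lcatA // (valP w). Qed.
Lemma fg_mul1 : left_id fg_one fg_mul.
Proof. by move=> u; apply: val_inj. Qed.
Lemma fg_mulr1 : right_id fg_one fg_mul.
Proof. by move=> u; apply: val_inj; rewrite /= lcat0 // (valP u). Qed.
Lemma fg_mulV : left_inverse fg_one fg_inv fg_mul.
Proof. by move=> u; apply: val_inj; rewrite /= lcat_winv. Qed.
Lemma fg_mulrV : right_inverse fg_one fg_inv fg_mul.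
Proof. by move=> u; apply: val_inj; rewrite /= -{1}(winvK (val u)) lcat_winv. Qed.

HB.instance Definition _ :=
  isGroup.Build free_group fg_mulA fg_mul1 fg_mulr1 fg_mulV fg_mulrV.

Definition fg_gen (i : 'I_n) : free_group := Sub [:: (i, true)] isT.

End FreeGroup.

Definition lcs_normal (G : groupType) k : normal_subgroup G :=
  NormalSubgroup (lcs_subgroup (setT_subgroup G) k)
                 (lcs_norm (setT_subgroup G) (k := k)).

Definition free_nil (n c : nat) : groupType :=
  quotg (lcs_normal (free_group n) c.+1).

Definition fn_gen n c (i : 'I_n) : free_nil n c := qpi _ (fg_gen i).

Lemma lcs_quot (G : groupType) (N : normal_subgroup G) k (y : quotg N) :
  lcs setT k y -> exists2 x, lcs setT k x & qpi N x = y.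
Proof.
case: k => [|k]; first by move=> _; exists (repr y); rewrite ?qpi_repr.
elim: k y => [|k IH] y; first by move=> _; exists (repr y); rewrite ?qpi_repr.
rewrite lcsSS; elim=> {y} [_ [a [b [/IH [x Kx <-] _ ->]]]||a b _ [x Kx <-] _ [y Ky <-]|a _ [x Kx <-]].
- exists [~ x, repr b]; first by apply: gen_in; exists x, (repr b).
  by rewrite qpiR qpi_repr.
- by exists 1; [exact: gen1|].
- by exists (x * y); [exact: genM|rewrite qpiM].
- by exists x^-1; [exact: genV|rewrite qpiV].
Qed.

Lemma free_nil_lcs n c (x : free_nil n c) : lcs setT c.+1 x -> x = 1.
Proof.
case/lcs_quot => y Ky <-; rewrite -qpi1; apply/qpiP; rewrite mulg1.
by case: (lcs_subgroup (setT_subgroup (free_group n)) c.+1) => _ _; apply.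
Qed.


Local Open Scope ring_scope.

HB.mixin Record Zmodule_isLieRing L of GRing.Zmodule L := {
  lbr : L -> L -> L;
  lbrDl : forall x y z, lbr (x + y) z = lbr x z + lbr y z;
  lbrDr : forall x y z, lbr x (y + z) = lbr x y + lbr x z;
  lbrxx : forall x, lbr x x = 0;
  lbr_jacobi : forall x y z,
    lbr (lbr x y) z + lbr (lbr y z) x + lbr (lbr z x) y = 0 }.

#[short(type="lieRingType")]
HB.structure Definition LieRing := {L of Zmodule_isLieRing L & GRing.Zmodule L}.

Section LieRingTheory.
Variable L : lieRingType.
Implicit Types x y z : L.
Lemma lbr0l x : lbr 0 x = 0.
Proof. by apply: (addrI (lbr 0 x)); rewrite -lbrDl !addr0. Qed.
Lemma lbr0r x : lbr x 0 = 0.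
Proof. by apply: (addrI (lbr x 0)); rewrite -lbrDr !addr0. Qed.
Lemma lbrNl x y : lbr (- x) y = - lbr x y.
Proof. by apply: (addrI (lbr x y)); rewrite -lbrDl !subrr lbr0l. Qed.
Lemma lbrNr x y : lbr x (- y) = - lbr x y.
Proof. by apply: (addrI (lbr x y)); rewrite -lbrDr !subrr lbr0r. Qed.
Lemma lbrBl x y z : lbr (x - y) z = lbr x z - lbr y z.
Proof. by rewrite lbrDl lbrNl. Qed.
Lemma lbrBr x y z : lbr x (y - z) = lbr x y - lbr x z.
Proof. by rewrite lbrDr lbrNr. Qed.
End LieRingTheory.

Definition dprod (I : Type) (A : I -> zmodType) : Type := forall i, A i.

Section Dprod.
Variables (I : Type) (A : I -> zmodType).
HB.instance Definition _ := gen_eqMixin (dprod A).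
HB.instance Definition _ := gen_choiceMixin (dprod A).

Let add (f g : dprod A) : dprod A := fun i => f i + g i.
Let opp (f : dprod A) : dprod A := fun i => - f i.
Let zero : dprod A := fun i => 0.
Let addA : associative add.
Proof. by move=> f g h; apply: functional_extensionality_dep => i; apply: addrA. Qed.
Let addC : commutative add.
Proof. by move=> f g; apply: functional_extensionality_dep => i; apply: addrC. Qed.
Let add0 : left_id zero add.
Proof. by move=> f; apply: functional_extensionality_dep => i; apply: add0r. Qed.
Let addN : left_inverse zero opp add.
Proof. by move=> f; apply: functional_extensionality_dep => i; apply: addNr. Qed.
HB.instance Definition _ := GRing.isZmodule.Build (dprod A) addA addC add0 addN.
End Dprod.

Section Dsum.
Variable A : nat -> zmodType.

Definition fin_supp (f : dprod A) : bool :=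
  `[< exists N, forall k, (N <= k)%N -> f k = 0 >].

Lemma fin_supp_zmod_closed : zmod_closed fin_supp.
Proof.
split=> [|f g]; first by apply/asboolP; exists 0%N.
move=> /asboolP [N fN] /asboolP [M gM]; apply/asboolP; exists (maxn N M) => k.
rewrite geq_max => /andP [Nk Mk].
have -> : (f - g) k = f k - g k by [].
by rewrite fN // gM // subrr.
Qed.
HB.instance Definition _ := GRing.isZmodClosed.Build (dprod A) fin_supp
  fin_supp_zmod_closed.

Definition dsum := {f : dprod A | fin_supp f}.
HB.instance Definition _ := SubChoice.on dsum.
HB.instance Definition _ := [SubChoice_isSubZmodule of dsum by <:].

Definition dsum_at (x : dsum) : forall k, A k := val x.

Lemma dsum_atD (x y : dsum) k : dsum_at (x + y) k = dsum_at x k + dsum_at y k. Proof. by []. Qed.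
Lemma dsum_atN (x : dsum) k : dsum_at (- x) k = - dsum_at x k. Proof. by []. Qed.
Lemma dsum_at0 k : dsum_at 0 k = 0. Proof. by []. Qed.
Lemma dsumP (x y : dsum) : (forall k, dsum_at x k = dsum_at y k) -> x = y.
Proof. by move=> xy; apply/val_inj/functional_extensionality_dep. Qed.
Lemma dsum_supp (x : dsum) : exists N, forall k, (N <= k)%N -> dsum_at x k = 0.
Proof. by case: x => f ff; case/asboolP: (ff) => N fN; exists N. Qed.

Definition mkdsum (f : dprod A) (ff : exists N, forall k, (N <= k)%N -> f k = 0) : dsum :=
  Sub f (asboolT ff).
End Dsum.

Inductive zspan (V : zmodType) (S : set V) : V -> Prop :=
| zspan_in x : S x -> zspan S x
| zspan0 : zspan S 0
| zspanB x y : zspan S x -> zspan S y -> zspan S (x - y).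

Section Zspan.
Variables (V : zmodType) (S : set V).
Definition zspanb (x : V) : bool := `[< zspan S x >].
Lemma zspanb_closed : zmod_closed zspanb.
Proof.
split=> [|x y]; first by apply/asboolP/zspan0.
by move=> /asboolP Sx /asboolP Sy; apply/asboolP/zspanB.
Qed.
HB.instance Definition _ := GRing.isZmodClosed.Build V zspanb zspanb_closed.

Lemma zspanN x : zspan S x -> zspan S (- x).
Proof. by move=> Sx; rewrite -sub0r; apply: zspanB => //; apply: zspan0. Qed.
Lemma zspanD x y : zspan S x -> zspan S y -> zspan S (x + y).
Proof. by move=> Sx Sy; rewrite -[y]opprK; apply: zspanB => //; apply: zspanN. Qed.

Definition zquot := Quotient.quot (GRing.ZmodClosed.clone V zspanb _).
HB.instance Definition _ := Choice.on zquot.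
HB.instance Definition _ := GRing.Zmodule.on zquot.

Definition zpi (x : V) : zquot := (\pi_zquot x)%qT.
Lemma zpiP x y : zpi x = zpi y <-> zspan S (x - y).
Proof. by rewrite (rwP eqP) (rwP (asboolP (zspan S _))) /zpi eqmodE. Qed.
Lemma zpi_repr (q : zquot) : zpi (repr q) = q. Proof. exact: reprK. Qed.
Lemma zpiD x y : zpi (x + y) = zpi x + zpi y. Proof. exact: raddfD. Qed.
Lemma zpiB x y : zpi (x - y) = zpi x - zpi y. Proof. exact: raddfB. Qed.
Lemma zpi0 : zpi 0 = 0. Proof. exact: raddf0. Qed.
Lemma zpi_eq0 x : zpi x = 0 <-> zspan S x.
Proof. by rewrite -zpi0 zpiP subr0. Qed.
End Zspan.

Section Gr.
Variables (G : groupType) (F : nseries G).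
Implicit Types (x y z : G) (i j k l : nat).

Lemma nser1 k : F k 1%g. Proof. by case: (nser_sg F k). Qed.
Lemma nserM k x y : F k x -> F k y -> F k (x * y)%g.
Proof. by case: (nser_sg F k) => _ h _; apply: h. Qed.
Lemma nserV k x : F k x -> F k x^-1%g.
Proof. by case: (nser_sg F k) => _ _ h; apply: h. Qed.
Lemma nser_le j k x : (j <= k)%N -> F k x -> F j x.
Proof.
move=> /subnK <-; elim: (k - j)%N => [//|m IH] Fx.
by apply/IH/nserS; rewrite addSn in Fx.
Qed.
Lemma nserJ j k x y : F j y -> F k x -> F k (x ^ y)%g.
Proof.
move=> Fy Fx; have -> : (x ^ y = x * [~ x, y])%g by rewrite commgEl mulVKg.
by apply: nserM => //; apply: (@nser_le _ (k + j)); [apply: leq_addr|apply: nserR].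
Qed.

Definition filt k : pred G := fun x => `[< F k.+1 x >].
Definition gr_equiv k (x y : {x : G | filt k x}) : bool :=
  `[< F k.+2 ((val x)^-1 * val y)%g >].

Lemma gr_equivP k : equiv_class_of (@gr_equiv k).
Proof.
split=> [[x Fx]|[x Fx] [y Fy]|[y Fy] [x Fx] [z Fz]]; rewrite /gr_equiv /=.
- by apply/asboolP; rewrite mulVg; apply: nser1.
- by apply: asbool_equiv_eq; split=> /nserV; rewrite invgM invgK.
- move=> /asboolP xy /asboolP yz; apply/asboolP.
  have -> : (x^-1 * z = x^-1 * y * (y^-1 * z))%g by rewrite !gnorm.
  exact: nserM.
Qed.
Canonical gr_equiv_rel k := EquivRelPack (gr_equivP k).
Canonical gr_equiv_enc k := defaultEncModRel (@gr_equiv k).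

(* F_{k+1} / F_{k+2}: the index k stands for the degree k+1. *)
Definition gr k := {eq_quot (@gr_equiv k)}.
HB.instance Definition _ k := Choice.on (gr k).

Fact filt1 k : filt k 1%g. Proof. by apply/asboolP/nser1. Qed.

(* The class of x; 0 by convention if x is not in F_{k+1}. *)
Definition gcls k (x : G) : gr k := (\pi_(gr k) (insubd (Sub 1%g (filt1 k)) x))%qT.
Definition grep k (a : gr k) : G := val (repr a).

Lemma grepP k (a : gr k) : F k.+1 (grep a).
Proof. by apply/asboolP; apply: (valP (repr a)). Qed.

Lemma gclsP k x y : F k.+1 x -> F k.+1 y ->
  gcls k x = gcls k y <-> F k.+2 (x^-1 * y)%g.
Proof.
move=> Fx Fy; rewrite /gcls (rwP eqP) eqmodE /= /gr_equiv !val_insubd.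
have -> : filt k x by apply/asboolP.
have -> : filt k y by apply/asboolP.
by split=> /asboolP.
Qed.

Lemma grepK k (a : gr k) : gcls k (grep a) = a.
Proof.
rewrite -[RHS]reprK /gcls; congr (\pi__ _)%qT; apply: val_inj.
rewrite val_insubd; case: ifP => // /asboolP; case; exact: grepP.
Qed.

Lemma gcls_rep k x : F k.+1 x -> F k.+2 ((grep (gcls k x))^-1 * x)%g.
Proof. by move=> Fx; apply/gclsP; rewrite ?grepK //; apply: grepP. Qed.

Definition gr_add k (a b : gr k) : gr k := gcls k (grep a * grep b)%g.
Definition gr_opp k (a : gr k) : gr k := gcls k (grep a)^-1%g.

Lemma gr_addE k x y : F k.+1 x -> F k.+1 y ->
  gr_add (gcls k x) (gcls k y) = gcls k (x * y)%g.
Proof.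
move=> Fx Fy; apply/gclsP; try by apply: nserM => //; apply: grepP.
rewrite invgM.
set b := grep (gcls k y); set a := grep (gcls k x).
have -> : (b^-1 * a^-1 * (x * y) = (b^-1 * y) * (a^-1 * x) ^ y)%g.
  by rewrite conjgE !gnorm.
by apply: nserM; [|apply: nserJ Fy _]; apply: gcls_rep.
Qed.

Lemma gr_oppE k x : F k.+1 x -> gr_opp (gcls k x) = gcls k x^-1%g.
Proof.
move=> Fx; apply/gclsP; try by apply: nserV => //; apply: grepP.
set a := grep _.
have -> : (a^-1^-1 * x^-1 = ((a^-1 * x) ^ a^-1)^-1)%g by rewrite conjgE !gnorm.
by apply/nserV/nserJ/gcls_rep => //; apply/nserV/grepP.
Qed.

Lemma gr_addA k : associative (@gr_add k).
Proof.
move=> a b c; rewrite -[a]grepK -[b]grepK -[c]grepK.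
by rewrite !gr_addE ?mulgA //; do ?apply: nserM; apply: grepP.
Qed.
Lemma gr_addC k : commutative (@gr_add k).
Proof.
move=> a b; rewrite -[a]grepK -[b]grepK.
have Fa := grepP a; have Fb := grepP b; move: (grep a) (grep b) Fa Fb => x y Fx Fy.
rewrite !gr_addE //; apply/gclsP; try exact: nserM.
have -> : ((x * y)^-1 * (y * x) = [~ y, x])%g by rewrite /commg conjgE !gnorm.
apply: (@nser_le _ (k.+1 + k.+1)); last exact: nserR.
by rewrite addSn addnS !ltnS leq_addr.
Qed.
Lemma gr_add0 k : left_id (gcls k 1%g) (@gr_add k).
Proof. by move=> a; rewrite -[a]grepK gr_addE ?mul1g //; [apply: nser1|apply: grepP]. Qed.
Lemma gr_addN k : left_inverse (gcls k 1%g) (@gr_opp k) (@gr_add k).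
Proof.
move=> a; rewrite -[a]grepK; have Fa := grepP a.
by rewrite gr_oppE // gr_addE ?mulVg //; apply: nserV.
Qed.

HB.instance Definition _ k := GRing.isZmodule.Build (gr k)
  (@gr_addA k) (@gr_addC k) (@gr_add0 k) (@gr_addN k).

Lemma gclsM k x y : F k.+1 x -> F k.+1 y -> gcls k (x * y)%g = gcls k x + gcls k y.
Proof. by move=> Fx Fy; rewrite -gr_addE. Qed.
Lemma gclsV k x : F k.+1 x -> gcls k x^-1%g = - gcls k x.
Proof. by move=> Fx; rewrite -gr_oppE. Qed.
Lemma gcls1 k : gcls k 1%g = 0. Proof. by []. Qed.
Lemma gcls_eq0 k x : F k.+1 x -> gcls k x = 0 <-> F k.+2 x.
Proof.
move=> Fx; rewrite -gcls1; split=> [/esym/gclsP|F2x].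
  by rewrite invg1 mul1g; apply=> //; apply: nser1.
by apply/esym/gclsP => //; [apply: nser1|rewrite invg1 mul1g].
Qed.
Lemma gclsJ k j x y : F k.+1 x -> F j.+1 y -> gcls k (x ^ y)%g = gcls k x.
Proof.
move=> Fx Fy; apply/esym/gclsP => //; first exact: nserJ Fy Fx.
rewrite -commgEl; apply: (@nser_le _ (k.+1 + j.+1)); last exact: nserR.
by rewrite addSn addnS !ltnS leq_addr.
Qed.

(* Only meaningful for (i + j).+1 = k, that is, (i+1) + (j+1) = k+1. *)
Definition gbr k i j (a : gr i) (b : gr j) : gr k := gcls k [~ grep a, grep b]%g.

Section Gbr.
Variables (k i j : nat).
Hypothesis ijk : (i + j).+1 = k.

Lemma nserR1 x y : F i.+1 x -> F j.+1 y -> F k.+1 [~ x, y]%g.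
Proof. by move=> Fx Fy; rewrite -ijk -addSn -addnS; apply: nserR. Qed.

Let Rml x x' y : F i.+1 x -> F i.+1 x' -> F j.+1 y ->
  gcls k [~ x * x', y]%g = gcls k [~ x, y]%g + gcls k [~ x', y]%g.
Proof.
move=> Fx Fx' Fy; have -> : ([~ x * x', y] = [~ x, y] ^ x' * [~ x', y])%g.
  by rewrite /commg !conjgE !gnorm.
have h := nserR1 Fx Fy; have h' := nserR1 Fx' Fy.
by rewrite gclsM // ?(gclsJ _ Fx') //; apply: nserJ Fx' _.
Qed.
Let Rmr x y y' : F i.+1 x -> F j.+1 y -> F j.+1 y' ->
  gcls k [~ x, y * y']%g = gcls k [~ x, y]%g + gcls k [~ x, y']%g.
Proof.
move=> Fx Fy Fy'; have -> : ([~ x, y * y'] = [~ x, y'] * [~ x, y] ^ y')%g.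
  by rewrite /commg !conjgE !gnorm.
have h := nserR1 Fx Fy; have h' := nserR1 Fx Fy'.
by rewrite gclsM // ?(gclsJ _ Fy') 1?addrC //; apply: nserJ Fy' _.
Qed.

Lemma gbrE x y : F i.+1 x -> F j.+1 y ->
  gbr k (gcls i x) (gcls j y) = gcls k [~ x, y]%g.
Proof.
move=> Fx Fy; rewrite /gbr.
have := gcls_rep Fx; have := gcls_rep Fy.
have := grepP (gcls i x); have := grepP (gcls j y).
set b := grep (gcls j y); set a := grep (gcls i x) => Fb Fa F2y F2x.
have F1x := nserS F2x; have F1y := nserS F2y.
rewrite -{1}(mulVKg a x) -{1}(mulVKg b y).
rewrite Rml ?(Rmr _ (y := b)) //; try exact: nserM.
have z1 : gcls k [~ a, b^-1 * y]%g = 0.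
  apply/gcls_eq0; first exact: nserR1.
  by rewrite -ijk -addSn -!addnS; apply: nserR.
have z2 : gcls k [~ a^-1 * x, b]%g = 0.
  apply/gcls_eq0; first exact: nserR1.
  by rewrite -ijk -addnS -!addSn; apply: nserR.
have z3 : gcls k [~ a^-1 * x, b^-1 * y]%g = 0.
  apply/gcls_eq0; first exact: nserR1.
  by rewrite -ijk -addnS -!addSn; apply: nserR.
by rewrite z1 z2 z3 !addr0.
Qed.

Lemma gbrDl (a a' : gr i) (b : gr j) : gbr k (a + a') b = gbr k a b + gbr k a' b.
Proof.
rewrite -[a]grepK -[a']grepK -[b]grepK.
have Fa := grepP a; have Fa' := grepP a'; have Fb := grepP b.
by rewrite -gclsM // !gbrE ?Rml //; apply: nserM.
Qed.
Lemma gbrDr (a : gr i) (b b' : gr j) : gbr k a (b + b') = gbr k a b + gbr k a b'.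
Proof.
rewrite -[a]grepK -[b']grepK -[b]grepK.
have Fa := grepP a; have Fb' := grepP b'; have Fb := grepP b.
by rewrite -gclsM // !gbrE ?Rmr //; apply: nserM.
Qed.
Lemma gbr0l (b : gr j) : gbr k (0 : gr i) b = 0.
Proof. by apply: (addrI (gbr k (0 : gr i) b)); rewrite -gbrDl !addr0. Qed.
Lemma gbr0r (a : gr i) : gbr k a (0 : gr j) = 0.
Proof. by apply: (addrI (gbr k a (0 : gr j))); rewrite -gbrDr !addr0. Qed.
Lemma gbrNl (a : gr i) (b : gr j) : gbr k (- a) b = - gbr k a b.
Proof. by apply: (addrI (gbr k a b)); rewrite -gbrDl !subrr gbr0l. Qed.
Lemma gbrNr (a : gr i) (b : gr j) : gbr k a (- b) = - gbr k a b.
Proof. by apply: (addrI (gbr k a b)); rewrite -gbrDr !subrr gbr0r. Qed.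
Lemma gbr_suml (a : gr j) (I : Type) (r : seq I) (P : pred I) (f : I -> gr i) :
  gbr k (\sum_(s <- r | P s) f s) a = \sum_(s <- r | P s) gbr k (f s) a.
Proof. by apply: (big_morph (fun b => gbr k b a)); [move=> *; apply: gbrDl|apply: gbr0l]. Qed.
End Gbr.

Lemma gbrC k i j (a : gr i) (b : gr j) : (i + j).+1 = k -> gbr k a b = - gbr k b a.
Proof.
move=> ijk; rewrite /gbr -gclsV ?invgR //.
by apply: (@nserR1 k j i); [rewrite addnC|apply: grepP|apply: grepP].
Qed.

Lemma gbr_jacobi k i j l (a : gr i) (b : gr j) (c : gr l) : (i + j + l).+2 = k ->
  gbr k (gbr (i + j).+1 a b) c + gbr k (gbr (j + l).+1 b c) a
    + gbr k (gbr (l + i).+1 c a) b = 0.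
Proof.
move=> ijlk.
have e1 : ((i + j).+1 + l).+1 = k by [].
have e2 : ((j + l).+1 + i).+1 = k by rewrite -ijlk addSn (addnC (j + l)) addnA.
have e3 : ((l + i).+1 + j).+1 = k by rewrite -ijlk addSn -addnA addnC.
have key u v w p q r (a' : gr p) (b' : gr q) (c' : gr r) :
    ((p + q).+1 + r).+1 = k -> u = grep a' -> v = grep b' -> w = grep c' ->
    gcls k ([~ u, v^-1, w] ^ v)%g = - gbr k (gbr (p + q).+1 a' b') c'
    /\ F k.+1 ([~ u, v^-1, w] ^ v)%g.
  move=> pqr -> -> ->; have Fa := grepP a'; have Fb := grepP b'; have Fc := grepP c'.
  have Fv := nserV Fb; have R1 := nserR1 erefl Fa Fv.
  have R2 := nserR1 pqr R1 Fc.
  split; last exact: nserJ Fb R2.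
  rewrite (gclsJ R2 Fb) -(gbrE pqr R1 Fc) -(gbrE erefl Fa Fv) gclsV // !grepK.
  by rewrite gbrNr // gbrNl.
have [h1 F1] := key _ _ _ _ _ _ a b c e1 erefl erefl erefl.
have [h2 F2] := key _ _ _ _ _ _ b c a e2 erefl erefl erefl.
have [h3 F3] := key _ _ _ _ _ _ c a b e3 erefl erefl erefl.
have := congr1 (gcls k) (hall_witt (grep a) (grep b) (grep c)).
rewrite (gclsM (nserM F1 F2) F3) (gclsM F1 F2) h1 h2 h3 gcls1 -!opprD => /eqP.
by rewrite oppr_eq0 => /eqP.
Qed.

Definition lgr := dsum gr.
HB.instance Definition _ := GRing.Zmodule.on lgr.

Definition lgr_br_fun (x y : lgr) : dprod gr := fun k =>
  \sum_(i < k) \sum_(j < k | (i + j).+1 == k) gbr k (dsum_at x i) (dsum_at y j).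

Fact lgr_br_supp (x y : lgr) :
  exists N, forall k, (N <= k)%N -> lgr_br_fun x y k = 0.
Proof.
have [N xN] := dsum_supp x; have [M yM] := dsum_supp y.
exists (N + M)%N => k NMk; rewrite /lgr_br_fun big1 // => i _; rewrite big1 // => j /eqP ijk.
case: (leqP N i) => [/xN -> |iN]; first exact: gbr0l.
case: (leqP M j) => [/yM -> |jM]; first exact: gbr0r.
have := leq_trans (leq_add iN jM) NMk.
by rewrite addSn addnS ijk ltnn.
Qed.
Definition lgr_br (x y : lgr) : lgr := mkdsum (lgr_br_supp x y).

Lemma lgr_brE (x y : lgr) k : dsum_at (lgr_br x y) k =
  \sum_(i < k) \sum_(j < k | (i + j).+1 == k) gbr k (dsum_at x i) (dsum_at y j).
Proof. by []. Qed.

Lemma lgr_brDl (x y z : lgr) : lgr_br (x + y) z = lgr_br x z + lgr_br y z.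
Proof.
apply: dsumP => k; rewrite dsum_atD !lgr_brE -big_split; apply: eq_bigr => i _ /=.
by rewrite -big_split; apply: eq_bigr => j /eqP ijk; rewrite /= dsum_atD gbrDl.
Qed.
Lemma lgr_brDr (x y z : lgr) : lgr_br x (y + z) = lgr_br x y + lgr_br x z.
Proof.
apply: dsumP => k; rewrite dsum_atD !lgr_brE -big_split; apply: eq_bigr => i _ /=.
by rewrite -big_split; apply: eq_bigr => j /eqP ijk; rewrite /= dsum_atD gbrDr.
Qed.

Lemma sum_antisym (V : zmodType) m (f : nat -> nat -> V) :
  (forall i, f i i = 0) -> (forall i j, f i j = - f j i) ->
  \sum_(i < m) \sum_(j < m) f i j = 0.
Proof.
move=> f0 fN; elim: m => [|m IH]; first by rewrite big_ord0.
rewrite big_ord_recr /= [X in _ + X]big_ord_recr /= f0 addr0.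
under eq_bigr => i _ do rewrite big_ord_recr /=.
rewrite big_split /= IH add0r -big_split big1 // => i _ /=.
by rewrite fN addNr.
Qed.

Lemma lgr_brxx (x : lgr) : lgr_br x x = 0.
Proof.
apply: dsumP => k; rewrite dsum_at0 lgr_brE.
under eq_bigr => i _ do rewrite big_mkcond /=.
apply: (@sum_antisym _ _ (fun i j => if (i + j).+1 == k then gbr k (dsum_at x i) (dsum_at x j) else 0)).
  by move=> i; rewrite /gbr commgg gcls1; case: ifP.
move=> i j; rewrite (addnC j); case: eqP => [ijk|_]; last by rewrite oppr0.
exact: gbrC.
Qed.

Lemma lgr_br3 (x y z : lgr) k : dsum_at (lgr_br (lgr_br x y) z) k =
  \sum_(i < k) \sum_(j < k) \sum_(l < k)
    (if (i + j + l).+2 == k then gbr k (gbr (i + j).+1 (dsum_at x i) (dsum_at y j)) (dsum_at z l) else 0).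
Proof.
pose T i j l := gcls k [~ [~ grep (dsum_at x i), grep (dsum_at y j)], grep (dsum_at z l)]%g.
transitivity (\sum_(a < k) \sum_(l < k) \sum_(i < k) \sum_(j < k)
   (if ((a + l).+1 == k) && ((i + j).+1 == a) then T i j l else 0)).
  rewrite lgr_brE; apply: eq_bigr => a _.
  rewrite big_mkcond; apply: eq_bigr => l _ /=; case: eqP => [alk|_] /=; last first.
    by rewrite big1 // => i _; rewrite big1.
  rewrite lgr_brE gbr_suml // (big_ord_widen k
    (fun i => gbr k (\sum_(j < a | (i + j).+1 == a) gbr a (dsum_at x i) (dsum_at y j)) (dsum_at z l))); last first.
    exact: ltnW.
  rewrite big_mkcond; apply: eq_bigr => i _; case: ifPn => [ia|nia]; last first.
    rewrite big1 // => j _; case: eqP => // ija.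
    by case/negP: nia; rewrite -ija ltnS leq_addr.
  rewrite gbr_suml // (big_ord_widen_cond k (fun j => (i + j).+1 == a)
     (fun j => gbr k (gbr a (dsum_at x i) (dsum_at y j)) (dsum_at z l))); last exact: ltnW.
  rewrite big_mkcond; apply: eq_bigr => j _.
  case: (eqVneq (i + j).+1 (a : nat)) => [ija|] //=.
  rewrite -{1}ija ltnS leq_addl /T -(gbrE alk) ?grepK //; last exact: grepP.
  by apply: (nserR1 ija); apply: grepP.
under eq_bigr => a _ do rewrite exchange_big /=.
rewrite exchange_big /=; apply: eq_bigr => i _.
under eq_bigr => a _ do rewrite exchange_big /=.
rewrite exchange_big /=; apply: eq_bigr => j _.
rewrite exchange_big /=; apply: eq_bigr => l _.
case: eqP => [ijlk|nijlk]; last first.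
  rewrite big1 // => a _; case: andP => // -[/eqP alk /eqP ija].
  by case: nijlk; rewrite -[RHS]alk -ija addSn.
have ak : ((i + j).+1 < k)%N by rewrite -[X in (_ < X)%N]ijlk !ltnS leq_addr.
rewrite (bigD1 (Ordinal ak)) //= eqxx addSn ijlk eqxx /= big1 ?addr0.
  rewrite /T -(@gbrE k (i + j).+1 l) ?grepK //; last exact: grepP.
  by apply: nserR1 => //; apply: grepP.
move=> a /eqP na; case: andP => // -[_ /eqP ija]; case: na; exact: val_inj.
Qed.

Lemma lgr_jacobi (x y z : lgr) :
  lgr_br (lgr_br x y) z + lgr_br (lgr_br y z) x + lgr_br (lgr_br z x) y = 0.
Proof.
apply: dsumP => k; rewrite !dsum_atD dsum_at0 !lgr_br3.
have -> : forall A B C : gr k, A + B + C = A + (B + C) by move=> *; rewrite addrA.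
rewrite [X in _ + (X + _)]exchange_big [X in _ + (_ + X)]exchange_big /=.
rewrite [X in _ + (X + _)](_ : _ = \sum_(i < k) \sum_(j < k) \sum_(l < k)
   (if (i + j + l).+2 == k then gbr k (gbr (j + l).+1 (dsum_at y j) (dsum_at z l)) (dsum_at x i) else 0)); last first.
  under eq_bigr => i _ do rewrite exchange_big /=.
  rewrite exchange_big /=; apply: eq_bigr => i _; rewrite exchange_big /=.
  apply: eq_bigr => j _; apply: eq_bigr => l _.
  by rewrite (addnC (j + l)%N) addnA.
rewrite [X in _ + (_ + X)](_ : _ = \sum_(i < k) \sum_(j < k) \sum_(l < k)
   (if (i + j + l).+2 == k then gbr k (gbr (l + i).+1 (dsum_at z l) (dsum_at x i)) (dsum_at y j) else 0)); last first.
  apply: eq_bigr => i _; rewrite exchange_big /=.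
  apply: eq_bigr => j _; apply: eq_bigr => l _.
  by rewrite -addnA addnC.
rewrite -!big_split big1 // => i _ /=; rewrite -!big_split big1 // => j _ /=.
rewrite -!big_split big1 // => l _ /=.
by case: eqP => [e|_]; rewrite ?addr0 // addrA gbr_jacobi.
Qed.

HB.instance Definition _ := Zmodule_isLieRing.Build lgr
  lgr_brDl lgr_brDr lgr_brxx lgr_jacobi.

(* The class of x in F_{k+1} / F_{k+2}, seen in the direct sum. *)
Definition lcls_fun k (x : G) : dprod gr := fun i => if i == k then gcls i x else 0.
Fact lcls_supp k x : exists N, forall i, (N <= i)%N -> lcls_fun k x i = 0.
Proof. by exists k.+1 => i ki; rewrite /lcls_fun gtn_eqF. Qed.
Definition lcls k x : lgr := mkdsum (lcls_supp k x).

End Gr.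

Section GrIncl.
Variables (G : groupType) (F F' : nseries G).
Hypothesis FF' : forall k, F k `<=` F' k.

Definition gr_incl_fun (x : lgr F) : dprod (gr F') := fun k => gcls F' k (grep (dsum_at x k)).

Lemma gr_incl_cls k x : F k.+1 x -> gcls F' k (grep (gcls F k x)) = gcls F' k x.
Proof.
move=> Fx; apply/gclsP; try by apply: FF' => //; apply: grepP.
exact/FF'/gcls_rep.
Qed.

Fact gr_incl_supp (x : lgr F) : exists N, forall k, (N <= k)%N -> gr_incl_fun x k = 0.
Proof.
have [N xN] := dsum_supp x; exists N => k /xN xk.
by rewrite /gr_incl_fun xk -gcls1 gr_incl_cls ?gcls1 //; apply: nser1.
Qed.
Definition gr_incl (x : lgr F) : lgr F' := mkdsum (gr_incl_supp x).
End GrIncl.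


Section FreeLie.
Variable n : nat.

(* The free Lie ring on V = Z^n is the free Lie ring on the basis e_i of V,
   obtained from terms modulo the congruence generated by the Lie ring axioms. *)
Inductive lterm :=
| LVar of 'I_n
| LZero
| LAdd of lterm & lterm
| LOpp of lterm
| LBr of lterm & lterm.

Inductive leqv : lterm -> lterm -> Prop :=
| leqv_refl s : leqv s s
| leqv_sym s t : leqv s t -> leqv t s
| leqv_trans s t u : leqv s t -> leqv t u -> leqv s u
| leqv_add s s' t t' : leqv s s' -> leqv t t' -> leqv (LAdd s t) (LAdd s' t')
| leqv_opp s s' : leqv s s' -> leqv (LOpp s) (LOpp s')
| leqv_br s s' t t' : leqv s s' -> leqv t t' -> leqv (LBr s t) (LBr s' t')
| leqv_addA s t u : leqv (LAdd s (LAdd t u)) (LAdd (LAdd s t) u)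
| leqv_addC s t : leqv (LAdd s t) (LAdd t s)
| leqv_add0 s : leqv (LAdd LZero s) s
| leqv_addN s : leqv (LAdd (LOpp s) s) LZero
| leqv_brDl s t u : leqv (LBr (LAdd s t) u) (LAdd (LBr s u) (LBr t u))
| leqv_brDr s t u : leqv (LBr s (LAdd t u)) (LAdd (LBr s t) (LBr s u))
| leqv_brxx s : leqv (LBr s s) LZero
| leqv_jacobi s t u :
    leqv (LAdd (LAdd (LBr (LBr s t) u) (LBr (LBr t u) s)) (LBr (LBr u s) t)) LZero.

HB.instance Definition _ := gen_eqMixin lterm.
HB.instance Definition _ := gen_choiceMixin lterm.

Definition leqvb s t : bool := `[< leqv s t >].
Lemma leqvb_equiv : equiv_class_of leqvb.
Proof.
split=> [s|s t|t s u]; first exact/asboolP/leqv_refl.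
- by apply: asbool_equiv_eq; split; apply: leqv_sym.
- by move=> /asboolP st /asboolP tu; apply/asboolP; apply: leqv_trans tu.
Qed.
Canonical leqv_rel := EquivRelPack leqvb_equiv.
Canonical leqv_enc := defaultEncModRel leqvb.

Definition free_lie := {eq_quot leqvb}.
HB.instance Definition _ := Choice.on free_lie.

Definition flcls (s : lterm) : free_lie := (\pi_free_lie s)%qT.
Lemma flclsP s t : flcls s = flcls t <-> leqv s t.
Proof. by rewrite (rwP eqP) (rwP (asboolP (leqv _ _))) /flcls eqmodE. Qed.
Lemma fl_repr u : flcls (repr u) = u. Proof. exact: reprK. Qed.
Lemma repr_fl s : leqv (repr (flcls s)) s. Proof. by apply/flclsP; rewrite fl_repr. Qed.

Definition fl_gen i := flcls (LVar i).
Definition fl_add (u v : free_lie) := flcls (LAdd (repr u) (repr v)).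
Definition fl_opp (u : free_lie) := flcls (LOpp (repr u)).
Definition fl_br (u v : free_lie) := flcls (LBr (repr u) (repr v)).

Lemma fl_addE s t : fl_add (flcls s) (flcls t) = flcls (LAdd s t).
Proof. by apply/flclsP/leqv_add; apply: repr_fl. Qed.
Lemma fl_oppE s : fl_opp (flcls s) = flcls (LOpp s).
Proof. by apply/flclsP/leqv_opp/repr_fl. Qed.
Lemma fl_brE s t : fl_br (flcls s) (flcls t) = flcls (LBr s t).
Proof. by apply/flclsP/leqv_br; apply: repr_fl. Qed.

Lemma fl_addA : associative fl_add.
Proof.
move=> u v w; rewrite -[u]fl_repr -[v]fl_repr -[w]fl_repr !fl_addE.
exact/flclsP/leqv_addA.
Qed.
Lemma fl_addC : commutative fl_add.
Proof.
move=> u v; rewrite -[u]fl_repr -[v]fl_repr !fl_addE; exact/flclsP/leqv_addC.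
Qed.
Lemma fl_add0 : left_id (flcls LZero) fl_add.
Proof. by move=> u; rewrite -[u]fl_repr !fl_addE; exact/flclsP/leqv_add0. Qed.
Lemma fl_addN : left_inverse (flcls LZero) fl_opp fl_add.
Proof. by move=> u; rewrite -[u]fl_repr fl_oppE !fl_addE; exact/flclsP/leqv_addN. Qed.
HB.instance Definition _ := GRing.isZmodule.Build free_lie fl_addA fl_addC fl_add0 fl_addN.

Lemma flclsD s t : flcls (LAdd s t) = flcls s + flcls t. Proof. by rewrite -fl_addE. Qed.
Lemma flclsN s : flcls (LOpp s) = - flcls s. Proof. by rewrite -fl_oppE. Qed.
Lemma flcls0 : flcls LZero = 0. Proof. by []. Qed.

Lemma fl_brDl u v w : fl_br (u + v) w = fl_br u w + fl_br v w.
Proof.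
rewrite -[u]fl_repr -[v]fl_repr -[w]fl_repr -flclsD !fl_brE -flclsD.
exact/flclsP/leqv_brDl.
Qed.
Lemma fl_brDr u v w : fl_br u (v + w) = fl_br u v + fl_br u w.
Proof.
rewrite -[u]fl_repr -[v]fl_repr -[w]fl_repr -flclsD !fl_brE -flclsD.
exact/flclsP/leqv_brDr.
Qed.
Lemma fl_brxx u : fl_br u u = 0.
Proof. by rewrite -[u]fl_repr fl_brE -flcls0; apply/flclsP/leqv_brxx. Qed.
Lemma fl_jacobi u v w :
  fl_br (fl_br u v) w + fl_br (fl_br v w) u + fl_br (fl_br w u) v = 0.
Proof.
rewrite -[u]fl_repr -[v]fl_repr -[w]fl_repr !fl_brE -!flclsD -flcls0.
exact/flclsP/leqv_jacobi.
Qed.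
HB.instance Definition _ :=
  Zmodule_isLieRing.Build free_lie fl_brDl fl_brDr fl_brxx fl_jacobi.

Lemma flclsR s t : flcls (LBr s t) = lbr (flcls s) (flcls t).
Proof. by rewrite -fl_brE. Qed.

Section Lift.
Variables (L : lieRingType) (f : 'I_n -> L).
Fixpoint leval (s : lterm) : L :=
  match s with
  | LVar i => f i
  | LZero => 0
  | LAdd s t => leval s + leval t
  | LOpp s => - leval s
  | LBr s t => lbr (leval s) (leval t)
  end.
Lemma leval_eqv s t : leqv s t -> leval s = leval t.
Proof.
elim=> {s t} //=; try by move=> *; congruence.
- by move=> *; rewrite addrA.
- by move=> *; rewrite addrC.
- by move=> *; rewrite add0r.
- by move=> *; rewrite addNr.
- by move=> *; rewrite lbrDl.
- by move=> *; rewrite lbrDr.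
- by move=> *; rewrite lbrxx.
- by move=> *; rewrite lbr_jacobi.
Qed.

Definition fl_lift (u : free_lie) : L := leval (repr u).
Lemma fl_liftE s : fl_lift (flcls s) = leval s.
Proof. exact/leval_eqv/repr_fl. Qed.
Lemma fl_lift_gen i : fl_lift (fl_gen i) = f i. Proof. exact: fl_liftE. Qed.
Lemma fl_liftD u v : fl_lift (u + v) = fl_lift u + fl_lift v.
Proof. by rewrite -[u]fl_repr -[v]fl_repr -flclsD !fl_liftE. Qed.
Lemma fl_liftN u : fl_lift (- u) = - fl_lift u.
Proof. by rewrite -[u]fl_repr -flclsN !fl_liftE. Qed.
Lemma fl_liftB u v : fl_lift (u - v) = fl_lift u - fl_lift v.
Proof. by rewrite fl_liftD fl_liftN. Qed.
Lemma fl_lift0 : fl_lift 0 = 0. Proof. exact: (fl_liftE LZero). Qed.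
Lemma fl_liftR u v : fl_lift (lbr u v) = lbr (fl_lift u) (fl_lift v).
Proof. by rewrite -[u]fl_repr -[v]fl_repr -flclsR !fl_liftE. Qed.
End Lift.

(* The homogeneous component of degree k. *)
Inductive fl_hom : nat -> free_lie -> Prop :=
| fl_hom_gen i : fl_hom 1 (fl_gen i)
| fl_hom0 k : fl_hom k 0
| fl_homB k u v : fl_hom k u -> fl_hom k v -> fl_hom k (u - v)
| fl_homR j k u v : fl_hom j u -> fl_hom k v -> fl_hom (j + k) (lbr u v).

Lemma zspan_br (S T : set free_lie) u v :
  (forall a b, S a -> T b -> S (lbr a b)) -> zspan S u -> zspan T v ->
  zspan S (lbr u v).
Proof.
move=> ST Su Tv; elim: Tv => {v} [v Tv||v w _ IHv _ IHw].
- elim: Su => {u} [u Su||u w _ IHu _ IHw].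
  + by apply/zspan_in/ST.
  + by rewrite lbr0l; apply: zspan0.
  + by rewrite lbrBl; apply: zspanB.
- by rewrite lbr0r; apply: zspan0.
- by rewrite lbrBr; apply: zspanB.
Qed.

Lemma fl_hom_span u : zspan [set v | exists k, fl_hom k v] u.
Proof.
rewrite -[u]fl_repr; elim: (repr u) => [i||s IHs t IHt|s IHs|s IHs t IHt].
- by apply: zspan_in; exists 1%N; apply: fl_hom_gen.
- exact: zspan0.
- by rewrite flclsD; apply: zspanD.
- by rewrite flclsN; apply: zspanN.
- rewrite flclsR; apply: zspan_br IHs IHt => a b [j Ha] [k Hb].
  by exists (j + k)%N; apply: fl_homR.
Qed.

Variable c : nat.

Definition fl_gt : set free_lie := [set u | exists2 k, (c < k)%N & fl_hom k u].

Definition trunc_lie := zquot fl_gt.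
HB.instance Definition _ := Choice.on trunc_lie.
HB.instance Definition _ := GRing.Zmodule.on trunc_lie.

Definition tl_pi (u : free_lie) : trunc_lie := zpi fl_gt u.

Lemma fl_gt_ideal u v : zspan fl_gt u -> zspan fl_gt (lbr u v).
Proof.
move=> gu; apply: zspan_br gu (fl_hom_span v) => a b [k ck Ha] [j Hb].
by exists (k + j)%N; [apply: ltn_addr|apply: fl_homR].
Qed.
Lemma fl_lbrC (L : lieRingType) (x y : L) : lbr x y = - lbr y x.
Proof.
apply/eqP; rewrite -addr_eq0; apply/eqP.
have := lbrxx (x + y); rewrite lbrDl !lbrDr !lbrxx add0r addr0 //.
Qed.
Lemma fl_gt_ideal_r u v : zspan fl_gt v -> zspan fl_gt (lbr u v).
Proof. by move=> gv; rewrite fl_lbrC; apply/zspanN/fl_gt_ideal. Qed.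

Definition tl_br (x y : trunc_lie) : trunc_lie := tl_pi (lbr (repr x) (repr y)).
Lemma tl_repr (x : trunc_lie) : tl_pi (repr x) = x. Proof. exact: zpi_repr. Qed.
Lemma tl_brE u v : tl_br (tl_pi u) (tl_pi v) = tl_pi (lbr u v).
Proof.
rewrite /tl_br /tl_pi; apply/zpiP; set a := repr _; set b := repr _.
have -> : lbr a b - lbr u v = lbr (a - u) b + lbr u (b - v).
  by rewrite lbrBl lbrBr addrA subrK.
by apply: zspanD; [apply: fl_gt_ideal|apply: fl_gt_ideal_r];
  apply/zpiP; rewrite zpi_repr.
Qed.
Lemma tl_piD u v : tl_pi (u + v) = tl_pi u + tl_pi v. Proof. exact: zpiD. Qed.
Lemma tl_brDl x y z : tl_br (x + y) z = tl_br x z + tl_br y z.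
Proof.
by rewrite -[x]tl_repr -[y]tl_repr -[z]tl_repr -tl_piD !tl_brE -tl_piD lbrDl.
Qed.
Lemma tl_brDr x y z : tl_br x (y + z) = tl_br x y + tl_br x z.
Proof.
by rewrite -[x]tl_repr -[y]tl_repr -[z]tl_repr -tl_piD !tl_brE -tl_piD lbrDr.
Qed.
Lemma tl_brxx x : tl_br x x = 0.
Proof. by rewrite -[x]tl_repr tl_brE lbrxx; apply: zpi0. Qed.
Lemma tl_jacobi x y z : tl_br (tl_br x y) z + tl_br (tl_br y z) x + tl_br (tl_br z x) y = 0.
Proof.
rewrite -[x]tl_repr -[y]tl_repr -[z]tl_repr !tl_brE -!tl_piD lbr_jacobi.
exact: zpi0.
Qed.
HB.instance Definition _ :=
  Zmodule_isLieRing.Build trunc_lie tl_brDl tl_brDr tl_brxx tl_jacobi.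

Definition tl_gen i := tl_pi (fl_gen i).
Definition tl_hom k (x : trunc_lie) := exists2 u, fl_hom k u & x = tl_pi u.

Definition is_der k (d : trunc_lie -> trunc_lie) : bool :=
  `[< [/\ {morph d : x y / x + y},
          forall x y, d (lbr x y) = lbr (d x) y + lbr x (d y) &
          forall j x, tl_hom j x -> tl_hom (j + k) (d x)] >].

Lemma tl_homB k x y : tl_hom k x -> tl_hom k y -> tl_hom k (x - y).
Proof.
move=> [u Hu ->] [v Hv ->]; exists (u - v); first exact: fl_homB.
by rewrite /tl_pi zpiB.
Qed.

Lemma is_der_closed k : zmod_closed (is_der k).
Proof.
split=> [|d e].
  apply/asboolP; split=> [x y|x y|j x _]; rewrite ?lbr0l ?lbr0r ?addr0 //.
  by exists 0; [apply: fl_hom0|rewrite /tl_pi zpi0].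
move=> /asboolP [dD dR dH] /asboolP [eD eR eH]; apply/asboolP.
split=> [x y|x y|j x Hx].
- by rewrite !opprfctE !addrfctE dD eD opprD addrACA.
- rewrite !opprfctE !addrfctE dR eR lbrBl lbrBr opprD addrACA //.
- by apply: tl_homB; [apply: dH|apply: eH].
Qed.
HB.instance Definition _ k :=
  GRing.isZmodClosed.Build (trunc_lie -> trunc_lie) (is_der k) (is_der_closed k).

Definition der k := {d : trunc_lie -> trunc_lie | is_der k d}.
HB.instance Definition _ k := SubChoice.on (der k).
HB.instance Definition _ k := [SubChoice_isSubZmodule of der k by <:].

(* The component of index k has degree k+1. *)
Definition Der := dsum (fun k => der k.+1).
HB.instance Definition _ := GRing.Zmodule.on Der.

End FreeLie.

Arguments fl_lift {n L} f u.

Lemma commr_jacobi (R : pzRingType) (s t u : R) (br := fun s t : R => s * t - t * s) :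
  br (br s t) u + br (br t u) s + br (br u s) t = 0.
Proof.
rewrite /br !mulrBl !mulrBr !mulrA !opprB.
by rewrite [LHS](AC ((2*2)*2) (1*6*3*2*5*4)) /= !subrKA subrr.
Qed.

Section Tensors.
Variable n : nat.

(* T(V), with words in the e_i as basis. *)
Definition tensor_alg := {malg int[{fmonom 'I_n}]}.
HB.instance Definition _ := GRing.NzRing.on tensor_alg.

Definition ta_br (s t : tensor_alg) : tensor_alg := s * t - t * s.
Lemma ta_brDl s t u : ta_br (s + t) u = ta_br s u + ta_br t u.
Proof. by rewrite /ta_br mulrDl mulrDr opprD addrACA. Qed.
Lemma ta_brDr s t u : ta_br s (t + u) = ta_br s t + ta_br s u.
Proof. by rewrite /ta_br mulrDl mulrDr opprD addrACA. Qed.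
Lemma ta_brxx s : ta_br s s = 0. Proof. exact: subrr. Qed.
Lemma ta_jacobi s t u :
  ta_br (ta_br s t) u + ta_br (ta_br t u) s + ta_br (ta_br u s) t = 0.
Proof. exact: commr_jacobi. Qed.
HB.instance Definition _ :=
  Zmodule_isLieRing.Build tensor_alg ta_brDl ta_brDr ta_brxx ta_jacobi.

(* The canonical Lie ring morphism from the free Lie ring to T(V). *)
Definition iota : free_lie n -> tensor_alg := fl_lift (fun i => << fmu i >> : tensor_alg).

Definition ta_hom k (t : tensor_alg) := forall m, size (m : {fmonom _}) != k -> t@_m = 0.

(* V^{(x)k}: a tensor is given by its coordinates in the basis
   e_{w_1} (x) ... (x) e_{w_k} *)
Definition tens k := {ffun k.-tuple 'I_n -> int}.
HB.instance Definition _ k := GRing.Zmodule.on (tens k).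

Definition ta_comp k (t : tensor_alg) : tens k := [ffun w : k.-tuple 'I_n => t@_(FMonom w)].

Definition tens_rot k (j : nat) (t : tens k) : tens k :=
  [ffun w : k.-tuple 'I_n => t [tuple of rot j w]].

Definition cyc k := zquot [set u : tens k | exists j t, u = t - tens_rot j t].
HB.instance Definition _ k := Choice.on (cyc k).
HB.instance Definition _ k := GRing.Zmodule.on (cyc k).
End Tensors.


Section IotaGraded.
Variable n : nat.
Implicit Types s t : tensor_alg n.

Lemma ta_homB k s t : ta_hom k s -> ta_hom k t -> ta_hom k (s - t).
Proof. by move=> hs ht m nm; rewrite mcoeffB hs ?ht ?subr0. Qed.

Lemma ta_homM j k s t : ta_hom j s -> ta_hom k t -> ta_hom (j + k) (s * t).
Proof.
move=> hs ht m nm; rewrite mcoeffMl big1 // => m1 _; rewrite big1 // => m2 _.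
case: eqP => [em|_]; last by rewrite mulr0n.
case: (eqVneq (size (m1 : {fmonom 'I_n})) j) => [e1|/hs ->]; last by rewrite mul0r mul0rn.
case: (eqVneq (size (m2 : {fmonom 'I_n})) k) => [e2|/ht ->]; last by rewrite mulr0 mul0rn.
by case/eqP: nm; rewrite -em fmM size_cat e1 e2.
Qed.

Lemma iota_hom k (u : free_lie n) : fl_hom k u -> ta_hom k (iota u).
Proof.
elim=> {k u} [i|k|k u v _ hu _ hv|j k u v _ hu _ hv].
- move=> m nm; rewrite /iota fl_lift_gen mcoeffU; case: eqP => // em.
  by case/eqP: nm; rewrite -em fmuE.
- by move=> m _; rewrite /iota fl_lift0 mcoeff0.
- by rewrite /iota fl_liftB; apply: ta_homB.
- by rewrite /iota fl_liftR; apply: ta_homB; [|rewrite addnC]; apply: ta_homM.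
Qed.

Lemma ta_compB k s t : ta_comp k (s - t) = ta_comp k s - ta_comp k t.
Proof. by apply/ffunP => w; rewrite !ffunE mcoeffB. Qed.

Variable c : nat.

(* The component of degree k of the canonical map to T(V); the chosen preimage
   in the free Lie ring is irrelevant for k <= c, by tl_tensE. *)
Definition tl_tens k (x : trunc_lie n c) : tens n k := ta_comp k (iota (repr x)).

Lemma tl_tensE k (u : free_lie n) : (k <= c)%N -> tl_tens k (tl_pi c u) = ta_comp k (iota u).
Proof.
move=> kc; apply/eqP; rewrite /tl_tens -subr_eq0 -ta_compB -fl_liftB; apply/eqP.
have : zspan (fl_gt c) (repr (tl_pi c u) - u) by apply/zpiP; rewrite zpi_repr.
move: (_ - u) => v; elim=> {u v} [u [j cj /iota_hom Hu]||u v _ IHu _ IHv].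
- apply/ffunP => w; rewrite !ffunE; apply: Hu.
  by rewrite size_tuple ltn_eqF // (leq_ltn_trans kc).
- by apply/ffunP => w; rewrite !ffunE fl_lift0 mcoeff0.
- by rewrite fl_liftB ta_compB IHu IHv subr0.
Qed.

(* V^* (x) V^{(x)k+1} is represented by the families (t_i) <-> sum_i e_i^* (x) t_i. *)
Definition Phi k (t : {ffun 'I_n -> tens n k.+1}) : tens n k :=
  \sum_i [ffun w : k.-tuple 'I_n => t i [tuple of rcons w i]].

Definition tr k (D : Der n c) : cyc n k.+1 :=
  zpi _ (Phi [ffun i => tl_tens k.+2 (val (dsum_at D k) (tl_gen c i))]).

(* C_2 V (+) ... (+) C_{c-1} V; the component of index k has degree k+2.
   Degree 1 has to be left out: every element of degree 1 of Der(L_{<=c} V)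
   comes from IA_{F_{n,c}} (which is both Gamma_1 and A_1), while the trace is
   not zero there, as it maps e_1^* (x) [e_1, e_2] to - e_2 in C_1 V = V. *)
Definition cyc_lt := dprod (fun k : 'I_c.-2 => cyc n k.+2).
HB.instance Definition _ := GRing.Zmodule.on cyc_lt.

Definition Tr (D : Der n c) : cyc_lt := fun k => tr k.+1 D.

End IotaGraded.

Section Johnson.
Variables n c : nat.
Local Notation Fnc := (free_nil n c).
Local Notation GF := (Gamma Fnc).

(* V is identified with the abelianization: e_i is the class of x_i. *)
Definition fl_to_gr : free_lie n -> lgr GF := fl_lift (fun i => lcls GF 0 (fn_gen c i)).

(* The canonical isomorphism from L_{<=c} V to the Lie ring of the lower central
   series of F_{n,c}; well defined by tl_to_grE. *)
Definition tl_to_gr (x : trunc_lie n c) : lgr GF := fl_to_gr (repr x).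

Lemma fl_to_gr_hom k (u : free_lie n) i : fl_hom k u -> i.+1 != k -> dsum_at (fl_to_gr u) i = 0.
Proof.
move=> Hu; elim: Hu i => {k u} [a|k|k u v _ hu _ hv|j k u v _ hu _ hv] i ik.
- rewrite /fl_to_gr fl_lift_gen /lcls /dsum_at /= /lcls_fun.
  by move: ik; rewrite eqSS => /negPf ->.
- by rewrite /fl_to_gr fl_lift0.
- by rewrite /fl_to_gr fl_liftB dsum_atD dsum_atN hu ?hv ?subr0.
- rewrite /fl_to_gr fl_liftR; rewrite [LHS]lgr_brE big1 // => p _; rewrite big1 // => q /eqP pq.
  case: (eqVneq p.+1 j) => [pj|/hu ->]; last exact: gbr0l.
  case: (eqVneq q.+1 k) => [qk|/hv ->]; last exact: gbr0r.
  by case/eqP: ik; rewrite -pj -qk addSn addnS pq.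
Qed.

Lemma gr_free_nil k (a : gr GF k) : (c <= k)%N -> a = 0.
Proof.
move=> ck; rewrite -[a]grepK.
have -> : grep a = 1%g.
  apply: free_nil_lcs; apply: (@nser_le _ GF _ k.+1) => //; exact: grepP.
exact: gcls1.
Qed.

Lemma tl_to_grE (u : free_lie n) : tl_to_gr (tl_pi c u) = fl_to_gr u.
Proof.
apply/eqP; rewrite /tl_to_gr -subr_eq0 -fl_liftB; apply/eqP.
have : zspan (fl_gt c) (repr (tl_pi c u) - u) by apply/zpiP; rewrite zpi_repr.
move: (_ - u) => v; elim=> {u v} [u [j cj Hu]||u v _ IHu _ IHv].
- apply: dsumP => i; case: (leqP c i) => ci; first exact: gr_free_nil.
  by apply: (fl_to_gr_hom Hu); rewrite ltn_eqF // (leq_ltn_trans ci).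
- exact: fl_lift0.
- by rewrite fl_liftB IHu IHv subr0.
Qed.

Local Notation A := (autseries Fnc).

(* The component of D of degree k+1 is induced by x |-> f(x) x^-1, for f in A_{k+1}
   representing that of s: it sends the class of x in Gamma_{j+1} / Gamma_{j+2}
   to the class of f(x) x^-1 in Gamma_{j+k+2} / Gamma_{j+k+3}. *)
Definition is_johnson (s : lgr A) (D : Der n c) :=
  forall k (f : aut Fnc), A k.+1 f -> gcls A k f = dsum_at s k ->
  forall j (x : Fnc) (u : trunc_lie n c), GF j.+1 x -> tl_to_gr u = lcls GF j x ->
  tl_to_gr (val (dsum_at D k) u) = lcls GF (j + k.+1) (autfun f x * x^-1)%g.

(* There is exactly one such D, because tl_to_gr is bijective. *)
Definition johnson (s : lgr A) : Der n c := xget 0 [set D | is_johnson s D].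

Definition i_star : lgr (GammaIA Fnc) -> lgr A := gr_incl (@GammaIA_sub Fnc).

End Johnson.

(* Main.v *)
(* The maps A_k/A_{k+1} -> Der_k are bijective because the Lie ring of F_{n,c} is free nilpotent:
   F_n acts on power series M[[t]] by x_i |-> 1 + t f_i for arbitrary endomorphisms f_i,
   so a Lie polynomial u whose class in Gamma_k/Gamma_{k+1} is zero vanishes at all
   families of endomorphisms, and then u = 0 by repeated Lazard elimination of letters.

   The trace of a derivation is the class, modulo commutators of the tensor algebra, of
   the trace of its Jacobian matrix; it is a 1-cocycle, hence it vanishes on the brackets
   in degree >= 2.

   Exactness follows Satoh. Let I be the subring of Der generated by degree 1. Modulo I,
   e_i^* (x) [e_a, y] is e_b^* (x) (y with e_i replaced by [e_a, e_b]), for a letter b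
   occurring nowhere. Hence Der_k is spanned modulo I by the elements
   psi_b(w) = e_b^* (x) [e_{w_1}, [..., [e_{w_k}, e_b]]] with b not in w, whose trace is w.
   Finally psi_c(w w') = psi_b(w' w) modulo I, so psi is defined on cyclic words and
   is inverse to the trace on Der_k / I. *)

Require Import Defs.
From HB Require Import structures.
From mathcomp Require Import all_boot all_order all_algebra ssrAC zify.
From mathcomp Require Import boolp classical_sets functions.
From mathcomp.multinomials Require Import monalg.

Set Implicit Arguments.
Unset Strict Implicit.
Unset Printing Implicit Defensive.

Import GRing.Theory.
Local Open Scope ring_scope.

(** Automorphisms and derivations are compared through families [u : 'I_n -> free_lie n] of values
    on the generators. These live in the untruncated free Lie ring, where substitution, brackets
    ([brf]) and traces ([fdiv]) need no side condition on c; [jrep k f u] says that [u] represents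
    the leading term of [f]. The obstacle for the trace is degree 1: it does not vanish there, yet
    brackets with elements of degree 1 must be traceless. What saves the cocycle argument is that
    the trace of a derivation of degree 1 is a linear combination of letters, and a derivation of
    positive degree sends each letter to a Lie element of degree at least 2, a sum of commutators in
    T(V). Hence the disjunction in [traceless]. The bound n >= c+1 counts letters: in degree k+1 <=
    c-1 the cyclic words have length k+1, and two distinct letters absent from such a word are
    needed, that is k+3 <= n. *)

Section AdditiveMaps.
Variables (V W : zmodType) (f : V -> W).
Hypothesis fB : {morph f : a b / a - b}.

Lemma morphB0 : f 0 = 0. Proof. by rewrite -(subrr 0) fB subrr. Qed.
Lemma morphBN a : f (- a) = - f a. Proof. by rewrite -[- a]sub0r fB morphB0 sub0r. Qed.
Lemma morphBD a b : f (a + b) = f a + f b. Proof. by rewrite -[b]opprK fB morphBN !opprK. Qed.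
Lemma morphBMz a z : f (a *~ z) = f a *~ z.
Proof.
have nat_case m : f (a *+ m) = f a *+ m by elim: m => [|m IH]; rewrite ?morphB0 // !mulrS morphBD IH.
by case: z => m; rewrite ?NegzE ?mulrNz ?morphBN -!pmulrn nat_case.
Qed.
Lemma morphB_sum (I : Type) (r : seq I) (P : pred I) (F : I -> V) :
  f (\sum_(i <- r | P i) F i) = \sum_(i <- r | P i) f (F i).
Proof. exact: (big_morph _ morphBD morphB0). Qed.
End AdditiveMaps.

Section SubClosed.
Variables (V : zmodType) (P : V -> Prop).
Hypotheses (P0 : P 0) (PB : forall a b, P a -> P b -> P (a - b)).

Lemma closedBN a : P a -> P (- a). Proof. by move=> Pa; rewrite -sub0r; apply: PB. Qed.
Lemma closedBD a b : P a -> P b -> P (a + b).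
Proof. by move=> Pa Pb; rewrite -[b]opprK; apply: PB => //; apply: closedBN. Qed.
Lemma closedBMz a z : P a -> P (a *~ z).
Proof.
move=> Pa; have nat_case m : P (a *+ m).
  by elim: m => [//|m IH]; rewrite mulrS; apply: closedBD.
by case: z => m; rewrite ?NegzE ?mulrNz -pmulrn //; apply: closedBN.
Qed.
Lemma closedB_sum (I : Type) (r : seq I) (Q : pred I) (F : I -> V) :
  (forall i, Q i -> P (F i)) -> P (\sum_(i <- r | Q i) F i).
Proof. by move=> hF; apply: (big_ind P) => //; apply: closedBD. Qed.
End SubClosed.

(** * The embedding of free Lie rings into associative rings *)

Section Endo.
Variable M : zmodType.

Definition is_endo (f : M -> M) : bool := `[< {morph f : x y / x + y} >].

Lemma is_endo_closed : zmod_closed is_endo.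
Proof.
split=> [|f g /asboolP fD /asboolP gD]; apply/asboolP => x y.
  by rewrite addr0.
by rewrite !opprfctE !addrfctE fD gD opprD addrACA.
Qed.
HB.instance Definition _ := GRing.isZmodClosed.Build (M -> M) is_endo is_endo_closed.

Definition endo := {f : M -> M | is_endo f}.
HB.instance Definition _ := SubChoice.on endo.
HB.instance Definition _ := [SubChoice_isSubZmodule of endo by <:].

Definition mk_endo (f : M -> M) (fD : {morph f : x y / x + y}) : endo :=
  Sub f (asboolT fD).
Definition endo_fun (f : endo) : M -> M := val f.
Coercion endo_fun : endo >-> Funclass.

Lemma mk_endoE (f : M -> M) (fD : {morph f : x y / x + y}) : mk_endo fD =1 f.
Proof. by []. Qed.
Lemma endoD (f : endo) : {morph f : x y / x + y}.
Proof. by case: f => f fP; apply/asboolP. Qed.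
Lemma endo0 (f : endo) : f 0 = 0.
Proof. by apply: (addrI (f 0)); rewrite -endoD !addr0. Qed.
Lemma endoN (f : endo) x : f (- x) = - f x.
Proof. by apply: (addrI (f x)); rewrite -endoD !subrr endo0. Qed.
Lemma endoB (f : endo) x y : f (x - y) = f x - f y.
Proof. by rewrite endoD endoN. Qed.
Lemma endo_eq (f g : endo) : f =1 g -> f = g.
Proof. by move=> fg; apply/val_inj/funext. Qed.
Lemma endo_addE (f g : endo) x : (f + g : endo) x = f x + g x.
Proof. by []. Qed.

Lemma endo_mulzE (f : endo) a x : (f *~ a : endo) x = f x *~ a.
Proof. exact: (morphBMz (f := fun g : endo => g x)). Qed.

Fact endo_br_subproof (f g : endo) :
  {morph (fun x => f (g x) - g (f x)) : x y / x + y}.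
Proof. by move=> x y; rewrite !endoD opprD addrACA. Qed.
Definition endo_br (f g : endo) : endo := mk_endo (endo_br_subproof f g).

Lemma endo_brE f g x : endo_br f g x = f (g x) - g (f x).
Proof. by []. Qed.

Lemma endo_brDl f g h : endo_br (f + g) h = endo_br f h + endo_br g h.
Proof.
by apply: endo_eq => x; rewrite !(endo_brE, endo_addE) endoD opprD addrACA.
Qed.
Lemma endo_brDr f g h : endo_br f (g + h) = endo_br f g + endo_br f h.
Proof.
by apply: endo_eq => x; rewrite !(endo_brE, endo_addE) endoD opprD addrACA.
Qed.
Lemma endo_brxx f : endo_br f f = 0.
Proof. by apply: endo_eq => x; rewrite endo_brE subrr. Qed.
Lemma endo_jacobi f g h :
  endo_br (endo_br f g) h + endo_br (endo_br g h) f + endo_br (endo_br h f) g = 0.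
Proof.
apply: endo_eq => x; rewrite !(endo_brE, endo_addE) !endoB !opprB.
rewrite [LHS](AC (((2*2)*(2*2))*(2*2)) (((1*8)*(11*2))*((3*6)*(9*4))*((5*12)*(7*10)))) /=.
by rewrite !subrr !addr0.
Qed.
HB.instance Definition _ :=
  Zmodule_isLieRing.Build endo endo_brDl endo_brDr endo_brxx endo_jacobi.

Lemma endo_lbrE (f g : endo) x : (lbr f g : endo) x = f (g x) - g (f x).
Proof. by []. Qed.
End Endo.

Section LieRingExtra.
Variable L : lieRingType.
Implicit Types x y z : L.

Lemma lbrC x y : lbr x y = - lbr y x. Proof. exact: fl_lbrC. Qed.

Lemma lbr_der x y z : lbr x (lbr y z) = lbr (lbr x y) z + lbr y (lbr x z).
Proof.
have := lbr_jacobi x y z.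
rewrite (lbrC (lbr y z) x) (lbrC z x) lbrNl -(lbrC y) => /eqP.
by rewrite addrAC subr_eq0 => /eqP ->.
Qed.

Lemma lbrMzl x y a : lbr (x *~ a) y = lbr x y *~ a.
Proof. exact: (morphBMz (f := lbr^~ y)) (fun _ _ => lbrBl _ _ _) _ _. Qed.
Lemma lbrMzr x y a : lbr x (y *~ a) = lbr x y *~ a.
Proof. exact: (morphBMz (lbrBr x)). Qed.
End LieRingExtra.

(** Elimination replaces the alphabet K by [K * nat], so the terms need an arbitrary, possibly
    infinite, set of letters; [TScale] holds the coefficients that elimination produces. *)
Inductive lie_term (K : Type) :=
| TVar of K
| TZero
| TAdd of lie_term K & lie_term K
| TScale of int & lie_term K
| TBr of lie_term K & lie_term K.
Arguments TZero {K}.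

Section TermEval.
Variables (K : Type) (L : lieRingType) (z : K -> L).
Fixpoint teval (t : lie_term K) : L :=
  match t with
  | TVar y => z y
  | TZero => 0
  | TAdd s t => teval s + teval t
  | TScale a s => teval s *~ a
  | TBr s t => lbr (teval s) (teval t)
  end.
End TermEval.

(* [tlen S d t]: the monomials of [t] have length at most [d], and those of
   length exactly [d] only involve letters of [S]. *)
Inductive tlen (K : Type) : (K -> Prop) -> nat -> lie_term K -> Prop :=
| tlen_low S d t : tlen (fun _ => True) d t -> tlen S d.+1 t
| tlen_var (S : K -> Prop) y : S y -> tlen S 1 (TVar y)
| tlen_zero S d : tlen S d TZero
| tlen_add S d s t : tlen S d s -> tlen S d t -> tlen S d (TAdd s t)
| tlen_scale S d a t : (a != 0 -> tlen S d t) -> tlen S d (TScale a t)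
| tlen_br S a b s t : tlen S a s -> tlen S b t -> tlen S (a + b) (TBr s t).

Fixpoint tall (K : Type) (P : K -> Prop) (t : lie_term K) : Prop :=
  match t with
  | TVar y => P y
  | TZero => True
  | TAdd s t | TBr s t => tall P s /\ tall P t
  | TScale _ s => tall P s
  end.

Fixpoint tletters (K : Type) (t : lie_term K) : seq K :=
  match t with
  | TVar y => [:: y]
  | TZero => [::]
  | TAdd s t | TBr s t => tletters s ++ tletters t
  | TScale _ s => tletters s
  end.

Section TermLength.
Variable K : Type.
Implicit Types (S P : K -> Prop) (s t : lie_term K).

Lemma tlen_lt S d d' t : (d < d')%N -> tlen (fun=> True) d t -> tlen S d' t.
Proof.
elim: d' S => [//|d' IH] S; rewrite ltnS leq_eqVlt => /orP [/eqP <-|dd'] dt.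
  exact: tlen_low.
by apply/tlen_low/IH.
Qed.

Lemma tlen_le d d' t : (d <= d')%N -> tlen (fun=> True) d t -> tlen (fun=> True) d' t.
Proof. by rewrite leq_eqVlt => /orP [/eqP <-//|]; apply: tlen_lt. Qed.

Lemma tlen0_eval S t : tlen S 0 t -> forall (L : lieRingType) (z : K -> L), teval z t = 0.
Proof.
move=> h L z; move: (erefl 0%N) h; move: {1 3}0%N => d d0 h.
elim: h d0 => {S d t} //= [S d s t _ IHs _ IHt e|S d a t _ IH e|S a b s t _ IHs _ IHt e].
- by rewrite IHs ?IHt ?addr0.
- by case: (eqVneq a 0) => [->|/IH ->]; rewrite ?mulr0z ?mul0rz.
- by move/eqP: e; rewrite addn_eq0 => /andP [/eqP a0 _]; rewrite IHs ?lbr0l.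
Qed.

Lemma tlen_sub S S' d t : (forall y, S y -> S' y) -> tlen S d t -> tlen S' d t.
Proof.
move=> SS' h; elim: h S' SS' => {S d t} [S d t h _|S y Sy|S d|S d s t _ IHs _ IHt|S d a t _ IH|S a b s t _ IHs _ IHt] S' SS'.
- exact: tlen_low.
- exact/tlen_var/SS'.
- exact: tlen_zero.
- by apply: tlen_add; [apply: IHs|apply: IHt].
- by apply: tlen_scale => /IH; apply.
- by apply: tlen_br; [apply: IHs|apply: IHt].
Qed.

Lemma tlen_tall S P d t : tlen S d t -> tall P t -> tlen (fun y => S y /\ P y) d t.
Proof.
elim=> {S d t} [S d t h _|S y Sy|S d|S d s t _ IHs _ IHt|S d a t _ IH|S a b s t _ IHs _ IHt] /= Pt.
- exact: tlen_low.
- exact: tlen_var.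
- exact: tlen_zero.
- by case: Pt => Ps Pt; apply: tlen_add; [apply: IHs|apply: IHt].
- by apply: tlen_scale => /IH; apply.
- by case: Pt => Ps Pt; apply: tlen_br; [apply: IHs|apply: IHt].
Qed.

(** Once every top letter has been eliminated, no monomial reaches the maximal length: this is where
    the length bound drops in [lie_null]. *)
Lemma tlen_empty S d t : (forall y, ~ S y) -> tlen S d.+1 t -> tlen (fun=> True) d t.
Proof.
move=> S0 h; move: (erefl d.+1) h; move: {1 3}d.+1 => e ed h.
elim: h d ed S0 => {S e t} [S e t h _|S y Sy|S e|S e s t _ IHs _ IHt|S e a t _ IH|S a b s t hs IHs ht IHt] d ed S0.
- by case: ed h => ->.
- by case: (S0 _ Sy).
- exact: tlen_zero.
- by apply: tlen_add; [apply: IHs|apply: IHt].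
- by apply: tlen_scale => /IH; apply.
- case: a ed hs IHs => [|a] ed hs IHs.
    rewrite -(add0n d); apply: tlen_br; last exact: IHt.
    exact: tlen_sub hs.
  case: ed => <-; apply: tlen_br; first exact: IHs.
  exact: tlen_sub ht.
Qed.

Lemma tlen_exists t : exists d, tlen (fun=> True) d t.
Proof.
elim: t => [y||s [d hs] t [e ht]|a t [d ht]|s [d hs] t [e ht]].
- by exists 1%N; apply: tlen_var.
- by exists 0%N; apply: tlen_zero.
- exists (maxn d e); apply: tlen_add; first exact: tlen_le (leq_maxl _ _) hs.
  exact: tlen_le (leq_maxr _ _) ht.
- by exists d; apply: tlen_scale.
- by exists (d + e)%N; apply: tlen_br.
Qed.
End TermLength.

Lemma tall_sub (K : Type) (P Q : K -> Prop) t : (forall y, P y -> Q y) -> tall P t -> tall Q t.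
Proof.
by move=> PQ; elim: t => //= s IHs t IHt [/IHs ? /IHt].
Qed.

Lemma tall_letters (K : eqType) (t : lie_term K) : tall (fun y => y \in tletters t) t.
Proof.
elim: t => //= [y|s IHs t IHt|s IHs t IHt]; first by rewrite mem_head.
  by split; [apply: tall_sub IHs|apply: tall_sub IHt] => y yt; rewrite mem_cat yt ?orbT.
by split; [apply: tall_sub IHs|apply: tall_sub IHt] => y yt; rewrite mem_cat yt ?orbT.
Qed.

Section Elimination.
Variables (K : eqType) (x : K).

Fixpoint tshift (t : lie_term (K * nat)) : lie_term (K * nat) :=
  match t with
  | TVar yi => TVar (yi.1, yi.2.+1)
  | TZero => TZero
  | TAdd s t => TAdd (tshift s) (tshift t)
  | TScale a s => TScale a (tshift s)
  | TBr s t => TAdd (TBr (tshift s) t) (TBr s (tshift t))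
  end.

(* Lazard elimination: the free Lie ring on K is the direct sum of Zx and of the
   free Lie ring on the (ad x)^i y, y != x; the letter (y, i) stands for (ad x)^i y. *)
Fixpoint telim (t : lie_term K) : int * lie_term (K * nat) :=
  match t with
  | TVar y => if y == x then (1, TZero) else (0, TVar (y, 0%N))
  | TZero => (0, TZero)
  | TAdd s t => ((telim s).1 + (telim t).1, TAdd (telim s).2 (telim t).2)
  | TScale a s => ((telim s).1 *~ a, TScale a (telim s).2)
  | TBr s t => (0, TAdd (TAdd (TScale (telim s).1 (tshift (telim t).2))
                              (TScale (- (telim t).1) (tshift (telim s).2)))
                        (TBr (telim s).2 (telim t).2))
  end.

Section ElimEval.
Variables (L : lieRingType) (z : K -> L).
Definition ad_letters (yi : K * nat) : L := iter yi.2 (lbr (z x)) (z yi.1).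

Lemma teval_tshift p : teval ad_letters (tshift p) = lbr (z x) (teval ad_letters p).
Proof.
elim: p => [[y i]||s IHs t IHt|a s IHs|s IHs t IHt] //=; first by rewrite lbr0r.
- by rewrite IHs IHt lbrDr.
- by rewrite IHs lbrMzr.
- by rewrite IHs IHt [RHS]lbr_der.
Qed.

Lemma teval_elim t :
  teval z t = z x *~ (telim t).1 + teval ad_letters (telim t).2.
Proof.
elim: t => [y||s IHs t IHt|a s IHs|s IHs t IHt] /=.
- by case: eqP => [->|_] /=; rewrite ?mulr1z ?addr0 // mulr0z add0r.
- by rewrite mulr0z addr0.
- by rewrite IHs IHt mulrzDr addrACA.
- by rewrite IHs mulrzDl -mulrzA mulrzz.
- rewrite IHs IHt !teval_tshift lbrDl !lbrDr !lbrMzl !lbrMzr lbrxx !mul0rz add0r.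
  by rewrite mulr0z add0r mulrNz -mulNrz -lbrC addrA.
Qed.
End ElimEval.

Lemma tall_tshift p : tall (fun yi => yi.1 != x) p -> tall (fun yi => yi.1 != x) (tshift p).
Proof.
elim: p => //= s IHs t IHt [ps pt]; first by split; [apply: IHs|apply: IHt].
by split; split=> //; [apply: IHs|apply: IHt].
Qed.

Lemma tall_elim t : tall (fun yi => yi.1 != x) (telim t).2.
Proof.
elim: t => //= [y|s IHs t IHt]; first by case: ifPn.
by split=> //; split; apply: tall_tshift.
Qed.

Lemma tlen_tshift S d p : tlen S d p -> tlen (fun=> True) d (tshift p).
Proof.
elim=> {S d p} [S d t _ IH|S y Sy|S d|S d s t _ IHs _ IHt|S d a t _ IH|S a b s t hs IHs ht IHt] /=.
- exact: tlen_low.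
- exact: tlen_var.
- exact: tlen_zero.
- exact: tlen_add.
- by apply: tlen_scale => /IH.
- by apply: tlen_add; apply: tlen_br => //; [apply: tlen_sub ht|apply: tlen_sub hs].
Qed.

Lemma tlen0_elim S t : tlen S 0 t -> (telim t).1 = 0.
Proof.
move=> h; move: (erefl 0%N) h; move: {1 3}0%N => d d0 h.
elim: h d0 => {S d t} //= [S d s t _ IHs _ IHt e|S d a t _ IH e].
- by rewrite IHs ?IHt.
- by case: (eqVneq a 0) => [->|/IH ->]; rewrite ?mulr0z ?mul0rz.
Qed.

(** A letter (y, i) with i > 0 absorbs i occurrences of x, so a monomial containing it is shorter
    than before; at top length only the letters (y, 0) remain. If a factor of a bracket has length
    bound 0, nothing gets shorter, but its coefficient of x is then 0: hence the guard [a != 0] in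
    [tlen_scale]. *)
Lemma tlen_elim S d t : tlen S d t ->
  tlen (fun yi => [/\ S yi.1, yi.1 != x & yi.2 = 0%N]) d (telim t).2.
Proof.
elim=> {S d t} [S d t _ IH|S y Sy|S d|S d s t _ IHs _ IHt|S d a t _ IH|S a b s t hs IHs ht IHt] /=.
- by apply: tlen_low; apply: tlen_sub IH.
- by case: ifPn => yx; [apply: tlen_zero|apply: tlen_var].
- exact: tlen_zero.
- exact: tlen_add.
- by apply: tlen_scale => /IH.
- apply: tlen_add; last exact: tlen_br.
  apply: tlen_add; apply: tlen_scale => nz.
  + apply: (@tlen_lt _ _ b); last exact: tlen_tshift IHt.
    case: a hs nz {IHs} => [/tlen0_elim ->|a _ _]; first by rewrite eqxx.
    by rewrite addSn ltnS leq_addl.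
  + apply: (@tlen_lt _ _ a); last exact: tlen_tshift IHs.
    case: b ht nz {IHt} => [/tlen0_elim ->|b _ _]; first by rewrite oppr0 eqxx.
    by rewrite addnS ltnS leq_addr.
Qed.
End Elimination.

Section Hurwitz.
Variable M : zmodType.
Local Notation series := (nat -> M).

Fact series_shift_subproof : {morph (fun (m : series) k => m k.+1) : x y / x + y}.
Proof. by []. Qed.
Definition series_shift : endo series := mk_endo series_shift_subproof.

(** The sequence m stands for the series of the m_k t^k / k! and the shift for d/dt; the binomial
    weights avoid the denominators, so that M can be any abelian group. *)
Definition hurwitz_fun (a : nat -> endo M) (m : series) : series :=
  fun k => \sum_(i < k.+1) a i (m (k - i)%N) *+ 'C(k, i).
Fact hurwitz_subproof a : {morph hurwitz_fun a : x y / x + y}.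
Proof.
move=> m m'; apply/funext => k.
rewrite [RHS](_ : _ = hurwitz_fun a m k + hurwitz_fun a m' k) // /hurwitz_fun -big_split.
by apply: eq_bigr => i _ /=; rewrite endoD mulrnDl.
Qed.
Definition hurwitz a : endo series := mk_endo (hurwitz_subproof a).

(* [hurwitz a] is multiplication by the Hurwitz series of a, and the shift is a derivation. *)
Lemma shift_hurwitz a :
  lbr series_shift (hurwitz a) = hurwitz (fun k => a k.+1).
Proof.
apply: endo_eq => m; apply/funext => k; rewrite endo_lbrE.
rewrite [LHS](_ : _ = hurwitz_fun a m k.+1 - hurwitz_fun a (fun k => m k.+1) k) //.
rewrite [RHS](_ : _ = hurwitz_fun (fun k => a k.+1) m k) // /hurwitz_fun.
rewrite big_ord_recl [X in _ - X]big_ord_recl /= !bin0 !subn0 opprD addrACA subrr add0r.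
under eq_bigr => i _ do rewrite /= /bump /= add1n subSS binS mulrnDr.
rewrite big_split /= big_ord_recr /= bin_small // mulr0n addr0.
rewrite [X in X + _ - _](_ : _ = \sum_(i < k) a (bump 0 i) (m (k - bump 0 i).+1) *+ 'C(k, bump 0 i)) ?addrK //.
- by rewrite addrAC subrr add0r; apply: eq_bigr.
- by apply: eq_bigr => i _; rewrite /bump /= add1n -subSn.
Qed.
End Hurwitz.

Lemma fun_mulzE (T : Type) (M : zmodType) (g : T -> M) a k : (g *~ a) k = g k *~ a.
Proof. exact: (morphBMz (f := fun g : T -> M => g k)). Qed.

Section Witt.

(** All modules M are allowed at once because one elimination step passes from M to sequences in
    M. *)
Definition operator_null (K : Type) (t : lie_term K) :=
  forall (M : zmodType) (f : K -> endo M), teval f t = 0.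

Section NullElim.
Variables (K : eqType) (x : K) (t : lie_term K).
Hypothesis t0 : operator_null t.

(** Operators f(y, i) on M come from operators on series: let x act as d/dt and y as the
    multiplication by the series with coefficients f(y, i). Then (ad x)^i y acts as the
    multiplication by the i-th derivative of that series, whose constant term is f(y, i), and taking
    constant terms carries nullity of [t] over to the eliminated term. *)
Lemma null_elim : operator_null (telim x t).2.
Proof.
move=> M f; apply: endo_eq => u.
pose z y : endo (nat -> M) :=
  if y == x then @series_shift M else hurwitz (fun k => f (y, k)).
have zE y i : y != x -> ad_letters x z (y, i) = hurwitz (fun k => f (y, (k + i)%N)).
  move=> yx; rewrite /ad_letters /=; elim: i => [|i IH] /=.
    by rewrite /z (negPf yx); congr hurwitz; apply/funext => k; rewrite addn0.
  rewrite IH {1}/z eqxx shift_hurwitz; congr hurwitz.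
  by apply/funext => k; rewrite addSnnS.
have rep p : tall (fun yi => yi.1 != x) p -> forall m : nat -> M,
    (teval (ad_letters x z) p : endo _) m 0%N = (teval f p : endo _) (m 0%N).
  elim: p => [[y i] /= yx m||s IHs r IHr /= [ps pr] m|a s IHs /= ps m|s IHs r IHr /= [ps pr] m] //=.
  - by rewrite zE // mk_endoE /hurwitz_fun big_ord_recl big_ord0 addr0 bin0.
  - by rewrite !endo_addE -IHs // -IHr.
  - by rewrite !endo_mulzE fun_mulzE IHs.
  - by rewrite !endo_lbrE -IHs // -IHr // -IHr // -IHs.
(* A constant series, so that d/dt kills it and the multiple of x in [teval_elim] disappears. *)
pose m k := if k is 0 then u else 0.
have /(congr1 (fun g : endo _ => g m 0%N)) := t0 z.
rewrite (teval_elim x) endo_addE addrfctE endo_mulzE fun_mulzE /z eqxx -/z.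
by rewrite [series_shift _ m 0%N]/= mul0rz add0r rep //; apply: tall_elim.
Qed.

(** When x acts as the identity of [int] and the other letters as 0, only the coefficient of x
    survives. *)
Lemma null_elim_coef : (telim x t).1 = 0.
Proof.
have idD : {morph @id int : u v / u + v} by [].
pose f y : endo int := if y == x then mk_endo idD else 0.
have f0 s : teval (ad_letters x f) (telim x s).2 = 0.
  elim: s => //= [y|s IHs r IHr|a s IHs|s IHs r IHr].
  - by case: ifPn => //= yx; rewrite /ad_letters /= /f (negPf yx).
  - by rewrite IHs IHr addr0.
  - by rewrite IHs mul0rz.
  - by rewrite IHs lbr0l !teval_tshift IHs IHr !lbr0r !mul0rz !addr0.
have /(congr1 (fun g : endo _ => g 1)) := t0 f.
by rewrite (teval_elim x) f0 addr0 endo_mulzE /f eqxx mk_endoE intz.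
Qed.
End NullElim.

(** Double induction on the length bound d and on the number m of letters allowed at length d.
    Eliminating a letter x of S keeps d and removes x from S, by [tlen_elim], although the alphabet
    itself grows; hence K varies in the induction. When S is empty the bound drops, and S restarts
    as the finite set of letters of [t]. *)
Lemma lie_null d m (K : eqType) (S : seq K) (t : lie_term K) :
  (size S <= m)%N -> tlen (fun y => y \in S) d t -> operator_null t ->
  forall (L : lieRingType) (z : K -> L), teval z t = 0.
Proof.
elim: d m K S t => [|d IHd] m K S t; first by move=> _ /tlen0_eval h _.
elim: m K S t => [|m IHm] K S t.
  rewrite leqn0 => /nilP -> /tlen_empty dt t0.
  apply: (IHd (size (tletters t)) K (tletters t)) => //.
  apply: tlen_sub (tlen_tall (dt _) (tall_letters t)) => // y; by case.
case: S => [|x S] /= Sm dt t0 L z; first by apply: (IHm K [::]).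
rewrite (teval_elim x) (null_elim_coef x t0) mulr0z add0r.
apply: (IHm _ [seq (y, 0%N) | y <- S & y != x]) (null_elim x t0) _ _.
  by rewrite size_map size_filter (leq_trans (count_size _ _)).
apply: tlen_sub (tlen_elim x dt) => -[y i] /= [yS yx ->].
apply/mapP; exists y => //; rewrite mem_filter yx.
by move: yS; rewrite inE (negPf yx).
Qed.

(* Equivalently, the free Lie ring embeds into the tensor algebra. *)
Theorem witt (K : eqType) (t : lie_term K) : operator_null t ->
  forall (L : lieRingType) (z : K -> L), teval z t = 0.
Proof.
move=> t0; have [d dt] := tlen_exists t.
apply: (@lie_null d (size (tletters t)) K (tletters t)) t0 => //.
by apply: tlen_sub (tlen_tall dt (tall_letters t)) => y [].
Qed.
End Witt.

(** * The Magnus representation *)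

Section FreeGroupAction.
Variables (n : nat) (X : Type) (la : 'I_n * bool -> X -> X).
Hypothesis laK : forall a x, la (linv a) (la a x) = x.

Definition fg_act (w : free_group n) (x : X) : X := foldr la x (val w).

Lemma fg_actM u v x : fg_act (u * v)%g x = fg_act u (fg_act v x).
Proof.
case: u v => [u ru] [v rv]; rewrite /fg_act /= {ru rv}.
elim: u => [//|a u IH] /=; rewrite -IH; case: (lcat u v) => [//|b w] /=.
by case: eqP => [->|//] /=; have := laK (linv a) (foldr la x w); rewrite linvK.
Qed.

Lemma fg_act1 x : fg_act 1%g x = x. Proof. by []. Qed.

Lemma fg_actK u x : fg_act u^-1%g (fg_act u x) = x.
Proof. by rewrite -fg_actM mulVg. Qed.
End FreeGroupAction.

Lemma fg_ind n (P : free_group n -> Prop) :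
  P 1%g -> (forall x y, P x -> P y -> P (x * y)%g) -> (forall x, P x -> P x^-1%g) ->
  (forall i, P (fg_gen i)) -> forall x, P x.
Proof.
move=> P1 PM PV Pg [w].
pose U v (rv : reduced v) : free_group n := Sub v rv.
elim: w => [|a w IH] rw.
  by have -> : exist _ [::] rw = 1%g :> free_group n by apply: val_inj.
have rw' : reduced w by apply: path_sorted rw.
have ra : reduced [:: a] by [].
have -> : exist _ (a :: w) rw = (U _ ra * U _ rw')%g :> free_group n.
  by apply: val_inj; rewrite /= lconsE.
apply: (PM); last exact: IH.
case: a ra {rw} => i [] ra.
  by have -> : U _ ra = fg_gen i by apply: val_inj.
by have -> : U _ ra = (fg_gen i)^-1%g; [apply: val_inj|apply: PV].
Qed.

Section Morphism.
Variables (G H : groupType) (phi : G -> H).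
Hypothesis phiM : {morph phi : x y / (x * y)%g}.

Lemma gmorph1 : phi 1%g = 1%g.
Proof. by apply: (mulgI (phi 1%g)); rewrite -phiM !mulg1. Qed.
Lemma gmorphV x : phi x^-1%g = (phi x)^-1%g.
Proof. by apply: (mulgI (phi x)); rewrite -phiM !mulgV gmorph1. Qed.
Lemma gmorphR x y : phi [~ x, y]%g = [~ phi x, phi y]%g.
Proof. by rewrite /commg /conjg !(phiM, gmorphV). Qed.

Lemma lcs_morph k x : lcs setT k x -> lcs setT k (phi x).
Proof.
case: k => [//|k]; elim: k x => [//|k IH] x; rewrite !lcsSS.
elim=> {x} [_ [x [y [Kx _ ->]]]||x y _ Kx _ Ky|x _ Kx].
- by rewrite gmorphR; apply: gen_in; exists (phi x), (phi y); split=> //; apply: IH.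
- by rewrite gmorph1; apply: gen1.
- by rewrite phiM; apply: genM.
- by rewrite gmorphV; apply: genV.
Qed.
End Morphism.

Lemma lcs_qpi (G : groupType) (N : normal_subgroup G) k x :
  lcs setT k x -> lcs setT k (qpi N x).
Proof. by apply: lcs_morph => a b; rewrite qpiM. Qed.

Section Magnus.
Variables (n : nat) (M : zmodType) (f : 'I_n -> endo M).
Local Notation series := (nat -> M).
Implicit Types (m : series) (x y : free_group n) (a b : endo M).

(* The generator x_i acts on M[[t]] as 1 + t f_i. *)
Fixpoint inv_series i m k : M :=
  m k - (if k is k'.+1 then f i (inv_series i m k') else 0).

Definition magnus_letter (l : 'I_n * bool) m : series :=
  if l.2 then fun k => m k + (if k is k'.+1 then f l.1 (m k') else 0)
  else inv_series l.1 m.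

Lemma magnus_letterK l m : magnus_letter (linv l) (magnus_letter l m) = m.
Proof.
apply/funext; case: l => i []; rewrite /magnus_letter /=.
  by elim=> [|k IH] /=; rewrite ?IH addrK.
by case=> [|k]; rewrite /= ?subrK.
Qed.

Definition magnus_act x m : series := fg_act magnus_letter x m.

Lemma magnus_actM x y m : magnus_act (x * y)%g m = magnus_act x (magnus_act y m).
Proof. exact/fg_actM/magnus_letterK. Qed.
Lemma magnus_actK x m : magnus_act x^-1%g (magnus_act x m) = m.
Proof. exact/fg_actK/magnus_letterK. Qed.

Lemma magnus_letterB l m m' : magnus_letter l (m - m') = magnus_letter l m - magnus_letter l m'.
Proof.
apply/funext => k; case: l => i []; rewrite /magnus_letter /=.
  by case: k => [|k]; rewrite !(addrfctE, opprfctE) ?addr0 // endoB opprD addrACA.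
elim: k => [|k IH] /=; rewrite !(addrfctE, opprfctE) /= ?subr0 //.
by rewrite IH !(addrfctE, opprfctE) endoB !opprD addrACA.
Qed.

Lemma magnus_actB x m m' : magnus_act x (m - m') = magnus_act x m - magnus_act x m'.
Proof.
rewrite /magnus_act /fg_act; elim: (val x) => [//|l w IH] /=.
by rewrite IH magnus_letterB.
Qed.

Definition ord_ge s m := forall j, (j < s)%N -> m j = 0.

Lemma ord_geB s m m' : ord_ge s m -> ord_ge s m' -> ord_ge s (m - m').
Proof. by move=> h h' j js; rewrite addrfctE opprfctE h ?h' ?subr0. Qed.
Lemma ord_ge_le s s' m : (s <= s')%N -> ord_ge s' m -> ord_ge s m.
Proof. by move=> ss h j /leq_trans /(_ ss); apply: h. Qed.

Lemma magnus_act_lead x s m : ord_ge s m -> ord_ge s (magnus_act x m) /\ magnus_act x m s = m s.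
Proof.
rewrite /magnus_act /fg_act => ms; elim: (val x) => [//|l w []] /=.
move: (foldr _ _ _) => m' m's <-; case: l => i []; rewrite /magnus_letter /=.
  split=> [j js|].
    by rewrite m's //; case: j js => [|j] js; rewrite ?addr0 // m's ?endo0 ?addr0 // ltnW.
  by case: s ms m's => [|s] ms m's; rewrite ?addr0 // (m's s) // endo0 addr0.
have z j : (j < s)%N -> inv_series i m' j = 0.
  elim: j => [|j IH] js /=; rewrite m's // ?subr0 // IH ?endo0 ?subr0 //; exact: ltnW.
split; first exact: z.
by case: s {ms m's} z => [|s] z /=; rewrite ?subr0 // z // endo0 subr0.
Qed.

(* x = 1 + t^k a + higher order terms *)
Definition magnus k x a := forall s m, ord_ge s m ->
  ord_ge (s + k) (magnus_act x m - m) /\ (magnus_act x m - m) (s + k)%N = a (m s).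

Lemma magnus_gen i : magnus 1 (fg_gen i) (f i).
Proof.
move=> s m ms; rewrite addn1; split.
  move=> j js; rewrite addrfctE opprfctE /magnus_act /fg_act /= /magnus_letter /= addrAC subrr add0r.
  by case: j js => [//|j]; rewrite ltnS => /ms ->; rewrite endo0.
by rewrite addrfctE opprfctE /magnus_act /fg_act /= /magnus_letter /= addrAC subrr add0r.
Qed.

Lemma magnus1 k : magnus k 1%g 0.
Proof.
by move=> s m ms; rewrite /magnus_act fg_act1 subrr; split.
Qed.

Lemma magnusM k x y a b : magnus k x a -> magnus k y b -> magnus k (x * y)%g (a + b).
Proof.
move=> hx hy s m ms.
have [oy ly] := magnus_act_lead y ms.
have [o1 l1] := hx _ _ oy; have [o2 l2] := hy _ _ ms.
have -> : magnus_act (x * y)%g m - m =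
   (magnus_act x (magnus_act y m) - magnus_act y m) + (magnus_act y m - m).
  by rewrite magnus_actM addrA subrK.
split=> [j js|]; first by rewrite addrfctE o1 ?o2 ?addr0.
by rewrite addrfctE l1 l2 ly.
Qed.

Lemma magnusV k x a : magnus k x a -> magnus k x^-1%g (- a).
Proof.
move=> hx s m ms; have [o1 l1] := hx _ _ ms.
have [o2 l2] := magnus_act_lead x^-1%g o1.
have -> : magnus_act x^-1%g m - m = - magnus_act x^-1%g (magnus_act x m - m).
  by rewrite magnus_actB magnus_actK opprB.
by split=> [j js|]; rewrite opprfctE; [rewrite o2 ?oppr0|rewrite l2 l1].
Qed.

(** Since [x, y] = (yx)^-1 xy, one has [x, y] - 1 = (yx)^-1 ((x - 1)(y - 1) - (y - 1)(x - 1)), and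
    (yx)^-1 does not change leading coefficients. *)
Lemma magnusR j k x y a b : magnus j x a -> magnus k y b ->
  magnus (j + k) [~ x, y]%g (lbr a b).
Proof.
move=> hx hy s m ms; have [o1 l1] := hx _ _ ms; have [o2 l2] := hy _ _ ms.
have [o12 l12] := hy _ _ o1; have [o21 l21] := hx _ _ o2.
pose z := (y * x)%g.
have cE : [~ x, y]%g = (z^-1 * (x * y))%g by rewrite /z /commg conjgE invgM !mulgA.
have E : magnus_act [~ x, y]%g m - m = magnus_act z^-1%g
    ((magnus_act x (magnus_act y m - m) - (magnus_act y m - m))
    - (magnus_act y (magnus_act x m - m) - (magnus_act x m - m))).
  rewrite -[X in _ - X = _](magnus_actK z m) cE [in LHS]magnus_actM -magnus_actB; congr magnus_act.
  rewrite /z !magnus_actM !magnus_actB !opprB.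
  rewrite [RHS](AC ((2*2)*(2*2)) (((1*8)*(5*2))*((3*6)*(7*4)))) /=.
  by rewrite !subrr !addr0.
have o3 : ord_ge (s + (j + k)) ((magnus_act x (magnus_act y m - m) - (magnus_act y m - m))
    - (magnus_act y (magnus_act x m - m) - (magnus_act x m - m))).
  by apply: ord_geB; [rewrite (addnC j) addnA|rewrite addnA].
have [o4 l4] := magnus_act_lead z^-1%g o3.
rewrite E; split=> //; rewrite l4 addrfctE opprfctE endo_lbrE -l1 -l2 -l12 -l21.
by rewrite -!addnA (addnC k).
Qed.

Lemma magnusS k x a : magnus k.+1 x a -> magnus k x 0.
Proof.
move=> hx s m /hx [o _]; split; first by apply: ord_ge_le o; rewrite leq_add2l.
by rewrite o // addnS.
Qed.

Lemma magnus_inj k x a b : magnus k x a -> magnus k x b -> a = b.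
Proof.
move=> ha hb; apply: endo_eq => u.
pose m : series := fun k => if k is 0 then u else 0.
have m0 : ord_ge 0 m by [].
by have [_ <-] := ha _ _ m0; have [_ <-] := hb _ _ m0.
Qed.

Lemma magnus_lcs k x : lcs setT k.+1 x -> exists a, magnus k.+1 x a.
Proof.
elim: k x => [|k IH] x.
  move=> _; elim/fg_ind: x => [|x y [a ha] [b hb]|x [a ha]|i].
  - by exists 0; apply: magnus1.
  - by exists (a + b); apply: magnusM.
  - by exists (- a); apply: magnusV.
  - by exists (f i); apply: magnus_gen.
rewrite lcsSS; elim=> {x} [_ [x [y [Kx _ ->]]]||x y _ [a ha] _ [b hb]|x _ [a ha]].
- have [a ha] := IH _ Kx.
  have [b hb] : exists b, magnus 1 y b.
    elim/fg_ind: y => [|x' y [a' ha'] [b hb]|x' [a' ha']|i].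
    - by exists 0; apply: magnus1.
    - by exists (a' + b); apply: magnusM.
    - by exists (- a'); apply: magnusV.
    - by exists (f i); apply: magnus_gen.
  by exists (lbr a b); rewrite -addn1; apply: magnusR.
- by exists 0; apply: magnus1.
- by exists (a + b); apply: magnusM.
- by exists (- a); apply: magnusV.
Qed.
End Magnus.

(** * The graded Lie ring of the free nilpotent group *)

Section GradedClasses.
Variables (G : groupType) (F : nseries G).
Implicit Types (x y : G).

Lemma lcls_at k x : dsum_at (lcls F k x) k = gcls F k x.
Proof. by rewrite /dsum_at /= /lcls_fun eqxx. Qed.
Lemma lcls_at_neq k i x : i != k -> dsum_at (lcls F k x) i = 0.
Proof. by rewrite /dsum_at /= /lcls_fun => /negPf ->. Qed.

Lemma lcls1 k : lcls F k 1%g = 0.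
Proof.
by apply: dsumP => i; case: (eqVneq i k) => [->|ik]; rewrite ?lcls_at ?gcls1 ?lcls_at_neq.
Qed.
Lemma lclsM k x y : F k.+1 x -> F k.+1 y -> lcls F k (x * y)%g = lcls F k x + lcls F k y.
Proof.
move=> Fx Fy; apply: dsumP => i; rewrite dsum_atD.
by case: (eqVneq i k) => [->|ik]; rewrite ?lcls_at ?gclsM // !lcls_at_neq // addr0.
Qed.
Lemma lclsV k x : F k.+1 x -> lcls F k x^-1%g = - lcls F k x.
Proof.
move=> Fx; apply: dsumP => i; rewrite dsum_atN.
by case: (eqVneq i k) => [->|ik]; rewrite ?lcls_at ?gclsV // !lcls_at_neq // oppr0.
Qed.
Lemma lclsR j k x y : F j.+1 x -> F k.+1 y ->
  lcls F (j + k).+1 [~ x, y]%g = lbr (lcls F j x) (lcls F k y).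
Proof.
move=> Fx Fy; apply: dsumP => i; rewrite [RHS]lgr_brE.
case: (eqVneq i (j + k).+1) => [->|ik]; last first.
  rewrite lcls_at_neq // big1 // => p _; rewrite big1 // => q /eqP pq.
  case: (eqVneq (p : nat) j) => [pj|pj]; last by rewrite lcls_at_neq // gbr0l.
  case: (eqVneq (q : nat) k) => [qk|qk]; last by rewrite [X in gbr _ _ X]lcls_at_neq // gbr0r.
  by case/eqP: ik; rewrite -pq pj qk.
have jk : (j < (j + k).+1)%N by rewrite ltnS leq_addr.
have kj : (k < (j + k).+1)%N by rewrite ltnS leq_addl.
rewrite (bigD1 (Ordinal jk)) //= (bigD1 (Ordinal kj)) //= !lcls_at gbrE //.
rewrite [X in _ + X + _]big1 ?addr0 => [|q /andP [/eqP [/addnI qk]] /eqP nq]; last first.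
  by case: nq; apply: val_inj.
rewrite big1 ?addr0 // => p np; rewrite big1 // => q /eqP pq.
by rewrite lcls_at_neq ?gbr0l.
Qed.

Lemma lcls_eq0 k x : F k.+1 x -> lcls F k x = 0 <-> F k.+2 x.
Proof.
move=> Fx; rewrite -gcls_eq0 // -lcls_at; split=> [->//|x0].
apply: dsumP => i; case: (eqVneq i k) => [->//|ik]; exact: lcls_at_neq.
Qed.

Lemma lcls_eqP k x y : F k.+1 x -> F k.+1 y -> lcls F k x = lcls F k y <-> F k.+2 (x^-1 * y)%g.
Proof.
move=> Fx Fy; rewrite -gclsP // -!lcls_at; split=> [->//|xy].
apply: dsumP => i; case: (eqVneq i k) => [->//|ik]; by rewrite !lcls_at_neq.
Qed.

End GradedClasses.

Section FreeLieExtra.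
Variable n : nat.
Local Notation L := (free_lie n).

Lemma fl_ind (P : L -> Prop) :
  (forall i, P (fl_gen i)) -> P 0 -> (forall u v, P u -> P v -> P (u + v)) ->
  (forall u, P u -> P (- u)) -> (forall u v, P u -> P v -> P (lbr u v)) ->
  forall u, P u.
Proof.
move=> Pg P0 PD PN PR u; rewrite -[u]fl_repr.
elim: (repr u) => [i||s IHs t IHt|s IHs|s IHs t IHt].
- exact: Pg.
- exact: P0.
- by rewrite flclsD; apply: PD.
- by rewrite flclsN; apply: PN.
- by rewrite flclsR; apply: PR.
Qed.

Lemma fl_homN k (u : L) : fl_hom k u -> fl_hom k (- u).
Proof. exact: (closedBN (@fl_hom0 n k) (@fl_homB n k)). Qed.
Lemma fl_homD k (u v : L) : fl_hom k u -> fl_hom k v -> fl_hom k (u + v).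
Proof. exact: (closedBD (@fl_hom0 n k) (@fl_homB n k)). Qed.
Lemma fl_homMz k (u : L) a : fl_hom k u -> fl_hom k (u *~ a).
Proof. exact: (closedBMz (@fl_hom0 n k) (@fl_homB n k)). Qed.
Lemma fl_hom_sum k (I : Type) (r : seq I) (P : pred I) (g : I -> L) :
  (forall i, P i -> fl_hom k (g i)) -> fl_hom k (\sum_(i <- r | P i) g i).
Proof. exact: (closedB_sum (@fl_hom0 n k) (@fl_homB n k)). Qed.

Lemma fl_hom_eq0 (u : L) : fl_hom 0 u -> u = 0.
Proof.
move=> h; move: (erefl 0%N) h; move: {1 3}0%N => d d0 h.
elim: h d0 => {d u} // [k u v _ IHu _ IHv k0|j k u v _ IHu _ _ /eqP].
  by rewrite IHu ?IHv ?subr0.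
by rewrite addn_eq0 => /andP [/eqP j0 _]; rewrite IHu ?lbr0l.
Qed.

(** Elements of degree 0 vanish, so both factors of a bracket may be taken of positive degree; the
    shifted index matches that of [gr]. *)
Lemma fl_homS_ind (P : nat -> L -> Prop) :
  (forall i, P 0%N (fl_gen i)) -> (forall k, P k 0) ->
  (forall k u v, P k u -> P k v -> P k (u - v)) ->
  (forall j k u v, fl_hom j.+1 u -> fl_hom k.+1 v -> P j u -> P k v -> P (j + k).+1 (lbr u v)) ->
  forall k u, fl_hom k.+1 u -> P k u.
Proof.
move=> Pg P0 PB PR.
suff H k u : fl_hom k u -> (0 < k)%N -> P k.-1 u by move=> k u /H; apply.
elim=> {k u} [i|k|k u v _ IHu _ IHv|j k u v hu IHu hv IHv] //.
- by move=> k0; apply: PB; [apply: IHu|apply: IHv].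
- case: j hu IHu => [/fl_hom_eq0 -> _|j hu IHu]; first by rewrite lbr0l.
  case: k hv IHv => [/fl_hom_eq0 -> _|k hv IHv]; first by rewrite lbr0r.
  by move=> _; rewrite addSn addnS; apply: PR => //; [apply: IHu|apply: IHv].
Qed.

Lemma fl_lift_id (u : L) : fl_lift (@fl_gen n) u = u.
Proof.
elim/fl_ind: u => [i||u v IHu IHv|u IHu|u v IHu IHv].
- exact: fl_lift_gen.
- exact: fl_lift0.
- by rewrite fl_liftD IHu IHv.
- by rewrite fl_liftN IHu.
- by rewrite fl_liftR IHu IHv.
Qed.

Fixpoint term_of (s : lterm n) : lie_term 'I_n :=
  match s with
  | LVar i => TVar i
  | LZero => TZero
  | LAdd s t => TAdd (term_of s) (term_of t)
  | LOpp s => TScale (-1) (term_of s)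
  | LBr s t => TBr (term_of s) (term_of t)
  end.
Lemma teval_term_of (K : lieRingType) (f : 'I_n -> K) s : teval f (term_of s) = leval f s.
Proof.
by elim: s => //= [s -> t ->|s ->|s -> t ->] //; rewrite mulrN1z.
Qed.

Lemma free_lie_witt (u : L) :
  (forall (M : zmodType) (f : 'I_n -> endo M), fl_lift f u = 0) -> u = 0.
Proof.
move=> u0; rewrite -[LHS]fl_lift_id /fl_lift -teval_term_of; apply: witt => M f.
by rewrite teval_term_of; apply: u0.
Qed.

Lemma fl_hom_decomp (u : L) : exists N (g : nat -> L),
  (forall k, fl_hom k (g k)) /\ u = \sum_(k < N) g k.
Proof.
elim: (fl_hom_span u) => {u} [u [k hu]||u v _ [N [g [hg ->]]] _ [N' [g' [hg' ->]]]].
- exists k.+1, (fun i => if i == k then u else 0); split=> [i|].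
    by case: eqP => [->//|_]; apply: fl_hom0.
  by rewrite big_ord_recr /= eqxx big1 ?add0r // => i _; rewrite ltn_eqF.
- by exists 0%N, (fun=> 0); split=> [k|]; rewrite ?big_ord0 //; apply: fl_hom0.
- pose tr N (g : nat -> L) k := if (k < N)%N then g k else 0.
  have trE m (h : nat -> L) m' : (m <= m')%N -> \sum_(k < m) h k = \sum_(k < m') tr m h k.
    move=> mm'; rewrite (big_ord_widen m' (fun k => h k)) // big_mkcond.
    by apply: eq_bigr => i _.
  exists (maxn N N'), (fun k => tr N g k - tr N' g' k); split=> [k|].
    by apply: fl_homB; rewrite /tr; case: ifP => _ //; apply: fl_hom0.
  by rewrite (trE N g _ (leq_maxl _ N')) (trE N' g' _ (leq_maxr N _)) -sumrB.
Qed.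
End FreeLieExtra.

Section GradedIso.
Variables n c : nat.
Local Notation L := (free_lie n).
Local Notation Fnc := (free_nil n c).
Local Notation GF := (Gamma Fnc).
Local Notation togr := (@fl_to_gr n c).

Lemma fl_to_grD (u v : L) : togr (u + v) = togr u + togr v. Proof. exact: fl_liftD. Qed.
Lemma fl_to_grB (u v : L) : togr (u - v) = togr u - togr v. Proof. exact: fl_liftB. Qed.
Lemma fl_to_grR (u v : L) : togr (lbr u v) = lbr (togr u) (togr v). Proof. exact: fl_liftR. Qed.
Lemma fl_to_gr0 : togr 0 = 0. Proof. exact: fl_lift0. Qed.

Lemma fn_ind (P : Fnc -> Prop) :
  P 1%g -> (forall x y, P x -> P y -> P (x * y)%g) -> (forall x, P x -> P x^-1%g) ->
  (forall i, P (fn_gen c i)) -> forall x, P x.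
Proof.
move=> P1 PM PV Pg x; rewrite -(qpi_repr x).
elim/fg_ind: (repr x) => [|a b Pa Pb|a Pa|i].
- exact: P1.
- by rewrite qpiM; apply: PM.
- by rewrite qpiV; apply: PV.
- exact: Pg.
Qed.

(** A single group element realises [u] both in the graded ring of F_{n,c} and as a Magnus leading
    term, for all operators at once. It is taken in F_n, since the Magnus action need not factor
    through F_{n,c}. *)
Lemma hom_lift k (u : L) : fl_hom k.+1 u -> exists x : free_group n,
  [/\ lcs setT k.+1 x, togr u = lcls GF k (qpi _ x) &
      forall (M : zmodType) (f : 'I_n -> endo M), magnus f k.+1 x (fl_lift f u)].
Proof.
pose sub k := lcs_subgroup (setT_subgroup (free_group n)) k.
move=> hu; elim/fl_homS_ind: hu => {k u} [i|k|k u v [x [Kx ux mx]] [y [Ky vy my]]|j k u v _ _ [x [Kx ux mx]] [y [Ky vy my]]].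
- exists (fg_gen i); split=> // [|M f].
    by rewrite /fl_to_gr fl_lift_gen.
  by rewrite fl_lift_gen; apply: magnus_gen.
- exists 1%g; split=> [||M f]; first by case: (sub k.+1).
    by rewrite fl_to_gr0 qpi1 lcls1.
  by rewrite fl_lift0; apply: magnus1.
- have [_ sM sV] := sub k.+1.
  exists (x * y^-1)%g; split=> [||M f]; first by apply: (sM) => //; apply: (sV).
    by rewrite fl_to_grB ux vy qpiM qpiV lclsM ?lclsV //; do ?apply: nserV; apply: lcs_qpi.
  by rewrite fl_liftB; apply: magnusM (mx M f) (magnusV (my M f)).
- exists [~ x, y]%g; split=> [||M f].
  + by rewrite -addSn -addnS; apply: lcs_comm.
  + by rewrite fl_to_grR ux vy qpiR lclsR //; apply: lcs_qpi.
  + by rewrite fl_liftR -addSn -addnS; apply: magnusR.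
Qed.

(** If the class of the lift x vanishes, then x lies in Gamma_{k+2}(F_n), which contains
    Gamma_{c+1}(F_n) because k < c. Its Magnus coefficient of degree k+1 is therefore 0, so [u]
    vanishes on all families of endomorphisms. *)
Lemma fl_to_gr_inj_hom k (u : L) : fl_hom k.+1 u -> (k < c)%N ->
  dsum_at (togr u) k = 0 -> u = 0.
Proof.
move=> hu kc; have [x [Kx -> mx]] := hom_lift hu.
have GFx : GF k.+1 (qpi _ x) by apply: lcs_qpi Kx.
rewrite lcls_at => /(gcls_eq0 GFx) /lcs_quot [y Ky /qpiP yx].
have [_ sM _] := lcs_subgroup (setT_subgroup (free_group n)) k.+2.
have Kx2 : lcs setT k.+2 x.
  rewrite -(mulVKg y x); apply: (sM) => //.
  exact: (@nser_le _ (Gamma (free_group n)) k.+2 c.+1).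
apply: free_lie_witt => M f; have [a /magnusS ha] := magnus_lcs f Kx2.
exact: magnus_inj (mx M f) ha.
Qed.

Lemma fl_to_gr_surj k (x : Fnc) : GF k.+1 x ->
  exists2 u : L, fl_hom k.+1 u & togr u = lcls GF k x.
Proof.
have base (y : Fnc) : exists2 u : L, fl_hom 1 u & togr u = lcls GF 0 y.
  elim/fn_ind: y => [|y z [u hu uy] [v hv vz]|y [u hu uy]|i].
  - by exists 0; [apply: fl_hom0|rewrite fl_to_gr0 lcls1].
  - by exists (u + v); [apply: fl_homD|rewrite fl_to_grD uy vz lclsM].
  - by exists (- u); [apply: fl_homN|rewrite /fl_to_gr fl_liftN -/(togr u) uy lclsV].
  - by exists (fl_gen i); [apply: fl_hom_gen|rewrite /fl_to_gr fl_lift_gen].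
elim: k x => [|k IH] x; first by move=> _; apply: base.
rewrite [GF _]lcsSS; elim=> {x} [_ [x [y [Kx _ ->]]]||x y Kx [u hu ux] Ky [v hv vy]|x Kx [u hu ux]].
- have [u hu ux] := IH x Kx; have [v hv vy] := base y.
  exists (lbr u v); first by rewrite -addn1; apply: fl_homR.
  by rewrite fl_to_grR ux vy -lclsR // addn0.
- by exists 0; [apply: fl_hom0|rewrite fl_to_gr0 lcls1].
- by exists (u + v); [apply: fl_homD|rewrite fl_to_grD ux vy lclsM].
- by exists (- u); [apply: fl_homN|rewrite /fl_to_gr fl_liftN -/(togr u) ux lclsV].
Qed.

Lemma dsum_at_sum (A : nat -> zmodType) (I : Type) (r : seq I) (P : pred I) (F : I -> dsum A) k :
  dsum_at (\sum_(i <- r | P i) F i) k = \sum_(i <- r | P i) dsum_at (F i) k.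
Proof. by apply: (big_morph (fun x => dsum_at x k)). Qed.

Lemma zspan_sum (V : zmodType) (S : set V) (I : Type) (r : seq I) (P : pred I) (F : I -> V) :
  (forall i, P i -> zspan S (F i)) -> zspan S (\sum_(i <- r | P i) F i).
Proof. exact: (closedB_sum (@zspan0 V S) (@zspanB V S)). Qed.

Lemma fl_to_gr_eq0 (u : L) : togr u = 0 -> zspan (fl_gt c) u.
Proof.
have [N [g [hg ->]]] := fl_hom_decomp u => u0; apply: zspan_sum => k _.
case: (ltnP c k) => [ck|kc]; first by apply: zspan_in; exists k.
suff -> : g k = 0 by apply: zspan0.
have : forall i, i.+1 = k -> dsum_at (togr (g k)) i = 0.
  move=> i ik; have /(congr1 (fun s => dsum_at s i)) := u0.
  rewrite /fl_to_gr (big_morph _ (fl_liftD _) (fl_lift0 _)) dsum_at_sum (bigD1 k) //= big1 ?addr0 //.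
  move=> j jk; apply: fl_to_gr_hom (hg j) _; apply: contra jk => /eqP ij.
  by apply/eqP/val_inj; rewrite /= -ij.
have := hg k; move: (g k) => v; move: (k : nat) kc => m {k}.
case: m => [|m] mc hv v0; first exact: fl_hom_eq0 hv.
by apply: fl_to_gr_inj_hom hv mc _; apply: v0.
Qed.

Lemma fl_to_gr_inj (u v : L) : togr u = togr v -> tl_pi c u = tl_pi c v.
Proof.
by move=> uv; apply/zpiP/fl_to_gr_eq0; rewrite fl_to_grB uv subrr.
Qed.
Lemma fl_to_gr_pi (u v : L) : tl_pi c u = tl_pi c v -> togr u = togr v.
Proof. by move=> uv; rewrite -!tl_to_grE uv. Qed.

Lemma tl_to_gr_inj : injective (@tl_to_gr n c).
Proof.
by move=> x y; rewrite -[x]tl_repr -[y]tl_repr !tl_to_grE => /fl_to_gr_inj.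
Qed.
End GradedIso.

(* The semidirect product of L by its adjoint module: Lie morphisms [L' -> ldual L]
   of the form [v |-> (phi v, d v)] are the pairs of a morphism [phi] and a [phi]-derivation [d]. *)
Section LieDual.
Variable L : lieRingType.
Definition ldual := (L * L)%type.
HB.instance Definition _ := GRing.Zmodule.on ldual.
Definition ldual_br (x y : ldual) : ldual := (lbr x.1 y.1, lbr x.2 y.1 + lbr x.1 y.2).

Lemma ldual_brDl x y z : ldual_br (x + y) z = ldual_br x z + ldual_br y z.
Proof. by rewrite /ldual_br /= !lbrDl addrACA. Qed.
Lemma ldual_brDr x y z : ldual_br x (y + z) = ldual_br x y + ldual_br x z.
Proof. by rewrite /ldual_br /= !lbrDr addrACA. Qed.
Lemma ldual_brxx x : ldual_br x x = 0.
Proof. by rewrite /ldual_br lbrxx [lbr x.1 x.2]lbrC subrr. Qed.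
Lemma ldual_jacobi x y z :
  ldual_br (ldual_br x y) z + ldual_br (ldual_br y z) x + ldual_br (ldual_br z x) y = 0.
Proof.
rewrite /ldual_br /=; apply/eqP; rewrite xpair_eqE /= !lbrDl lbr_jacobi eqxx /=; apply/eqP.
rewrite [LHS](AC (3*3*3) ((1*6*8)*(2*4*9)*(3*5*7))) /=.
by rewrite !lbr_jacobi !addr0.
Qed.
HB.instance Definition _ :=
  Zmodule_isLieRing.Build ldual ldual_brDl ldual_brDr ldual_brxx ldual_jacobi.
End LieDual.

(** * Derivations of the free Lie ring and of its truncation *)

Section Derivations.
Variable n : nat.
Local Notation L := (free_lie n).
Implicit Types (u : 'I_n -> L) (a b v w : L).

Definition fder_lift u a : ldual L := fl_lift (fun i => (fl_gen i, u i) : ldual L) a.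
Definition fder u a : L := (fder_lift u a).2.

Lemma fder_lift1 u a : (fder_lift u a).1 = a.
Proof.
rewrite /fder_lift; elim/fl_ind: a => [i||a b IHa IHb|a IHa|a b IHa IHb].
- by rewrite fl_lift_gen.
- by rewrite fl_lift0.
- by rewrite fl_liftD /= IHa IHb.
- by rewrite fl_liftN /= IHa.
- by rewrite fl_liftR /= IHa IHb.
Qed.

Lemma fder_gen u i : fder u (fl_gen i) = u i.
Proof. by rewrite /fder /fder_lift fl_lift_gen. Qed.
Lemma fderD u a b : fder u (a + b) = fder u a + fder u b.
Proof. by rewrite /fder /fder_lift fl_liftD. Qed.
Lemma fderN u a : fder u (- a) = - fder u a.
Proof. by rewrite /fder /fder_lift fl_liftN. Qed.
Lemma fderB u a b : fder u (a - b) = fder u a - fder u b.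
Proof. by rewrite fderD fderN. Qed.
Lemma fder0 u : fder u 0 = 0.
Proof. by rewrite /fder /fder_lift fl_lift0. Qed.
Lemma fderR u a b : fder u (lbr a b) = lbr (fder u a) b + lbr a (fder u b).
Proof.
rewrite /fder /fder_lift fl_liftR -/(fder_lift u a) -/(fder_lift u b).
transitivity (lbr (fder_lift u a).2 (fder_lift u b).1 + lbr (fder_lift u a).1 (fder_lift u b).2) => //.
by rewrite !fder_lift1.
Qed.

Lemma fder_hom u k j a : (forall i, fl_hom k.+1 (u i)) -> fl_hom j a -> fl_hom (j + k) (fder u a).
Proof.
move=> hu; elim=> {j a} [i|j|j a b _ ha _ hb|j l a b ha IHa hb IHb].
- by rewrite fder_gen add1n.
- by rewrite fder0; apply: fl_hom0.
- by rewrite fderB; apply: fl_homB.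
- rewrite fderR; apply: fl_homD; first by rewrite addnAC; apply: fl_homR.
  by rewrite -addnA; apply: fl_homR.
Qed.

(** The values on the generators of the commutator of the derivations [fder u] and [fder u']. *)
Definition brf u u' : 'I_n -> L := fun i => fder u (u' i) - fder u' (u i).

Lemma brf_hom u u' j k : (forall i, fl_hom j.+2 (u i)) -> (forall i, fl_hom k.+2 (u' i)) ->
  forall i, fl_hom (j + k).+3 (brf u u' i).
Proof.
move=> hu hu' i; apply: fl_homB.
  by have := fder_hom hu (hu' i); rewrite addSn addnS addSn (addnC k).
by have := fder_hom hu' (hu i); rewrite addSn addnS addSn.
Qed.

Section Truncation.
Variable c : nat.

Lemma fder_gt u k a : (forall i, fl_hom k.+1 (u i)) -> zspan (fl_gt c) a -> zspan (fl_gt c) (fder u a).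
Proof.
move=> hu; elim=> {a} [a [j cj ha]||a b _ IHa _ IHb].
- by apply: zspan_in; exists (j + k)%N; [apply: ltn_addr|apply: fder_hom].
- by rewrite fder0; apply: zspan0.
- by rewrite fderB; apply: zspanB.
Qed.

Lemma tl_pi_hom k a : (c < k)%N -> fl_hom k a -> tl_pi c a = 0.
Proof. by move=> ck ha; apply/zpi_eq0/zspan_in; exists k. Qed.

Definition tder u (x : trunc_lie n c) : trunc_lie n c := tl_pi c (fder u (repr x)).

Section TruncDer.
Variables (k : nat) (u : 'I_n -> L).
Hypothesis hu : forall i, fl_hom k.+1 (u i).

Lemma tder_pi a : tder u (tl_pi c a) = tl_pi c (fder u a).
Proof.
apply/zpiP; rewrite -fderB; apply: (fder_gt hu); apply/zpiP; exact: zpi_repr.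
Qed.

Fact tder_subproof : is_der k (tder u).
Proof.
apply/asboolP; split=> [x y|x y|j _ [a ha ->]].
- by rewrite -[x]tl_repr -[y]tl_repr -tl_piD !tder_pi fderD tl_piD.
- rewrite -[x]tl_repr -[y]tl_repr -[lbr _ _]/(tl_br _ _) tl_brE !tder_pi fderR tl_piD.
  by rewrite -!tl_brE.
- by rewrite tder_pi; exists (fder u a) => //; apply: fder_hom.
Qed.
Definition tder_der : der n c k := Sub (tder u) tder_subproof.
End TruncDer.

Lemma der_fder k (d : der n c k) u : (forall i, val d (tl_gen c i) = tl_pi c (u i)) ->
  forall a, val d (tl_pi c a) = tl_pi c (fder u a).
Proof.
case: d => d dP /= du; have /asboolP [dD dR _] := dP.
have d0 : d 0 = 0 by apply: (addrI (d 0)); rewrite -dD !addr0.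
have tl0 : tl_pi c 0 = 0 :> trunc_lie n c by apply: zpi0.
have tlN (a : L) : tl_pi c (- a) = - tl_pi c a.
  by apply: (addrI (tl_pi c a)); rewrite -tl_piD !subrr.
have dN x : d (- x) = - d x by apply: (addrI (d x)); rewrite -dD !subrr.
elim/fl_ind => [i||a b IHa IHb|a IHa|a b IHa IHb].
- by rewrite fder_gen -du.
- by rewrite fder0 tl0.
- by rewrite fderD !tl_piD dD IHa IHb.
- by rewrite fderN !tlN dN IHa.
- rewrite fderR tl_piD -!tl_brE -[tl_br _ _]/(lbr _ _) dR IHa IHb //.
Qed.

Lemma der_eq k (d e : der n c k) : (forall i, val d (tl_gen c i) = val e (tl_gen c i)) -> d = e.
Proof.
move=> de; apply/val_inj/funext => x; rewrite -[x]tl_repr.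
have h i : val e (tl_gen c i) = tl_pi c (repr (val e (tl_gen c i))) by rewrite tl_repr.
by rewrite (der_fder h) (der_fder (fun i => etrans (de i) (h i))).
Qed.

Lemma der_gen_lift k (d : der n c k) : exists u,
  (forall i, fl_hom k.+1 (u i)) /\ (forall i, val d (tl_gen c i) = tl_pi c (u i)).
Proof.
have /asboolP [_ _ dH] := valP d.
have /choice [u hu] i : exists a, fl_hom k.+1 a /\ val d (tl_gen c i) = tl_pi c a.
  have [|a ha da] := dH 1%N (tl_gen c i); last by exists a.
  by exists (fl_gen i) => //; apply: fl_hom_gen.
by exists u; split=> i; case: (hu i).
Qed.
End Truncation.
End Derivations.

(** * Automorphisms of the free nilpotent group *)

Section FreeLift.
Variables (n : nat) (G : groupType) (g : 'I_n -> G).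

Definition fg_letter (l : 'I_n * bool) (x : G) : G := ((if l.2 then g l.1 else (g l.1)^-1) * x)%g.
Lemma fg_letterK l x : fg_letter (linv l) (fg_letter l x) = x.
Proof. by case: l => i []; rewrite /fg_letter /= ?mulKg ?mulVKg. Qed.
Definition fg_lift (w : free_group n) : G := fg_act fg_letter w 1%g.

Lemma fg_liftM u v : fg_lift (u * v)%g = (fg_lift u * fg_lift v)%g.
Proof.
rewrite /fg_lift fg_actM; last exact: fg_letterK.
move: (fg_act _ v 1%g) => x; rewrite /fg_act; elim: (val u) => [|l w IH] /=.
  by rewrite mul1g.
by rewrite IH /fg_letter mulgA.
Qed.
Lemma fg_lift_gen i : fg_lift (fg_gen i) = g i.
Proof. by rewrite /fg_lift /fg_act /= /fg_letter mulg1. Qed.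
End FreeLift.

Section FreeNilAut.
Variables n c : nat.
Local Notation Fnc := (free_nil n c).
Local Notation GF := (Gamma Fnc).

Section NilLift.
Variable g : 'I_n -> Fnc.
Definition fn_lift (x : Fnc) : Fnc := fg_lift g (repr x).

(** A morphism from F_n to a c-nilpotent group kills Gamma_{c+1}(F_n), so the chosen representative
    does not matter. *)
Lemma fn_lift_pi w : fn_lift (qpi _ w) = fg_lift g w.
Proof.
have gM := fg_liftM g; set N := lcs_normal _ _.
have /(lcs_morph gM) /free_nil_lcs := qrepr_pi N w.
rewrite gM gmorphV // => h; rewrite /fn_lift.
by apply: (mulgI (fg_lift g (repr (qpi N w)))^-1%g); rewrite h mulVg.
Qed.
Lemma fn_liftM : {morph fn_lift : x y / (x * y)%g}.
Proof.
by move=> x y; rewrite -[x]qpi_repr -[y]qpi_repr -qpiM !fn_lift_pi fg_liftM.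
Qed.
Lemma fn_lift_gen i : fn_lift (fn_gen c i) = g i.
Proof. by rewrite fn_lift_pi fg_lift_gen. Qed.
End NilLift.

Section UnipotentEndo.
Variable phi : Fnc -> Fnc.
Hypothesis phiM : {morph phi : x y / (x * y)%g}.
Hypothesis phi_gen : forall i, GF 2 (phi (fn_gen c i) * (fn_gen c i)^-1)%g.

Lemma unipotent_lcls j x : GF j.+1 x -> lcls GF j (phi x) = lcls GF j x.
Proof.
have phiGF k y : GF k y -> GF k (phi y) by apply: lcs_morph.
have base y : lcls GF 0 (phi y) = lcls GF 0 y.
  elim/fn_ind: y => [|y z IHy IHz|y IHy|i].
  - by rewrite gmorph1.
  - by rewrite phiM !lclsM ?IHy ?IHz.
  - by rewrite gmorphV // !lclsV ?IHy.
  - rewrite -[phi _](mulgVK (fn_gen c i)) lclsM //.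
    by have /(lcls_eq0 (F := GF)) -> := phi_gen i; rewrite ?add0r.
elim: j x => [|j IH] x; first by move=> _; apply: base.
rewrite [GF _]lcsSS; elim=> {x} [_ [x [y [Kx _ ->]]]||x y Kx hx Ky hy|x Kx hx].
- by rewrite gmorphR // -(addn0 j) !lclsR ?IH ?base //; apply: phiGF.
- by rewrite gmorph1.
- by rewrite phiM !lclsM ?hx ?hy //; apply: phiGF.
- by rewrite gmorphV // !lclsV ?hx //; apply: phiGF.
Qed.

Lemma unipotent_inj : injective phi.
Proof.
move=> x y xy; have : phi (x^-1 * y)%g = 1%g by rewrite phiM gmorphV // xy mulVg.
move: (x^-1 * y)%g (mulVKg x y) => z <- z1.
suff -> : z = 1%g by rewrite mulg1.
suff H j : GF j.+1 z by apply/free_nil_lcs/H.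
elim: j => [//|j IH].
by apply/(lcls_eq0 (F := GF)) => //; rewrite -unipotent_lcls // z1 lcls1.
Qed.

(** Successive approximation: phi(z) and z agree modulo the next term of the lower central series,
    and the error is trivial after c steps. *)
Lemma unipotent_surj y : exists x, phi x = y.
Proof.
suff H d j z : (j + d = c)%N -> GF j.+1 z -> exists x, phi x = z by apply: (H c 0%N).
elim: d j z => [|d IH] j z.
  by rewrite addn0 => -> /free_nil_lcs ->; exists 1%g; rewrite gmorph1.
rewrite addnS -addSn => jd Kz.
have Kp : GF j.+1 (phi z) by apply: lcs_morph Kz.
have [|x ex] := IH _ ((phi z)^-1 * z)%g jd; first exact/lcls_eqP/unipotent_lcls.
by exists (z * x)%g; rewrite phiM ex mulVKg.
Qed.

Lemma unipotent_aut : exists f : aut Fnc, autfun f =1 phi.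
Proof.
have /choice [psi psiK] := unipotent_surj.
have pP : is_autpair (phi, psi).
  by apply/asboolP; split=> //= x; apply: unipotent_inj; rewrite psiK.
by exists (Sub (phi, psi) pP).
Qed.
End UnipotentEndo.
End FreeNilAut.

(** * Displacements and leading terms of automorphisms *)

Section Displacement.
Variables n c : nat.
Local Notation L := (free_lie n).
Local Notation Fnc := (free_nil n c).
Local Notation GF := (Gamma Fnc).
Local Notation A := (autseries Fnc).
Local Notation togr := (@fl_to_gr n c).
Implicit Types (f g : aut Fnc) (x y : Fnc).

Definition disp f x : Fnc := (f x * x^-1)%g.

Lemma gammaT x : GF 1 x. Proof. by []. Qed.

Lemma lclsJ k x y : GF k.+1 x -> lcls GF k (x ^ y)%g = lcls GF k x.
Proof.
move=> Kx; apply: dsumP => i; case: (eqVneq i k) => [->|ik]; last by rewrite !lcls_at_neq.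
by rewrite !lcls_at (gclsJ Kx (gammaT y)).
Qed.

Lemma disp_GF k f j x : A k f -> GF j.+1 x -> GF (j + k).+1 (disp f x).
Proof. by move=> Af Kx; rewrite -addSn addnC; apply: autfil_act. Qed.

Lemma dispM k f j x y : A k f -> GF j.+1 x -> GF j.+1 y ->
  lcls GF (j + k) (disp f (x * y)%g) = lcls GF (j + k) (disp f x) + lcls GF (j + k) (disp f y).
Proof.
move=> Af Kx Ky; have Dx := disp_GF Af Kx; have Dy := disp_GF Af Ky.
have -> : disp f (x * y)%g = (disp f x * disp f y ^ x^-1)%g.
  by rewrite /disp autM conjgE !gnorm.
by rewrite lclsM ?lclsJ //; apply: (nserJ (gammaT _)).
Qed.

Lemma disp1 f : disp f 1%g = 1%g. Proof. by rewrite /disp aut_1 mulgV. Qed.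

Lemma dispV k f j x : A k f -> GF j.+1 x ->
  lcls GF (j + k) (disp f x^-1%g) = - lcls GF (j + k) (disp f x).
Proof.
move=> Af Kx; apply: (addrI (lcls GF (j + k) (disp f x))).
by rewrite -dispM ?mulgV ?disp1 ?lcls1 ?subrr //; apply: nserV.
Qed.

Lemma dispR k f j l x y : A k.+1 f -> GF j.+1 x -> GF l.+1 y ->
  lcls GF ((j + l).+1 + k.+1) (disp f [~ x, y]%g) =
    lbr (lcls GF (j + k.+1) (disp f x)) (lcls GF l y)
    + lbr (lcls GF j x) (lcls GF (l + k.+1) (disp f y)).
Proof.
move=> Af Kx Ky; have Dx := disp_GF Af Kx; have Dy := disp_GF Af Ky.
have -> : disp f [~ x, y]%g =
    ([~ disp f x, disp f y * y] ^ x * ([~ x, disp f y] ^ y) ^ [~ x, y]^-1)%g.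
  by rewrite /disp aut_R /commg !conjgE !gnorm.
have Dy1 : GF l.+1 (disp f y) by apply: nser_le Dy; rewrite ltnS leq_addr.
have Dyy : GF l.+1 (disp f y * y)%g by apply: nserM.
have e1 : ((j + l).+1 + k.+1 = (j + k.+1 + l).+1)%N by lia.
have e2 : ((j + l).+1 + k.+1 = (j + (l + k.+1)).+1)%N by lia.
have R1 : GF ((j + l).+1 + k.+1).+1 [~ disp f x, disp f y * y]%g.
  by rewrite e1 -addSn -addnS; apply: nserR.
have R2 : GF ((j + l).+1 + k.+1).+1 [~ x, disp f y]%g.
  by rewrite e2 -addSn -addnS; apply: nserR.
rewrite lclsM; try by do ?apply: (nserJ (gammaT _)).
rewrite !lclsJ //; last by apply: (nserJ (gammaT _)).
rewrite {1}e1 e2 !lclsR // (lclsM (F := GF)) //.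
(* An automorphism of degree k+1 >= 1 displaces y at least one step deeper, so [disp f y * y] has
   the class of y. *)
have -> : lcls GF l (disp f y) = 0; last by rewrite add0r.
by apply/(lcls_eq0 (F := GF)) => //; apply: nser_le Dy; rewrite !ltnS addnS ltnS leq_addr.
Qed.

Lemma aut_lclsE f m x : A 1%N f -> GF m.+1 x -> lcls GF m (f x) = lcls GF m x.
Proof.
move=> Af Kx; apply: unipotent_lcls => //; first exact: autM.
by move=> i; apply: (Af).
Qed.

Lemma dispMf k f g j x : A k.+1 f -> A k.+1 g -> GF j.+1 x ->
  lcls GF (j + k.+1) (disp (f * g)%g x) = lcls GF (j + k.+1) (disp f x) + lcls GF (j + k.+1) (disp g x).
Proof.
move=> Af Ag Kx; have Dx := disp_GF Af Kx; have Dy := disp_GF Ag Kx.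
have A1 : A 1%N f by apply: nser_le Af.
have -> : disp (f * g)%g x = (f (disp g x) * disp f x)%g.
  by rewrite /disp autmE autM aut_V !gnorm.
by rewrite lclsM ?aut_lclsE 1?addrC //; apply: aut_lcs.
Qed.

Lemma disp_id x : disp 1%g x = 1%g. Proof. by rewrite /disp aut1E mulgV. Qed.

Lemma dispVf k f j x : A k.+1 f -> GF j.+1 x ->
  lcls GF (j + k.+1) (disp f^-1%g x) = - lcls GF (j + k.+1) (disp f x).
Proof.
move=> Af Kx; apply: (addrI (lcls GF (j + k.+1) (disp f x))).
rewrite -dispMf ?mulgV ?disp_id ?lcls1 ?subrr //; exact: nserV.
Qed.

Lemma disp_eq k f g j x : A k.+1 f -> A k.+1 g -> gcls A k f = gcls A k g -> GF j.+1 x ->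
  lcls GF (j + k.+1) (disp f x) = lcls GF (j + k.+1) (disp g x).
Proof.
move=> Af Ag /(gclsP Af Ag) Ah Kx.
have Ah' := nserS Ah.
rewrite -[g](mulVKg f) dispMf // [X in _ + X](_ : _ = 0) ?addr0 //.
apply/(lcls_eq0 (F := GF)); first exact: disp_GF.
by rewrite -addnS; apply: disp_GF.
Qed.

(** The Johnson derivation of degree k+1 of [f], by its values on the generators. The values are
    lifted to the untruncated Lie ring, hence determined only up to degrees above c. *)
Definition jrep k f (u : 'I_n -> L) :=
  A k.+1 f /\ forall i, togr (u i) = lcls GF k.+1 (disp f (fn_gen c i)).

Lemma autser_gen k f : (forall i, GF k.+2 (disp f (fn_gen c i))) -> A k.+1 f.
Proof.
move=> fx; suff : autfil k.+1 f by [].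
move=> x; elim/fn_ind: x => [|x y Kx Ky|x Kx|i]; last exact: fx.
- by rewrite aut_1 mulgV; exact: (nser1 GF k.+2).
- have -> : (f (x * y) * (x * y)^-1 = f x * x^-1 * (f y * y^-1) ^ x^-1)%g.
    by rewrite autM conjgE !gnorm.
  by apply: (nserM (F := GF) (k := k.+2)) => //; apply: (nserJ (F := GF) (gammaT _) (k := k.+2)).
- rewrite aut_V.
  have -> : ((f x)^-1 * x^-1^-1 = ((f x * x^-1)^-1) ^ x)%g by rewrite conjgE !gnorm.
  by apply: (nserJ (F := GF) (gammaT _) (k := k.+2)); apply: (nserV (F := GF) (k := k.+2)).
Qed.

Lemma disp_class k f j x y : A k.+1 f -> GF j.+1 x -> GF j.+1 y -> lcls GF j x = lcls GF j y ->
  lcls GF (j + k.+1) (disp f x) = lcls GF (j + k.+1) (disp f y).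
Proof.
move=> Af Kx Ky /(lcls_eqP Kx Ky) Kz; have Kz' := nserS Kz.
rewrite -[y](mulVKg x) dispM // [X in _ + X](_ : _ = 0) ?addr0 //.
apply/(lcls_eq0 (F := GF)); first exact: disp_GF.
by rewrite -addSn; apply: disp_GF.
Qed.

(** The right-hand side depends only on the class of x, by [disp_class]; it is enough to find one
    element y with the class of v, and y can be built along the construction of v. *)
Lemma jrep_fder k f u j v x : jrep k f u -> fl_hom j.+1 v -> GF j.+1 x -> togr v = lcls GF j x ->
  togr (fder u v) = lcls GF (j + k.+1) (disp f x).
Proof.
move=> [Af fu] hv Kx vx.
suff [y [Ky vy ->]] : exists y, [/\ GF j.+1 y, togr v = lcls GF j y &
    togr (fder u v) = lcls GF (j + k.+1) (disp f y)].
  by apply: disp_class => //; rewrite -vy.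
elim/fl_homS_ind: hv {x Kx vx} => {j v} [i|j|j v w [x [Kx vx dx]] [y [Ky wy dy]]|j l v w _ _ [x [Kx vx dx]] [y [Ky wy dy]]].
- by exists (fn_gen c i); split=> //; rewrite ?fder_gen // /fl_to_gr fl_lift_gen.
- exists 1%g; split; first exact: nser1.
    by rewrite fl_to_gr0 lcls1.
  by rewrite fder0 fl_to_gr0 disp1 lcls1.
- have Ky' := nserV Ky; exists (x * y^-1)%g; split; first exact: nserM.
    by rewrite fl_to_grB vx wy lclsM ?lclsV.
  by rewrite fderB fl_to_grB dx dy dispM ?dispV.
- exists [~ x, y]%g; split; first by rewrite -addSn -addnS; apply: nserR.
    by rewrite fl_to_grR vx wy lclsR.
  by rewrite fderR fl_to_grD !fl_to_grR dx dy vx wy dispR.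
Qed.

Lemma jrepD k f g u v : jrep k f u -> jrep k g v -> jrep k (f * g)%g (fun i => u i + v i).
Proof.
move=> [Af fu] [Ag gv]; split; first exact: nserM.
by move=> i; rewrite fl_to_grD fu gv -(add0n k.+1) dispMf.
Qed.

Lemma jrepB k f g u v : jrep k f u -> jrep k g v -> jrep k (f * g^-1)%g (fun i => u i - v i).
Proof.
move=> [Af fu] [Ag gv]; have Ag' := nserV Ag; split; first exact: nserM.
by move=> i; rewrite fl_to_grB fu gv -(add0n k.+1) dispMf ?dispVf.
Qed.

Lemma jrep1 k : jrep k 1%g (fun=> 0).
Proof.
split; first exact: nser1.
by move=> i; rewrite disp_id lcls1 fl_to_gr0.
Qed.

Lemma jrepR k l f g u v : (forall i, fl_hom k.+2 (u i)) -> (forall i, fl_hom l.+2 (v i)) ->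
  jrep k f u -> jrep l g v -> jrep (k + l).+1 [~ f, g]%g (brf u v).
Proof.
move=> hu hv ju jv; have [Af fu] := ju; have [Ag gv] := jv.
have Ah : A (k + l).+2 [~ f, g]%g by rewrite -addSn -addnS; apply: nserR.
split=> // i; rewrite /brf fl_to_grB; set x := fn_gen c i.
have Ka : GF k.+2 (disp f x) by apply: (disp_GF (j := 0) Af).
have Kb : GF l.+2 (disp g x) by apply: (disp_GF (j := 0) Ag).
rewrite (jrep_fder ju (hv i) Kb (gv i)) (jrep_fder jv (hu i) Ka (fu i)).
have fx : f x = (disp f x * x)%g by rewrite mulgVK.
have gx : g x = (disp g x * x)%g by rewrite mulgVK.
set h := [~ f, g]%g in Ah *.
move: (disp f x) (disp g x) fx gx Ka Kb => a b fx gx Ka Kb.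
have A1 : A 1%N (g * f)%g.
  by apply: nserM; [apply: nser_le Ag|apply: nser_le Af].
have Kw : GF (k + l).+3 (disp h x) by apply: (disp_GF (j := 0) Ah).
have Da : GF (k + l).+3 (disp g a).
  by have := disp_GF Ag Ka; rewrite addnS addSn.
have Db : GF (k + l).+3 (disp f b).
  by have := disp_GF Af Kb; rewrite addnS addSn (addnC l).
have -> : (k.+1 + l.+1 = (k + l).+2)%N by lia.
have -> : (l.+1 + k.+1 = (k + l).+2)%N by lia.
(* The automorphism gf fixes graded classes and satisfies (gf)[f, g] = fg; after applying it, the
   displacement of [f, g] at x becomes fg(x) (gf(x))^-1, which no longer contains inverses of f and
   g. *)
rewrite -[RHS](aut_lclsE A1) //.
have -> : autfun (g * f)%g (disp h x) = (disp f b * [~ b^-1, a^-1] * (disp g a)^-1)%g.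
  have hx : autfun (g * f)%g (autfun h x) = f (g x).
    by rewrite -[RHS]autmE -[LHS]autmE /h /commg conjgE !gnorm.
  have -> : autfun (g * f)%g (disp h x) = (f (g x) * (g (f x))^-1)%g.
    by rewrite {1}/disp autM aut_V hx.
  rewrite {1}gx {1}fx (autM f b x) (autM g a x) fx gx /disp.
  by rewrite /commg conjgE !gnorm.
(* One step too deep to contribute to the class. *)
have Kc : GF (k + l).+4 [~ b^-1, a^-1]%g.
  have -> : ((k + l).+4 = l.+2 + k.+2)%N by lia.
  by apply: nserR; apply: nserV.
have Kc' := nserS Kc.
have Da' := nserV Da.
have Dc : GF (k + l).+3 (disp f b * [~ b^-1, a^-1])%g by apply: nserM.
rewrite (lclsM (F := GF) Dc Da') (lclsM (F := GF) Db Kc') (lclsV (F := GF) Da).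
by rewrite ((lcls_eq0 (F := GF) Kc').2 Kc) addr0.
Qed.

(** The generators of F_{n,c} may be sent anywhere in F_{n,c}; x_i goes to y_i x_i, where y_i
    realises u_i, and such an endomorphism is invertible because it is unipotent. *)
Lemma jrep_exists k u : (forall i, fl_hom k.+2 (u i)) -> exists f, jrep k f u.
Proof.
move=> hu.
have /choice [y hy] i : exists y, GF k.+2 y /\ togr (u i) = lcls GF k.+1 y.
  by have [y [Ky uy _]] := hom_lift c (hu i); exists (qpi _ y); split=> //; apply: lcs_qpi.
pose phi := fn_lift (fun i => y i * fn_gen c i)%g.
have phi_gen i : (phi (fn_gen c i) * (fn_gen c i)^-1)%g = y i.
  by rewrite /phi fn_lift_gen mulgK.
have [|f fE] := unipotent_aut (fn_liftM (fun i => y i * fn_gen c i)%g).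
  by move=> i; rewrite phi_gen; case: (hy i) => Ky _; apply: nser_le Ky.
exists f; split.
  by apply: autser_gen => i; rewrite /disp fE phi_gen; case: (hy i).
by move=> i; rewrite /disp fE phi_gen; case: (hy i).
Qed.

Lemma jrep_of_aut k f : A k.+1 f -> exists u, (forall i, fl_hom k.+2 (u i)) /\ jrep k f u.
Proof.
move=> Af.
have /choice [u hu] i : exists v, fl_hom k.+2 v /\ togr v = lcls GF k.+1 (disp f (fn_gen c i)).
  have [|v hv vE] := @fl_to_gr_surj n c k.+1 (disp f (fn_gen c i)); last by exists v.
  exact: (disp_GF (j := 0) Af).
by exists u; split=> [i|]; [case: (hu i)|split=> // i; case: (hu i)].
Qed.
End Displacement.

(** * The Johnson morphism *)

Section JohnsonMap.
Variables n c : nat.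
Local Notation L := (free_lie n).
Local Notation Fnc := (free_nil n c).
Local Notation GF := (Gamma Fnc).
Local Notation A := (autseries Fnc).
Implicit Types (s t : lgr A) (D : Der n c) (f g : aut Fnc) (u v : 'I_n -> L).

Lemma is_johnson_gen s D k f u i : is_johnson s D -> jrep k f u ->
  gcls A k f = dsum_at s k -> val (dsum_at D k) (tl_gen c i) = tl_pi c (u i).
Proof.
move=> sD [Af fu] fs; apply: tl_to_gr_inj; rewrite tl_to_grE fu.
apply: (sD k f Af fs 0%N (fn_gen c i) (tl_gen c i)) => //.
by rewrite tl_to_grE /fl_to_gr fl_lift_gen.
Qed.

(** One representative per degree is enough: [disp_eq] passes to all the others, and [jrep_fder]
    from the generators to all x. *)
Lemma jrep_is_johnson s D :
  (forall k, exists f u, [/\ jrep k f u, gcls A k f = dsum_at s k &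
     forall i, val (dsum_at D k) (tl_gen c i) = tl_pi c (u i)]) ->
  is_johnson s D.
Proof.
move=> sD k f Af fs j x v Kx vx.
have [g [u [ju gs Du]]] := sD k; have [Ag _] := ju.
have [a ha ax] := fl_to_gr_surj Kx.
have -> : v = tl_pi c a by apply: tl_to_gr_inj; rewrite vx tl_to_grE ax.
rewrite (der_fder Du) tl_to_grE (jrep_fder ju ha Kx ax).
by apply: disp_eq => //; rewrite fs gs.
Qed.

Lemma rep_exists s k : exists u, (forall i, fl_hom k.+2 (u i)) /\ jrep k (grep (dsum_at s k)) u.
Proof. exact/jrep_of_aut/grepP. Qed.

Lemma is_johnson_exists s : exists D, is_johnson s D.
Proof.
have /choice [u hu] := rep_exists s.
have hom k i : fl_hom k.+2 (u k i) by case: (hu k).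
have supp : exists N, forall k, (N <= k)%N -> tder_der c (hom k) = 0.
  exists c => k ck; apply: der_eq => i /=.
  by rewrite (tder_pi c (hom k)) fder_gen; apply: (tl_pi_hom (k := k.+2)) => //; lia.
exists (mkdsum supp : Der n c); apply: jrep_is_johnson => k.
exists (grep (dsum_at s k)), (u k); split=> [||i]; first by case: (hu k).
  exact: grepK.
by rewrite /= (tder_pi c (hom k)) fder_gen.
Qed.

Lemma johnsonP s : is_johnson s (johnson s).
Proof. by have [D sD] := is_johnson_exists s; apply: (xgetPex 0 (ex_intro _ D sD)). Qed.

Lemma johnson_gen s k f u i : jrep k f u -> gcls A k f = dsum_at s k ->
  val (dsum_at (johnson s) k) (tl_gen c i) = tl_pi c (u i).
Proof. exact/is_johnson_gen/johnsonP. Qed.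

Lemma johnsonD : {morph @johnson n c : s t / s + t}.
Proof.
move=> s t; apply: dsumP => k; apply: der_eq => i.
have [u [_ ju]] := rep_exists s k; have [v [_ jv]] := rep_exists t k.
have [As _] := ju; have [At _] := jv.
rewrite (johnson_gen i (jrepD ju jv)) ?tl_piD; last by rewrite gclsM // !grepK dsum_atD.
rewrite dsum_atD [RHS](_ : _ = val (dsum_at (johnson s) k) (tl_gen c i) + val (dsum_at (johnson t) k) (tl_gen c i)) //.
by rewrite (johnson_gen i ju) ?grepK // (johnson_gen i jv) ?grepK.
Qed.

Lemma johnson_inj : injective (@johnson n c).
Proof.
move=> s t st; apply: dsumP => k.
have [u [_ ju]] := rep_exists s k; have [v [_ jv]] := rep_exists t k.
have [As us] := ju; have [At vt] := jv.
rewrite -(grepK (dsum_at s k)) -(grepK (dsum_at t k)); apply/gclsP => //.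
have As' := nserV As.
apply: autser_gen => i; have Kx := gammaT (fn_gen c i).
apply/(lcls_eq0 (F := GF)).
  exact: (disp_GF (j := 0) (nserM As' At) Kx).
rewrite -(add0n k.+1) dispMf // dispVf // add0n -us -vt -(addNr (fl_to_gr c (u i))); congr (_ + _).
apply: fl_to_gr_pi; rewrite -(johnson_gen i jv (grepK _)) -(johnson_gen i ju (grepK _)).
by rewrite st.
Qed.

Lemma autser_ge k f : (c <= k)%N -> A k f -> f = 1%g.
Proof.
move=> ck Af; apply: autP => x; rewrite aut1E.
have /free_nil_lcs e : GF c.+1 (disp f x).
  by apply: (@nser_le _ GF _ k.+1) => //; apply: (disp_GF (j := 0) Af).
by rewrite -[LHS](mulgVK x) -/(disp f x) e mul1g.
Qed.

Lemma johnson_surj D : exists s, johnson s = D.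
Proof.
have H k : exists fu : aut Fnc * ('I_n -> L), jrep k fu.1 fu.2 /\
    forall i, val (dsum_at D k) (tl_gen c i) = tl_pi c (fu.2 i).
  have [u [hu Du]] := der_gen_lift (dsum_at D k).
  by have [f ju] := jrep_exists c hu; exists (f, u).
have /choice [fu hfu] := H.
have supp : exists N, forall k, (N <= k)%N -> gcls A k (fu k).1 = 0.
  exists c => k ck; have [[Af _] _] := hfu k.
  by rewrite (autser_ge _ Af) ?gcls1 //; lia.
exists (mkdsum supp); apply: dsumP => k; apply: der_eq => i.
have [ju ->] := hfu k.
exact: (johnson_gen i ju).
Qed.

Lemma johnson_bij : bijective (@johnson n c).
Proof.
have /choice [h hK] := johnson_surj.
by exists h => // s; apply: johnson_inj; rewrite hK.
Qed.
End JohnsonMap.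

(** * The trace as a cocycle *)

(* An abstract presentation of the tensor algebra T(V), with words as basis: it
   prevents unification from unfolding the operations of the monoid algebra. *)
Record tensor_model (n : nat) := TensorModel {
  tm_ring :> pzRingType;
  mon : seq 'I_n -> tm_ring;
  coef : seq 'I_n -> tm_ring -> int;
  lin_ext : (seq 'I_n -> tm_ring) -> tm_ring -> tm_ring;
  tmi : free_lie n -> tm_ring;
  mon_nil : mon [::] = 1;
  mon_cat : forall s s', mon (s ++ s') = mon s * mon s';
  coefB : forall s, {morph coef s : a b / a - b};
  coef_mon : forall s s', coef s' (mon s) = (s == s')%:R;
  coef_inj : forall a b, (forall s, coef s a = coef s b) -> a = b;
  ta_ind : forall P : tm_ring -> Prop, P 0 -> (forall a b, P a -> P b -> P (a - b)) ->
    (forall s, P (mon s)) -> forall t, P t;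
  lin_extB : forall F, {morph lin_ext F : a b / a - b};
  lin_ext_mon : forall F s, lin_ext F (mon s) = F s;
  tmiB : {morph tmi : a b / a - b};
  tmiR : forall a b, tmi (lbr a b) = tmi a * tmi b - tmi b * tmi a;
  tmi_gen : forall i, tmi (@fl_gen n i) = mon [:: i];
  tmi_coef : forall s (a : free_lie n), coef s (tmi a) = (Defs.iota a)@_(FMonom s) }.

Section TensorModelExists.
Variable n : nat.
Local Notation T := (tensor_alg n).

Let word s : T := << FMonom s >>.

Fact word_nil : word [::] = 1. Proof. by rewrite /word -fmoneE. Qed.
Fact word_cat s s' : word (s ++ s') = word s * word s'.
Proof.
rewrite /word [RHS]malgM_def fgmulUU mulr1; congr (<< _ *g _ >>).
by rewrite -[RHS]/(fmmul _ _) fmmulE.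
Qed.
Fact word_coef s s' : (word s)@_(FMonom s') = (s == s')%:R.
Proof. by rewrite /word mcoeffU1 fmP. Qed.
Fact word_coef_inj (a b : T) : (forall s, a@_(FMonom s) = b@_(FMonom s)) -> a = b.
Proof. by move=> ab; apply/malgP => -[s]. Qed.

Fact word_ind (P : T -> Prop) : P 0 -> (forall a b, P a -> P b -> P (a - b)) ->
  (forall s, P (word s)) -> forall t, P t.
Proof.
move=> P0 PB Pm t.
rewrite [t]monalgE; apply: closedB_sum => // -[s] _; set z := t@__.
have -> : (<< z *g FMonom s >> : T) = word s *~ z; last exact: closedBMz.
apply: word_coef_inj => m.
transitivity ((word s)@_(FMonom m) *~ z); last exact/esym/(morphBMz (mcoeffB _)).
by rewrite [LHS]mcoeffU word_coef fmP; case: eqP => _; rewrite ?mul0rz // mulr1n intz.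
Qed.

Let ext (F : seq 'I_n -> T) : T -> T := mmap intr (fun m : {fmonom 'I_n} => F m).
Fact word_extB F : {morph ext F : a b / a - b}. Proof. exact: raddfB. Qed.
Fact word_ext F s : ext F (word s) = F s.
Proof. by rewrite /ext mmapU mul1r. Qed.
Fact iota_word i : Defs.iota (@fl_gen n i) = word [:: i].
Proof. by rewrite /Defs.iota fl_lift_gen /word -fmuE. Qed.

Lemma tensor_model_exists : inhabited (tensor_model n).
Proof.
by split; apply: (@TensorModel n T word (fun s t => t@_(FMonom s)) ext (@Defs.iota n)
  word_nil word_cat (fun s => mcoeffB (FMonom s)) word_coef word_coef_inj word_ind
  word_extB word_ext (fl_liftB _) (fl_liftR _) iota_word (fun _ _ => erefl)).
Qed.
End TensorModelExists.

Section TensorCalculus.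
Variables (n : nat) (T : tensor_model n).
Local Notation mon := (@mon n T).
Local Notation coef := (@coef n T).
Local Notation lin_ext := (@lin_ext n T).
Implicit Types (s : seq 'I_n) (a b t : T) (u v : 'I_n -> T).

Lemma lin_ext0 F : lin_ext F 0 = 0.
Proof. exact: (morphB0 (@lin_extB n T F)). Qed.

Fixpoint mon_der u s : T :=
  if s is i :: s' then u i * mon s' + mon [:: i] * mon_der u s' else 0.

Definition ta_der u : T -> T := lin_ext (mon_der u).

Lemma ta_derB u a b : ta_der u (a - b) = ta_der u a - ta_der u b. Proof. exact: lin_extB. Qed.
Lemma ta_der0 u : ta_der u 0 = 0. Proof. exact: lin_ext0. Qed.
Lemma ta_derN u a : ta_der u (- a) = - ta_der u a.
Proof. exact: (morphBN (ta_derB u)). Qed.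
Lemma ta_derD u a b : ta_der u (a + b) = ta_der u a + ta_der u b.
Proof. exact: (morphBD (ta_derB u)). Qed.
Lemma ta_der_gen u i : ta_der u (mon [:: i]) = u i.
Proof. by rewrite /ta_der lin_ext_mon /= mon_nil mulr1 mulr0 addr0. Qed.

Lemma mon_der_cat u s s' : mon_der u (s ++ s') = mon_der u s * mon s' + mon s * mon_der u s'.
Proof.
elim: s => [|i s IH] /=; first by rewrite mul0r add0r mon_nil mul1r.
rewrite IH (mon_cat T s s') -[i :: s]cat1s (mon_cat T [:: i] s) mulrDr mulrDl addrA.
by congr (_ + _ + _); rewrite mulrA.
Qed.

Lemma ta_derM u a b : ta_der u (a * b) = ta_der u a * b + a * ta_der u b.
Proof.
elim/ta_ind: a => [|a a' IHa IHa'|s].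
- by rewrite !(mul0r, ta_der0) addr0.
- by rewrite mulrBl !ta_derB IHa IHa' !mulrBl opprD addrACA.
elim/ta_ind: b => [|b b' IHb IHb'|s'].
- by rewrite !(mulr0, ta_der0) addr0.
- by rewrite mulrBr !ta_derB IHb IHb' !mulrBr opprD addrACA.
by rewrite -mon_cat /ta_der !lin_ext_mon mon_der_cat.
Qed.

(* t = eps(t) + sum_i (rder i t) e_i *)
Definition mon_rder i s : T :=
  if rev s is j :: r then if j == i then mon (rev r) else 0 else 0.
Definition rder i : T -> T := lin_ext (mon_rder i).

Lemma rderB i a b : rder i (a - b) = rder i a - rder i b. Proof. exact: lin_extB. Qed.
Lemma rder0 i : rder i 0 = 0. Proof. exact: lin_ext0. Qed.
Lemma rder_nil i : rder i (mon [::]) = 0. Proof. by rewrite /rder lin_ext_mon. Qed.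
Lemma rder_rcons i s j : rder i (mon (rcons s j)) = if j == i then mon s else 0.
Proof. by rewrite /rder lin_ext_mon /mon_rder rev_rcons revK. Qed.

Lemma rder_coef i t s : coef s (rder i t) = coef (rcons s i) t.
Proof.
elim/ta_ind: t => [|a b IHa IHb|w]; first by rewrite rder0 !(morphB0 (coefB _)).
  by rewrite rderB !coefB IHa IHb.
elim/last_ind: w => [|w j _]; first by rewrite rder_nil (morphB0 (coefB _)) coef_mon; case: s.
rewrite rder_rcons coef_mon eqseq_rcons; case: (j == i); first by rewrite coef_mon andbT.
by rewrite (morphB0 (coefB _)) andbF.
Qed.

Definition eps t : int := coef [::] t.

Lemma rderMg i a j : rder i (a * mon [:: j]) = if j == i then a else 0.
Proof.
elim/ta_ind: a => [|a b IHa IHb|s]; first by rewrite mul0r rder0; case: ifP.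
  by rewrite mulrBl rderB IHa IHb; case: ifP; rewrite ?subr0.
by rewrite -mon_cat cats1 rder_rcons.
Qed.

Lemma rderM i a b : rder i (a * b) = a * rder i b + rder i a *~ eps b.
Proof.
elim/ta_ind: b => [|b b' IHb IHb'|s].
- by rewrite mulr0 rder0 /eps (morphB0 (coefB _)) mulr0z mulr0 addr0.
- by rewrite mulrBr !rderB IHb IHb' /eps coefB mulrBr mulrzBr opprD addrACA.
elim/last_ind: s => [|s j _].
  by rewrite rder_nil /eps coef_mon mon_nil mulr1 mulr0 add0r.
rewrite /eps coef_mon -cats1 (_ : (_ == [::]) = false); last by case: s.
by rewrite mulr0z addr0 mon_cat mulrA !rderMg; case: ifP; rewrite ?mulr0.
Qed.

(** Chain rule of Fox calculus: apply [ta_der u] to a = eps(a) + sum_j (rder j a) e_j, then strip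
    the last letter. The vanishing of eps(u_j) ensures that this letter comes from u_j and not from
    the factor before it. *)
Lemma rder_der i u a : (forall j, eps (u j) = 0) ->
  rder i (ta_der u a) = ta_der u (rder i a) + \sum_j rder j a * rder i (u j).
Proof.
move=> u0; elim/ta_ind: a => [|a b IHa IHb|s].
- by rewrite !(ta_der0, rder0) big1 ?addr0 // => j _; rewrite rder0 mul0r.
- rewrite !(ta_derB, rderB) IHa IHb opprD addrACA -sumrB; congr (_ + _).
  by apply: eq_bigr => j _; rewrite rderB mulrBl.
elim/last_ind: s => [|s l _].
  rewrite rder_nil ta_der0 /ta_der lin_ext_mon /= rder0 big1 ?addr0 // => j _.
  by rewrite rder_nil mul0r.
rewrite rder_rcons -cats1 mon_cat ta_derM ta_der_gen.
rewrite (morphBD (rderB i)) rderMg (rderM i (mon s)) u0 mulr0z addr0; congr (_ + _).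
  by case: ifP; rewrite ?ta_der0.
rewrite (bigD1 l) //= rderMg eqxx big1 ?addr0 // => j /negPf jl.
by rewrite rderMg eq_sym jl mul0r.
Qed.

Definition ta_hom k t := forall s, size s != k -> coef s t = 0.

Lemma rder_hom k i t : ta_hom k.+1 t -> ta_hom k (rder i t).
Proof.
move=> ht s sk; rewrite rder_coef; apply: ht.
by rewrite size_rcons eqSS.
Qed.

(** [rder] strips the last letter, the one that [Phi] contracts; so the cyclic class of this trace
    of a Jacobian matrix is [tr], see [tr_fdiv]. *)
Definition div u : T := \sum_i rder i (u i).

Lemma ta_der_sum u (I : Type) (r : seq I) (P : pred I) (F : I -> T) :
  ta_der u (\sum_(i <- r | P i) F i) = \sum_(i <- r | P i) ta_der u (F i).
Proof. exact: (big_morph _ (ta_derD u) (ta_der0 u)). Qed.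

Definition ta_brf u v : 'I_n -> T := fun i => ta_der u (v i) - ta_der v (u i).

(* The last term is the trace of a commutator of matrices, which vanishes in cyclic words:
   hence div induces a 1-cocycle. *)
Lemma div_brf u v : (forall j, eps (u j) = 0) -> (forall j, eps (v j) = 0) ->
  div (ta_brf u v) = ta_der u (div v) - ta_der v (div u)
   + \sum_i \sum_j (rder j (v i) * rder i (u j) - rder i (u j) * rder j (v i)).
Proof.
move=> u0 v0; rewrite /div /ta_brf !ta_der_sum.
have -> : \sum_i \sum_j (rder j (v i) * rder i (u j) - rder i (u j) * rder j (v i))
   = \sum_i \sum_j rder j (v i) * rder i (u j) - \sum_i \sum_j rder j (u i) * rder i (v j).
  rewrite [X in _ - X]exchange_big /= -sumrB; apply: eq_bigr => i _.
  by rewrite -sumrB.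
rewrite addrACA -opprD -!big_split /= -sumrB; apply: eq_bigr => i _.
by rewrite rderB !rder_der.
Qed.

Section Cyclic.
Variable k : nat.
Definition ta_comp t : tens n k := [ffun w : k.-tuple 'I_n => coef w t].
Definition cy t : cyc n k := zpi _ (ta_comp t).

Lemma ta_compB a b : ta_comp (a - b) = ta_comp a - ta_comp b.
Proof. by apply/ffunP => w; rewrite !ffunE coefB. Qed.
Lemma cyB a b : cy (a - b) = cy a - cy b. Proof. by rewrite /cy ta_compB zpiB. Qed.
Lemma cy0 : cy 0 = 0. Proof. exact: (morphB0 cyB). Qed.
Lemma cyD a b : cy (a + b) = cy a + cy b. Proof. exact: (morphBD cyB). Qed.
Lemma cy_sum (I : Type) (r : seq I) (P : pred I) (F : I -> T) :
  cy (\sum_(i <- r | P i) F i) = \sum_(i <- r | P i) cy (F i).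
Proof. exact: (big_morph _ cyD cy0). Qed.

Lemma cyM a b : cy (a * b) = cy (b * a).
Proof.
elim/ta_ind: a => [|a a' IHa IHa'|s]; first by rewrite mul0r mulr0.
  by rewrite mulrBl mulrBr !cyB IHa IHa'.
elim/ta_ind: b => [|b b' IHb IHb'|s']; first by rewrite mul0r mulr0.
  by rewrite mulrBl mulrBr !cyB IHb IHb'.
rewrite -!mon_cat; apply/zpiP/zspan_in; exists (size s'), (ta_comp (mon (s ++ s'))).
congr (_ - _); apply/ffunP => w; rewrite !ffunE !coef_mon /=; congr (nat_of_bool _)%:R.
by rewrite -{1}(rot_size_cat s' s) (inj_eq (@rot_inj _ _)).
Qed.

Lemma cy_commutator a b : cy (a * b - b * a) = 0.
Proof. by rewrite cyB cyM subrr. Qed.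
End Cyclic.

Definition of_tens k (x : tens n k) : T := \sum_(w : k.-tuple 'I_n) mon w *~ x w.

Lemma of_tensB k (x y : tens n k) : of_tens (x - y) = of_tens x - of_tens y.
Proof. by rewrite /of_tens -sumrB; apply: eq_bigr => w _; rewrite !ffunE mulrzBr. Qed.

Lemma of_tens_coef k (x : tens n k) (w : k.-tuple 'I_n) : coef w (of_tens x) = x w.
Proof.
rewrite /of_tens (morphB_sum (coefB _)) (bigD1 w) //= (morphBMz (coefB _)) coef_mon eqxx intz big1 ?addr0 // => w' nw.
by rewrite (morphBMz (coefB _)) coef_mon -val_eqE in nw *; rewrite (negPf nw) mul0rz.
Qed.

Lemma ta_comp_of_tens k (x : tens n k) : ta_comp k (of_tens x) = x.
Proof. by apply/ffunP => w; rewrite ffunE of_tens_coef. Qed.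

Lemma ta_hom_of_tens k (x : tens n k) : ta_hom k (of_tens x).
Proof.
move=> s sk; rewrite /of_tens (morphB_sum (coefB _)) big1 // => w _; rewrite (morphBMz (coefB _)) coef_mon.
by case: eqP => [ws|_]; rewrite ?mul0rz //; case/eqP: sk; rewrite -ws size_tuple.
Qed.

Lemma of_tensK k t : ta_hom k t -> of_tens (ta_comp k t) = t.
Proof.
move=> ht; apply: coef_inj => s; case: (eqVneq (size s) k) => [sk|sk].
  have -> : s = tval (tcast sk (in_tuple s)) by rewrite val_tcast.
  by rewrite of_tens_coef ffunE.
by rewrite ht // ta_hom_of_tens.
Qed.

(** Summation by parts: the rotation moves from the coordinates to the words, so that the relations
    defining [cyc] can be tested word by word. *)
Lemma sum_tens_rot (V : zmodType) k j (F : k.-tuple 'I_n -> V) (x : tens n k) :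
  \sum_w F w *~ (x - tens_rot j x) w = \sum_w (F w - F [tuple of rotr j w]) *~ x w.
Proof.
under eq_bigr => w _ do rewrite !ffunE mulrzBr.
under [RHS]eq_bigr => w _ do rewrite mulrzBl.
rewrite !sumrB; congr (_ - _).
have rK (w : k.-tuple 'I_n) : [tuple of rotr j [tuple of rot j w]] = w.
  by apply: val_inj; rewrite /= rotK.
have rK' (w : k.-tuple 'I_n) : [tuple of rot j [tuple of rotr j w]] = w.
  by apply: val_inj; rewrite /= rotrK.
rewrite [RHS](reindex_onto (fun w : k.-tuple 'I_n => [tuple of rot j w]) (fun w => [tuple of rotr j w])) //=.
by apply: eq_big => [w|w _]; rewrite rK ?eqxx.
Qed.

Lemma mon_rotr j s : exists a b, mon s - mon (rotr j s) = a * b - b * a.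
Proof.
rewrite /rotr; move: (size s - j)%N => i; exists (mon (take i s)), (mon (drop i s)).
by rewrite -!mon_cat cat_take_drop.
Qed.

Lemma cy_der_commutator k u a b : cy k (ta_der u (a * b - b * a)) = 0.
Proof.
rewrite ta_derB !ta_derM opprD [X in _ + X]addrC addrACA cyD.
by rewrite !cy_commutator addr0.
Qed.

End TensorCalculus.

(** * The trace of a family of Lie elements *)

Section Trace.
Variables (n : nat) (T : tensor_model n).
Local Notation L := (free_lie n).
Local Notation iota := (@tmi n T).
Implicit Types (u v : 'I_n -> L) (a b : L).

Lemma tmi0 : iota 0 = 0. Proof. exact: (morphB0 (@tmiB n T)). Qed.

Lemma cy_iota k a m : fl_hom k.+2 a -> cy m (iota a) = 0.
Proof.
move=> ha; have : (0 < k.+1)%N by [].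
elim/fl_homS_ind: ha => {k a} [i|k|k a b IHa IHb|j k a b _ _ _ _] //.
- by rewrite tmi0 cy0.
- by move=> k0; rewrite tmiB cyB IHa // IHb // subr0.
- by rewrite tmiR cy_commutator.
Qed.

Lemma iota_fder u a : iota (fder u a) = ta_der (fun i => iota (u i)) (iota a).
Proof.
elim/fl_ind: a => [i||a b IHa IHb|a IHa|a b IHa IHb].
- by rewrite fder_gen tmi_gen ta_der_gen.
- by rewrite fder0 tmi0 ta_der0.
- by rewrite fderD !(morphBD (@tmiB n T)) IHa IHb ta_derD.
- by rewrite fderN !(morphBN (@tmiB n T)) IHa ta_derN.
- rewrite fderR (morphBD (@tmiB n T)) !tmiR IHa IHb ta_derB !ta_derM opprD.
  by rewrite [in RHS](addrC (- _)) [RHS]addrACA.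
Qed.

Lemma iota_eps k a : fl_hom k.+1 a -> eps (iota a) = 0.
Proof. by move=> ha; rewrite /eps tmi_coef (iota_hom ha). Qed.

Lemma tmi_hom k a : fl_hom k a -> ta_hom k (iota a).
Proof. by move=> ha s sk; rewrite tmi_coef; apply: (iota_hom ha). Qed.

Definition fdiv u : T := div (fun i => iota (u i)).

Lemma ta_hom_sum k (I : Type) (r : seq I) (P : pred I) (F : I -> T) :
  (forall i, P i -> ta_hom k (F i)) -> ta_hom k (\sum_(i <- r | P i) F i).
Proof.
move=> hF m mk; rewrite (morphB_sum (coefB m)) big1 // => i Pi; exact: hF.
Qed.

Lemma fdiv_hom k u : (forall i, fl_hom k.+2 (u i)) -> ta_hom k.+1 (fdiv u).
Proof. by move=> hu; apply: ta_hom_sum => i _; apply/rder_hom/tmi_hom. Qed.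

Lemma fdivB u v : fdiv (fun i => u i - v i) = fdiv u - fdiv v.
Proof. by rewrite /fdiv /div -sumrB; apply: eq_bigr => i _; rewrite tmiB rderB. Qed.

Lemma fdiv0 : fdiv (fun=> 0) = 0.
Proof. by rewrite /fdiv /div big1 // => i _; rewrite tmi0 rder0. Qed.

Definition traceless k (t : T) := k = 0%N \/ cy k.+1 t = 0.

Lemma cy_der_traceless j k u (t : T) m : (forall i, fl_hom j.+2 (u i)) -> ta_hom k.+1 t ->
  traceless k t -> cy m (ta_der (fun i => iota (u i)) t) = 0.
Proof.
move=> hu ht [k0|].
  rewrite k0 in ht; rewrite -(of_tensK ht) /of_tens ta_der_sum cy_sum big1 // => -[[|i [|]] //= w1] _.
  by rewrite (morphBMz (ta_derB _)) (morphBMz (@cyB n T m)) ta_der_gen (cy_iota _ (hu i)) mul0rz.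
move=> /zpi_eq0; rewrite -[in ta_der _ _](of_tensK ht).
elim=> {t ht} [_ [i [t ->]]||x y _ IHx _ IHy].
- rewrite /of_tens sum_tens_rot ta_der_sum cy_sum big1 // => w _.
  rewrite (morphBMz (ta_derB _)) (morphBMz (@cyB n T m)).
  by have [a [b ->]] := mon_rotr T i w; rewrite cy_der_commutator mul0rz.
- by rewrite (morphB0 (@of_tensB n T _)) ta_der0 cy0.
- by rewrite of_tensB ta_derB cyB IHx IHy subr0.
Qed.

Lemma cy_fdiv_brf j k u v m :
  (forall i, fl_hom j.+2 (u i)) -> (forall i, fl_hom k.+2 (v i)) ->
  traceless j (fdiv u) -> traceless k (fdiv v) -> cy m (fdiv (brf u v)) = 0.
Proof.
move=> hu hv tu tv.
have -> : fdiv (brf u v) = div (ta_brf (fun i => iota (u i)) (fun i => iota (v i))).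
  by apply: eq_bigr => i _; rewrite /brf tmiB !iota_fder.
rewrite div_brf; try by move=> i; apply: iota_eps.
rewrite cyD cyB (cy_der_traceless m hu (fdiv_hom hv) tv) (cy_der_traceless m hv (fdiv_hom hu) tu).
rewrite subr0 add0r cy_sum big1 // => i _; rewrite cy_sum big1 // => l _.
exact: cy_commutator.
Qed.

Variable c : nat.

(** The values have degree k+2, and the canonical map to tensors survives truncation only up to
    degree c. *)
Lemma tr_fdiv k (D : Der n c) u : (k.+2 <= c)%N ->
  (forall i, val (dsum_at D k) (tl_gen c i) = tl_pi c (u i)) -> tr k D = cy k.+1 (fdiv u).
Proof.
move=> kc Du; rewrite /tr /cy; congr zpi; apply/ffunP => w.
rewrite /Phi sum_ffunE ffunE /fdiv /div (morphB_sum (coefB _)); apply: eq_bigr => i _.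
by rewrite ffunE (ffunE _ i) Du tl_tensE // ffunE rder_coef tmi_coef.
Qed.
End Trace.

Section Complex.
Variables (n c : nat) (T : tensor_model n).
Local Notation Fnc := (free_nil n c).
Local Notation A := (autseries Fnc).

(** Only some representing family is claimed to be traceless: in degrees above c every homogeneous
    family represents f. *)
Lemma gammaIA_traceless k (f : aut Fnc) : GammaIA Fnc k.+1 f ->
  exists u, [/\ forall i, fl_hom k.+2 (u i), jrep k f u & traceless k (fdiv T u)].
Proof.
elim: k f => [|k IH] f; first by case/jrep_of_aut => u [hu ju]; exists u; split=> //; left.
rewrite [nser (GammaIA _) _]lcsSS; elim=> {f} [_ [f [g [/IH [u [hu ju tu]] Ag ->]]]||f g _ [u [hu ju tu]] _ [v [hv jv tv]]|f _ [u [hu ju tu]]].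
- have [v [hv jv]] := jrep_of_aut Ag.
  exists (brf u v); split=> [i||].
  + by have := brf_hom hu hv i; rewrite addn0.
  + by have := jrepR hu hv ju jv; rewrite addn0.
  + by right; apply: (cy_fdiv_brf _ hu hv tu); left.
- exists (fun=> 0); split=> [i||]; [exact: fl_hom0|exact: jrep1|right].
  by rewrite fdiv0 cy0.
- exists (fun i => u i + v i); split=> [i||]; [exact: fl_homD|exact: jrepD|right].
  case: tu tv => [//|tu] [//|tv].
  have -> : (fun i => u i + v i) = (fun i => u i - (0 - v i)).
    by apply/funext => i; rewrite sub0r opprK.
  by rewrite fdivB fdivB !cyB tu tv fdiv0 cy0 !subr0.
- exists (fun i => 0 - u i); split=> [i||].
  + exact: fl_homB (fl_hom0 _ _) (hu i).
  + by rewrite -[f^-1%g]mul1g; apply: jrepB ju; apply: jrep1.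
  + by right; case: tu => [//|tu]; rewrite fdivB cyB tu fdiv0 cy0 subr0.
Qed.

Lemma Tr_johnson_i_star (x : lgr (GammaIA Fnc)) : Tr (johnson (i_star x)) = 0.
Proof.
apply: functional_extensionality_dep => k.
(* Index k of [cyc_lt] is degree k+2, hence the component k.+1 of the derivation; there [traceless]
   leaves only its second alternative. *)
have kc : (k.+3 <= c)%N by have := ltn_ord k; lia.
have [u [_ ju []//]] := gammaIA_traceless (grepP (dsum_at x k.+1)).
by rewrite /Tr (tr_fdiv T kc (fun i => johnson_gen (s := i_star x) i ju erefl)).
Qed.
End Complex.

Lemma zspan_morph (V W : zmodType) (S : set V) (S' : W -> Prop) (f : V -> W) x :
  {morph f : a b / a - b} -> S' 0 -> (forall a b, S' a -> S' b -> S' (a - b)) ->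
  zspan S x -> (forall y, S y -> S' (f y)) -> S' (f x).
Proof.
move=> fB S0 SB Sx fS; elim: Sx => {x} [x /fS //||x y _ IHx _ IHy]; first by rewrite (morphB0 fB).
by rewrite fB; apply: SB.
Qed.

Lemma zspan_sub (V : zmodType) (S S' : set V) x :
  zspan S x -> (forall y, S y -> zspan S' y) -> zspan S' x.
Proof.
by move=> Sx SS'; apply: (@zspan_morph _ _ S _ id) Sx SS' => //; [apply: zspan0|apply: zspanB].
Qed.

(** * The cokernel of the Johnson morphism *)

Section Words.
Variable n : nat.
Local Notation L := (free_lie n).
Local Notation e := (@fl_gen n).
Implicit Types (w : seq 'I_n) (v x y : L) (i j a b c : 'I_n).

Lemma fresh_letter w : (size w < n)%N -> exists b, b \notin w.
Proof.
move=> wn; apply/existsP; apply: contraLR wn; rewrite negb_exists => /forallP h.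
rewrite -leqNgt -{1}(card_ord n) cardE; apply: uniq_leq_size (enum_uniq _) _ => b _.
by have := h b; rewrite negbK.
Qed.

Definition adw w x : L := foldr (fun a y => lbr (e a) y) x w.

Lemma adw_cat w w' x : adw (w ++ w') x = adw w (adw w' x). Proof. exact: foldr_cat. Qed.
Lemma adwB w : {morph adw w : x y / x - y}.
Proof. by move=> x y; elim: w => [//|a w /= ->]; rewrite lbrBr. Qed.
Lemma adw_hom w k x : fl_hom k x -> fl_hom (size w + k) (adw w x).
Proof.
move=> hx; elim: w => [//|a w IH] /=; rewrite addSn -add1n.
by apply: fl_homR => //; apply: fl_hom_gen.
Qed.
Lemma adw_gen_hom w a k : size w = k -> fl_hom k.+1 (adw w (e a)).
Proof. by move=> <-; rewrite -addn1; apply/adw_hom/fl_hom_gen. Qed.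

(** The alphabet P is recorded because a letter chosen to be absent must stay absent while brackets
    are rewritten. *)
Definition adset m (P : seq 'I_n) v : set L :=
  [set y | exists w, [/\ size w = m, {subset w <= P} & y = adw w v]].

Lemma adset_br m (P : seq 'I_n) a x v : a \in P -> zspan (adset m P v) x ->
  zspan (adset m.+1 P v) (lbr (e a) x).
Proof.
move=> aP hx; apply: (zspan_morph _ _ _ hx); [exact: lbrBr|exact: zspan0|exact: zspanB|].
move=> _ [w [wm wP ->]]; apply: zspan_in; exists (a :: w); split=> //=; first by rewrite wm.
by move=> y; rewrite inE => /orP [/eqP ->|/wP].
Qed.

Lemma adset_sub m (P P' : seq 'I_n) x v : {subset P <= P'} ->
  zspan (adset m P v) x -> zspan (adset m P' v) x.
Proof.
move=> PP' hx; apply: zspan_sub hx _ => _ [w [wm wP ->]]; apply: zspan_in.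
by exists w; split=> // y /wP /PP'.
Qed.

(** The adjoint action of a bracket is the commutator of the adjoint actions, so ad of an iterated
    bracket expands into words in ad of the same letters. *)
Lemma ad_span w a v : zspan (adset (size w).+1 (a :: w) v) (lbr (adw w (e a)) v).
Proof.
elim: w v => [|c w IH] v /=.
  by apply: zspan_in; exists [:: a]; split.
have -> : lbr (lbr (e c) (adw w (e a))) v =
    lbr (e c) (lbr (adw w (e a)) v) - lbr (adw w (e a)) (lbr (e c) v).
  by rewrite lbr_der addrK.
apply: zspanB.
  apply: adset_br; first by rewrite !inE eqxx orbT.
  by apply: adset_sub (IH v) => y; rewrite !inE => /orP [->|->]; rewrite ?orbT.
apply: zspan_sub (IH (lbr (e c) v)) _ => _ [w' [w'm w'P ->]]; apply: zspan_in.
exists (rcons w' c); split; first by rewrite size_rcons w'm.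
  move=> y; rewrite mem_rcons !inE => /orP [->|/w'P]; first by rewrite !orbT.
  by rewrite inE => /orP [->|->]; rewrite ?orbT.
by rewrite -cats1 adw_cat.
Qed.

Lemma hom_span k v : fl_hom k.+1 v ->
  zspan [set y | exists w a, size w = k /\ y = adw w (e a)] v.
Proof.
move=> hv; elim/fl_homS_ind: hv => {k v} [i|k|k u v hu hv|j k u v _ _ hu hv].
- by apply: zspan_in; exists [::], i.
- exact: zspan0.
- exact: zspanB.
- apply: (zspan_morph (f := fun x => lbr x v) _ _ _ hu); [by move=> x y; rewrite lbrBl|exact: zspan0|exact: zspanB|].
  move=> _ [w [a [wj ->]]].
  apply: (zspan_morph _ _ _ hv); [by move=> x y; rewrite lbrBr|exact: zspan0|exact: zspanB|].
  move=> _ [w' [b [w'k ->]]].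
  apply: zspan_sub (ad_span w a _) _ => _ [w2 [w2m _ ->]]; apply: zspan_in.
  by exists (w2 ++ w'), b; rewrite adw_cat size_cat w2m wj w'k addSn.
Qed.

(* e_i^* (x) x, and the derivation it defines *)
Definition sing i x : 'I_n -> L := fun j => if j == i then x else 0.
Definition fsing i x : L -> L := fder (sing i x).

Lemma singB i : {morph sing i : x y / x - y}.
Proof.
move=> x y; apply/funext => j; rewrite addrfctE opprfctE /sing.
by case: ifP => _; rewrite ?subr0.
Qed.
Lemma sing_hom i k x : fl_hom k x -> forall j, fl_hom k (sing i x j).
Proof. by move=> hx j; rewrite /sing; case: ifP => _ //; apply: fl_hom0. Qed.

Lemma fsing_gen i x a : fsing i x (e a) = if a == i then x else 0.
Proof. by rewrite /fsing fder_gen. Qed.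

Lemma fsing_adw i x w y : i \notin w -> fsing i x (adw w y) = adw w (fsing i x y).
Proof.
elim: w => [//|a w IH]; rewrite inE negb_or => /andP [ia iw] /=.
by rewrite /fsing fderR -!/(fsing i x _) fsing_gen eq_sym (negPf ia) lbr0l add0r IH.
Qed.

Lemma adw0 w : adw w 0 = 0. Proof. exact: (morphB0 (adwB w)). Qed.

Lemma fsing_adw0 i x w a : i \notin w -> a != i -> fsing i x (adw w (e a)) = 0.
Proof. by move=> iw ai; rewrite fsing_adw // fsing_gen (negPf ai) adw0. Qed.

Lemma brf_sing i x j y :
  brf (sing i x) (sing j y) = sing j (fsing i x y) - sing i (fsing j y x).
Proof.
apply/funext => l; rewrite addrfctE opprfctE /brf -/(fsing i x _) -/(fsing j y _) /sing.
by congr (_ - _); case: ifP => _ //; rewrite /fsing fder0.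
Qed.

(** Each occurrence of e_i is replaced by v in turn; antisymmetry and [ad_span] then move v to the
    innermost place without new letters. *)
Lemma fsing_span i v w a : zspan (adset (size w) (a :: w) v) (fsing i v (adw w (e a))).
Proof.
elim: w => [|c w IH] /=.
  rewrite fsing_gen; case: ifP => _; last exact: zspan0.
  by apply: zspan_in; exists [::]; split.
rewrite /fsing fderR -!/(fsing i v _) fsing_gen; apply: zspanD.
  case: ifP => _; last by rewrite lbr0l; apply: zspan0.
  rewrite lbrC; apply: zspanN; apply: adset_sub (ad_span w a v) => y.
  by rewrite !inE => /orP [->|->]; rewrite ?orbT.
apply: adset_br; first by rewrite !inE eqxx orbT.
by apply: adset_sub IH => y; rewrite !inE => /orP [->|->]; rewrite ?orbT.
Qed.

Definition psi b w : 'I_n -> L := sing b (adw w (e b)).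

(* The value 0 is junk: it is taken only if every letter occurs in w. *)
Definition psit w : 'I_n -> L := if [pick b | b \notin w] is Some b then psi b w else 0.

Definition Psi k (t : tens n k) : 'I_n -> L := \sum_(w : k.-tuple 'I_n) psit w *~ t w.

Lemma psi_hom b w k : size w = k -> forall i, fl_hom k.+1 (psi b w i).
Proof. by move=> wk; apply/sing_hom/adw_gen_hom. Qed.

Lemma fam_sumE (I : Type) (r : seq I) (P : pred I) (F : I -> 'I_n -> L) j :
  (\sum_(i <- r | P i) F i) j = \sum_(i <- r | P i) F i j.
Proof. exact: (big_morph (fun f : 'I_n -> L => f j)). Qed.

Lemma Psi_hom k (t : tens n k) i : fl_hom k.+1 (Psi t i).
Proof.
rewrite /Psi fam_sumE; apply: fl_hom_sum => w _; rewrite fun_mulzE; apply: fl_homMz.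
rewrite /psit; case: pickP => [b _|_]; first by apply: psi_hom; rewrite size_tuple.
exact: fl_hom0.
Qed.

Lemma PsiB k : {morph @Psi k : s t / s - t}.
Proof. by move=> s t; rewrite /Psi -sumrB; apply: eq_bigr => w _; rewrite !ffunE mulrzBr. Qed.
End Words.

(** * Reduction modulo the subring generated by degree 1 *)

Section Satoh.
Variable n : nat.
Local Notation L := (free_lie n).
Local Notation e := (@fl_gen n).
Implicit Types (w : seq 'I_n) (x y : L) (i a b c : 'I_n) (u v : 'I_n -> L).
Variable I : nat -> ('I_n -> L) -> Prop.
Hypothesis I1 : forall u, (forall i, fl_hom 2 (u i)) -> I 0 u.
Hypothesis IB : forall k u v, I k u -> I k v -> I k (u - v).
Hypothesis IR : forall (j k : nat) u v, I j u -> I k v -> I (j + k).+1 (brf u v).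
Hypothesis I0 : forall k, I k 0.

Lemma IN k u : I k u -> I k (- u).
Proof. exact: (closedBN (I0 k) (@IB k)). Qed.
Lemma ID k u v : I k u -> I k v -> I k (u + v).
Proof. exact: (closedBD (I0 k) (@IB k)). Qed.
Lemma Itrans k u v (z : 'I_n -> L) : I k (u - v) -> I k (v - z) -> I k (u - z).
Proof. by move=> h1 h2; have := ID h1 h2; rewrite addrA subrK. Qed.
Lemma Isym k u v : I k (u - v) -> I k (v - u).
Proof. by move=> h; rewrite -opprB; apply: IN. Qed.
Lemma Iz k u (z : int) : I k u -> I k (u *~ z).
Proof. exact: (closedBMz (I0 k) (@IB k)). Qed.
Lemma Isum k (J : Type) (r : seq J) (P : pred J) (F : J -> 'I_n -> L) :
  (forall j, P j -> I k (F j)) -> I k (\sum_(j <- r | P j) F j).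
Proof. exact: (closedB_sum (I0 k) (@IB k)). Qed.

(** If i does not occur in y and c != i, then e_i^* (x) [e_c, y] is the bracket of e_i^* (x) y with
    e_i^* (x) [e_c, e_i], which has degree 1; so letters can be peeled off one at a time. *)
Lemma I_absent i c w a : i \notin c :: w -> a != i -> I (size w) (sing i (adw (c :: w) (e a))).
Proof.
elim: w c => [|d w IH] c.
  move=> _ ai; apply: I1 => j; apply: sing_hom; exact: (@adw_gen_hom _ [:: c]).
rewrite inE negb_or => /andP [ic iw] ai.
have h2 : I 0 (sing i (lbr (e c) (e i))) by apply: I1 => j; apply: sing_hom; apply: (@adw_gen_hom _ [:: c]).
have := IR (IH d iw ai) h2; rewrite addn0 brf_sing.
rewrite [fsing i _ (adw _ _)]fsing_adw0 // [sing i 0](morphB0 (singB i)) subr0.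
by rewrite /fsing fderR -!/(fsing _ _ _) !fsing_gen eqxx eq_sym (negPf ic) lbr0l add0r.
Qed.

(** The bracket of e_b^* (x) y, which lies in I by [I_absent], with e_i^* (x) [e_a, e_b], of degree
    1. *)
Lemma I_substitute i a b c w a0 (y := adw (c :: w) (e a0)) :
  b != i -> b != a -> b \notin c :: w -> b != a0 ->
  I (size w).+1 (sing i (lbr (e a) y) - sing b (fsing i (lbr (e a) (e b)) y)).
Proof.
move=> bi ba bw ba0.
have h2 : I 0 (sing i (lbr (e a) (e b))) by apply: I1 => j; apply: sing_hom; apply: (@adw_gen_hom _ [:: a]).
have h1 : I (size w) (sing b y) by apply: I_absent => //; rewrite eq_sym.
have := IR h1 h2; rewrite addn0 brf_sing.
by rewrite {1}/fsing fderR -!/(fsing _ _ _) !fsing_gen eqxx eq_sym (negPf ba) lbr0l add0r.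
Qed.

(** The bracket of e_b^* (x) (ad w')(e_c) with e_c^* (x) (ad w)(e_b). Both lie in I by [I_absent],
    which requires nonempty words. *)
Lemma I_shuffle b c w w' : b != c -> b \notin w ++ w' -> c \notin w ++ w' ->
  (0 < size w)%N -> (0 < size w')%N -> I (size w + size w').-1 (psi c (w ++ w') - psi b (w' ++ w)).
Proof.
case: w w' => [//|x w] [//|y w'] bc.
rewrite mem_cat negb_or => /andP [bw bw']; rewrite mem_cat negb_or => /andP [cw cw'] _ _.
have cb : c != b by rewrite eq_sym.
have h1 : I (size w') (sing b (adw (y :: w') (e c))) by apply: I_absent.
have h2 : I (size w) (sing c (adw (x :: w) (e b))) by apply: I_absent.
have := IR h1 h2; rewrite brf_sing !fsing_adw // !fsing_gen !eqxx -!adw_cat.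
by rewrite /psi /= addnS /= addnC.
Qed.

Section Degree.
Variable k : nat.
Hypothesis k_gt0 : (0 < k)%N.
Hypothesis kn : (k.+3 <= n)%N.

Lemma I_rot_shuffle b c w (j : nat) : size w = k.+1 -> b != c -> b \notin w -> c \notin w ->
  (0 < j < k.+1)%N -> I k (psi c w - psi b (rot j w)).
Proof.
move=> wk bc bw cw /andP [j0 jk].
have := @I_shuffle b c (take j w) (drop j w) bc.
rewrite cat_take_drop -size_cat cat_take_drop wk; apply => //.
  by rewrite size_takel ?wk ?(ltnW jk).
by rewrite size_drop wk subn_gt0.
Qed.

Lemma I_rot1 b w : size w = k.+1 -> b \notin w -> I k (psi b w - psi b (rot 1 w)).
Proof.
move=> wk bw.
have [|c] := @fresh_letter n (b :: w); first by rewrite /= wk.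
rewrite inE negb_or => /andP [cb cw].
(* A word of length at least 3 can be cut after one or after two letters: cutting [rotr 1 w] in both
   ways relates psi_c of it to psi_b of w and to psi_b of [rot 1 w], and psi_c cancels. *)
have [k1|k2] := leqP k 1; last first.
  have wE : w = rot 1 (rotr 1 w) by rewrite rotrK.
  have rw : rot 2 (rotr 1 w) = rot 1 w.
    by rewrite -[2%N]addn1 rotD ?size_rotr ?wk // rotrK.
  have sz : size (rotr 1 w) = k.+1 by rewrite size_rotr.
  have bw' : b \notin rotr 1 w by rewrite mem_rotr.
  have cw' : c \notin rotr 1 w by rewrite mem_rotr.
  have bc : b != c by rewrite eq_sym.
  have h1 := I_rot_shuffle (j := 1) sz bc bw' cw' k_gt0.
  have h2 := I_rot_shuffle (j := 2) sz bc bw' cw' k2.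
  by rewrite rw in h2; rewrite -wE in h1; apply: Itrans (Isym h1) h2.
(* A word of two letters has a single cut. Here the difference is, by Jacobi, a multiple of e_b^*
   (x) [e_b, [e_x, e_y]], and [I_substitute] applies with nothing to substitute, as b is neither x
   nor y. *)
have {k1} k1 : k = 1%N by apply/eqP; rewrite eqn_leq k1.
move: wk bw cw; rewrite k1; case: w => [|x [|y [|]]] // _.
rewrite !inE !negb_or => /andP [bx by_] /andP [cx cy_].
have -> : psi b [:: x; y] - psi b (rot 1 [:: x; y]) = - sing b (lbr (e b) (adw [:: x] (e y))).
  rewrite /psi -singB -(morphBN (singB b)) /=; congr sing.
  by rewrite -(lbrC (lbr (e x) (e y)) (e b)) (lbr_der (e x) (e y)) addrK.
apply: IN.
have := @I_substitute b b c x [::] y cb cb; rewrite inE => /(_ cx cy_).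
rewrite fsing_adw0 ?inE //; last by rewrite eq_sym.
by rewrite (morphB0 (singB _)) subr0.
Qed.

Lemma I_rot b w (j : nat) : size w = k.+1 -> b \notin w -> I k (psi b w - psi b (rot j w)).
Proof.
move=> wk bw; elim: j => [|j IH]; first by rewrite rot0 subrr.
have [jk|jk] := ltnP j (size w); last by rewrite rot_oversize ?subrr // ltnW.
rewrite -[j.+1]add1n rotD ?add1n //; apply: Itrans IH _.
by apply: I_rot1; rewrite ?size_rot ?mem_rot.
Qed.

Lemma I_psi_indep b c w : size w = k.+1 -> b \notin w -> c \notin w -> I k (psi b w - psi c w).
Proof.
move=> wk bw cw; case: (eqVneq b c) => [->|bc]; first by rewrite subrr.
rewrite eq_sym in bc.
exact: Itrans (I_rot_shuffle (j := 1) wk bc cw bw k_gt0) (Isym (I_rot1 wk cw)).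
Qed.

Lemma I_psit b w : size w = k.+1 -> b \notin w -> I k (psi b w - psit w).
Proof.
move=> wk bw; rewrite /psit; case: pickP => [c cw|/(_ b)]; first exact: I_psi_indep.
by rewrite bw.
Qed.

Lemma I_psit_rotr w (j : nat) : size w = k.+1 -> I k (psit w - psit (rotr j w)).
Proof.
move=> wk; have [|b bw] := @fresh_letter n w; first by rewrite wk ltnW.
apply: Itrans (Isym (I_psit wk bw)) _; apply: Itrans (I_rot (size w - j) wk bw) _.
by apply: I_psit; rewrite ?size_rotr ?mem_rotr.
Qed.

Lemma I_Psi_zpi (t : tens n k.+1) : zpi _ t = 0 :> cyc n k.+1 -> I k (Psi t).
Proof.
move=> /zpi_eq0; elim=> {t} [_ [j [t ->]]||s t _ IHs _ IHt].
- rewrite /Psi sum_tens_rot; apply: Isum => w _; apply: Iz.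
  by apply: I_psit_rotr; rewrite size_tuple.
- by rewrite (morphB0 (@PsiB n _)).
- by rewrite PsiB; apply: IB.
Qed.

Definition mod_Psi u := exists t : tens n k.+1, I k (u - Psi t).

Lemma mod_Psi_I u : I k u -> mod_Psi u.
Proof. by move=> h; exists 0; rewrite (morphB0 (@PsiB n _)) subr0. Qed.
Lemma mod_PsiB u v : mod_Psi u -> mod_Psi v -> mod_Psi (u - v).
Proof.
move=> [s hs] [t ht]; exists (s - t); rewrite PsiB.
have := IB hs ht; congr (I k); rewrite !opprB.
by rewrite [LHS](AC (2*2) ((1*4)*(3*2))).
Qed.

Lemma mod_Psi_psi b w : size w = k.+1 -> b \notin w -> mod_Psi (psi b w).
Proof.
move=> wk bw; pose w0 : k.+1.-tuple 'I_n := tcast wk (in_tuple w).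
have w0E : w0 = w :> seq _ by rewrite val_tcast.
exists [ffun w => (w == w0)%:R].
rewrite /Psi (bigD1 w0) //= ffunE eqxx mulr1z big1 ?addr0 => [|w' /negPf nw]; last by rewrite ffunE nw mulr0z.
by rewrite w0E; apply: I_psit.
Qed.

Lemma mod_Psi_trans u v : I k (u - v) -> mod_Psi v -> mod_Psi u.
Proof. by move=> h [t ht]; exists t; apply: Itrans h ht. Qed.

Lemma mod_Psi_word i a w a0 : size w = k -> mod_Psi (sing i (adw (a :: w) (e a0))).
Proof.
move=> wk; have [iw|] := boolP (i \in a :: rcons w a0); last first.
  rewrite inE mem_rcons inE !negb_or => /and3P [ia ia0 iw].
  apply: mod_Psi_I; rewrite -wk; apply: I_absent; last by rewrite eq_sym.
  by rewrite inE negb_or ia.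
(* The word has k+2 letters, so k+3 <= n leaves one free; i occurs in the word, hence b != i. *)
have [|b bw] := @fresh_letter n (a :: rcons w a0); first by rewrite /= size_rcons wk.
have bi : b != i by apply: contraNneq bw => ->.
move: bw; rewrite inE mem_rcons inE !negb_or => /and3P [ba ba0 bw].
case: w wk iw bw => [k0|c w wk iw bw]; first by have := k_gt0; rewrite -k0.
have := @I_substitute i a b c w a0 bi ba bw ba0.
rewrite -[(size w).+1]/(size (c :: w)) wk => /mod_Psi_trans; apply.
apply: (zspan_morph _ _ _ (fsing_span i (lbr (e a) (e b)) (c :: w) a0)).
- exact: singB.
- exact: mod_Psi_I.
- exact: mod_PsiB.
move=> _ [w' [w'k w'P ->]].
(* The letter b stands only in the innermost place, which is the form of psi_b. *)
have -> : adw w' (lbr (e a) (e b)) = adw (rcons w' a) (e b) by rewrite -cats1 adw_cat.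
apply: mod_Psi_psi; first by rewrite size_rcons w'k wk.
rewrite mem_rcons inE negb_or ba; apply/negP => /w'P.
by rewrite inE (negPf ba0) (negPf bw).
Qed.

Lemma mod_Psi_all u : (forall i, fl_hom k.+2 (u i)) -> mod_Psi u.
Proof.
move=> hu.
have -> : u = \sum_i sing i (u i).
  apply/funext => j; rewrite fam_sumE (bigD1 j) //= /sing eqxx big1 ?addr0 // => i ij.
  by rewrite eq_sym (negPf ij).
apply: (closedB_sum (P := mod_Psi)) => [||i _]; [exact: mod_Psi_I|exact: mod_PsiB|].
apply: (zspan_morph _ _ _ (hom_span (hu i))).
- exact: singB.
- exact: mod_Psi_I.
- exact: mod_PsiB.
move=> _ [[|a w] [a0 [// [wk] ->]]]; exact: mod_Psi_word.
Qed.
End Degree.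
End Satoh.

Section TracePsi.
Variables (n : nat) (T : tensor_model n).
Local Notation L := (free_lie n).
Implicit Types (u v : 'I_n -> L).

Lemma fdiv_morphB : {morph fdiv T : u v / u - v}.
Proof. exact: fdivB. Qed.

(** In the expansion of the nested commutators, w b is the only monomial ending with b. *)
Lemma rder_adw b w : b \notin w -> rder b (tmi T (adw w (fl_gen b))) = mon T w.
Proof.
elim: w => [_|a w IH].
  by rewrite /= tmi_gen -[[:: b]]/(rcons [::] b) rder_rcons eqxx.
rewrite inE negb_or => /andP [ba bw] /=; rewrite tmiR tmi_gen rderB rderMg eq_sym (negPf ba) subr0.
rewrite rderM IH // -[[:: a]]/(rcons [::] a) rder_rcons eq_sym (negPf ba) mul0rz addr0 /=.
by rewrite -mon_cat.
Qed.

Lemma fdiv_psi b w : b \notin w -> fdiv T (psi b w) = mon T w.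
Proof.
move=> bw; rewrite /fdiv /div (bigD1 b) //= /psi /sing eqxx rder_adw // big1 ?addr0 // => i /negPf ib.
by rewrite ib tmi0 rder0.
Qed.

Lemma cy_fdiv_Psi k (t : tens n k) : (k < n)%N -> cy k (fdiv T (Psi t)) = zpi _ t.
Proof.
move=> kn; rewrite /Psi (morphB_sum fdiv_morphB) -[in RHS](ta_comp_of_tens T t); congr cy.
apply: eq_bigr => w _; rewrite (morphBMz fdiv_morphB) /psit; case: pickP => [b bw|bw].
  by rewrite fdiv_psi.
have [|b] := @fresh_letter n w; first by rewrite size_tuple.
by rewrite bw.
Qed.
End TracePsi.

(** * Exactness of the sequence *)

Section Exactness.
Variables (n c : nat) (T : tensor_model n).
Local Notation L := (free_lie n).
Local Notation Fnc := (free_nil n c).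
Local Notation A := (autseries Fnc).

(** The instance of I in Satoh's reduction. Tracelessness is built in, so that u = Psi t modulo I
    and tr u = 0 immediately give t = 0 in cyclic words; then Psi t, and hence u, lies in I. *)
Definition ia_image k (u : 'I_n -> L) :=
  [/\ forall i, fl_hom k.+2 (u i), traceless k (fdiv T u) &
      exists2 f : aut Fnc, GammaIA Fnc k.+1 f & jrep k f u].

Lemma ia_image1 u : (forall i, fl_hom 2 (u i)) -> ia_image 0 u.
Proof.
move=> hu; split=> //; first by left.
by have [f ju] := jrep_exists c hu; exists f => //; case: ju.
Qed.

Lemma ia_imageB k u v : ia_image k u -> ia_image k v -> ia_image k (u - v).
Proof.
move=> [hu tu [f Ff ju]] [hv tv [g Fg jv]]; split.
- by move=> i; apply: fl_homB.
- case: tu tv => [k0 _|tu [k0|tv]]; [by left|by left|right].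
  by rewrite fdiv_morphB cyB tu tv subr0.
- by exists (f * g^-1)%g; [apply: nserM => //; apply: nserV|apply: jrepB].
Qed.

Lemma ia_imageR j k u v : ia_image j u -> ia_image k v -> ia_image (j + k).+1 (brf u v).
Proof.
move=> [hu tu [f Ff ju]] [hv tv [g Fg jv]]; split; first exact: brf_hom.
  by right; apply: cy_fdiv_brf tu tv.
by exists [~ f, g]%g; [rewrite -addSn -addnS; apply: nserR|apply: jrepR].
Qed.

Lemma ia_image0 k : ia_image k 0.
Proof.
split; first by move=> i; apply: fl_hom0.
  by right; rewrite (morphB0 (@fdiv_morphB n T)) cy0.
by exists 1%g; [apply: nser1|apply: jrep1].
Qed.

Lemma ia_image_traceless k u : (k.+3 <= n)%N -> (forall i, fl_hom k.+2 (u i)) ->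
  traceless k (fdiv T u) -> ia_image k u.
Proof.
move=> kn hu; case: k kn hu => [|k] kn hu; first by move=> _; apply: ia_image1.
case=> // tu.
have [t ut] := mod_Psi_all ia_image1 ia_imageB ia_imageR ia_image0 (isT : 0 < k.+1)%N kn hu.
suff It : ia_image k.+1 (Psi t).
  by have := ID ia_imageB ia_image0 ut It; rewrite subrK.
apply: (I_Psi_zpi ia_image1 ia_imageB ia_imageR ia_image0 _ kn) => //.
have [_ [//|tut] _] := ut; move: tut; rewrite fdiv_morphB cyB tu sub0r cy_fdiv_Psi; last exact: ltnW.
by move/eqP; rewrite oppr_eq0 => /eqP.
Qed.

Hypothesis cn : (c.+1 <= n)%N.

Lemma Tr_kernel (D : Der n c) : Tr D = 0 ->
  exists x : lgr (GammaIA Fnc), johnson (i_star x) = D.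
Proof.
move=> D0.
have H k : exists fu : aut Fnc * ('I_n -> L), [/\ GammaIA Fnc k.+1 fu.1, jrep k fu.1 fu.2 &
    forall i, val (dsum_at D k) (tl_gen c i) = tl_pi c (fu.2 i)].
  have [u [hu Du]] := der_gen_lift (dsum_at D k).
  (* Values of degree k+2 > c vanish after truncation, so the identity automorphism will do. *)
  have [kc|ck] := leqP k.+2 c; last first.
    exists (1%g, fun=> 0); split=> [||i]; [exact: (nser1 (GammaIA Fnc))|exact: jrep1|].
    rewrite Du (tl_pi_hom ck (hu i)); exact/esym/zpi0.
  have [||_ _ [f Ff ju]] := @ia_image_traceless k u _ hu; first by apply: leq_trans cn.
    case: k hu kc Du => [|k] hu kc Du; first by left.
    right; rewrite -(tr_fdiv T kc Du).
    have kc' : (k < c.-2)%N by lia.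
    by have := congr1 (fun y : cyc_lt n c => y (Ordinal kc')) D0.
  by exists (f, u).
have /choice [fu hfu] := H.
have supp : exists N, forall k, (N <= k)%N -> gcls (GammaIA Fnc) k (fu k).1 = 0.
  exists c => k ck; have [_ [Af _] _] := hfu k.
  by rewrite (autser_ge _ Af) ?gcls1 //; lia.
exists (mkdsum supp); apply: dsumP => k; apply: der_eq => i.
have [Ff ju ->] := hfu k; apply: (johnson_gen i ju).
exact/esym/(gr_incl_cls (@GammaIA_sub Fnc) Ff).
Qed.

Lemma Tr_surj (y : cyc_lt n c) : exists D : Der n c, Tr D = y.
Proof.
have H m : exists u : 'I_n -> L, (forall i, fl_hom m.+2 (u i)) /\
    forall k : 'I_c.-2, m = k.+1 -> cy k.+2 (fdiv T u) = y k.
  (* Index 0 is degree 1, which has no counterpart in [cyc_lt]. *)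
  case: m => [|m]; first by exists (fun=> 0); split=> [i|k //]; apply: fl_hom0.
  have [mc|cm] := ltnP m c.-2; last first.
    exists (fun=> 0); split=> [i|k [mk]]; first exact: fl_hom0.
    by move: cm; rewrite mk leqNgt ltn_ord.
  exists (Psi (repr (y (Ordinal mc)))); split=> [i|k [mk]]; first exact: Psi_hom.
  have -> : k = Ordinal mc by apply: val_inj.
  rewrite cy_fdiv_Psi; first exact: zpi_repr.
  by rewrite /=; lia.
have /choice [u hu] := H.
have hom m i : fl_hom m.+2 (u m i) by case: (hu m).
have supp : exists N, forall m, (N <= m)%N -> tder_der c (hom m) = 0.
  exists c => m cm; apply: der_eq => i /=.
  by rewrite (tder_pi c (hom m)) fder_gen; apply: (tl_pi_hom (k := m.+2)) => //; lia.
exists (mkdsum supp : Der n c); apply: functional_extensionality_dep => k.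
have kc : (k.+3 <= c)%N by have := ltn_ord k; lia.
rewrite /Tr (tr_fdiv T (u := u k.+1) kc); first by have [_ ->] := hu k.+1.
by move=> i; rewrite /= (tder_pi c (hom k.+1)) fder_gen.
Qed.
End Exactness.

Theorem corollary2p47 (n c : nat) (n_gt0 : (0 < n)%N) (c_gt0 : (0 < c)%N) :
  [/\ {morph @johnson n c : s t / s + t >-> s + t} /\ bijective (@johnson n c),
      forall x : lgr (GammaIA (free_nil n c)), Tr (johnson (i_star x)) = 0 &
      (c.+1 <= n)%N ->
        (forall D : Der n c, Tr D = 0 ->
           exists x : lgr (GammaIA (free_nil n c)), johnson (i_star x) = D) /\
        (forall y : cyc_lt n c, exists D : Der n c, Tr D = y)].
Proof.
have [T] := tensor_model_exists n; split.
- by split; [apply: johnsonD|apply: johnson_bij].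
- exact: Tr_johnson_i_star.
- by move=> cn; split; [apply: Tr_kernel|apply: Tr_surj].
Qed.
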